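(* Let $0<\xi<1$ and let $(z,z')$ be in the principal or complementary series. The functions $\psi_a=\psi_a(x;z,z',\xi)$ of $x\in\mathbb Z'$, where $a$ ranges over $\mathbb Z'$, form an orthonormal basis in the Hilbert space $\ell^2(\mathbb Z')$.
   Context: $\mathbb Z'=\mathbb Z+\frac12$. The pair $(z,z')$ is in the principal series if $z,z'$ are not real and are complex conjugate to each other; in the complementary series if $z,z'$ are both real and lie in the same open interval $(m,m+1)$ with $m\in\mathbb Z$. $F(A,B;C;w)$ is the Gauss hypergeometric function ${}_2F_1$ (continued to $w\in\mathbb C\setminus[1,\infty)$); $F(A,B;C;w)/\Gamma(C)$ is understood as its extension by continuity to all $C\in\mathbb C$. For $a,x\in\mathbb Z'$, $$\psi_a(x;z,z',\xi)=\left(\frac{\Gamma(x+z+\frac12)\Gamma(x+z'+\frac12)}{\Gamma(z-a+\frac12)\Gamma(z'-a+\frac12)}\right)^{\frac12}\xi^{\frac12(x+a)}(1-\xi)^{\frac12(z+z')-a}\,\frac{F(-z+a+\frac12,-z'+a+\frac12;x+a+1;\frac{\xi}{\xi-1})}{\Gamma(x+a+1)},$$ where the quantity under the square root is positive and the positive root is taken. *)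

(* Defs.v *)
(* Built on the Stdlib reals and Coquelicot. *)
From Stdlib Require Import Reals ZArith List ClassicalDescription.
From Coquelicot Require Import Coquelicot.

Open Scope R_scope.

(* [HalfInt k] stands for the half-integer k + 1/2. *)
Record half_integer := HalfInt { hfloor : Z }.

Definition hval (x : half_integer) : R := IZR (hfloor x) + / 2.

(** * Hilbert space l^2 of complex functions on the half-integers *)

(* The sum of u over the half-integers, as the sum over the positive ones
   n + 1/2 plus the sum over the negative ones - (n + 1/2).  Only absolutely
   convergent sums are used, so that the order of summation is immaterial. *)
Definition is_hsum (u : half_integer -> C) (s : C) : Prop :=
  exists s1 s2 : C,
    is_series (V := C_NormedModule) (fun n => u (HalfInt (Z.of_nat n))) s1 /\
    is_series (V := C_NormedModule)
      (fun n => u (HalfInt (- Z.of_nat n - 1)%Z)) s2 /\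
    s = (s1 + s2)%C.

Definition in_l2 (f : half_integer -> C) : Prop :=
  ex_series (fun n => Cmod (f (HalfInt (Z.of_nat n))) ^ 2) /\
  ex_series (fun n => Cmod (f (HalfInt (- Z.of_nat n - 1)%Z)) ^ 2).

Definition l2_norm (f : half_integer -> C) : R :=
  sqrt (Series (fun n => Cmod (f (HalfInt (Z.of_nat n))) ^ 2) +
        Series (fun n => Cmod (f (HalfInt (- Z.of_nat n - 1)%Z)) ^ 2)).

Definition is_l2_inner (f g : half_integer -> C) (s : C) : Prop :=
  is_hsum (fun x => f x * Cconj (g x))%C s.

Definition lin_comb (e : half_integer -> half_integer -> C)
    (l : list (C * half_integer)) (x : half_integer) : C :=
  fold_right (fun p s => fst p * e (snd p) x + s)%C (RtoC 0) l.

(* An orthonormal family whose linear span is dense. *)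
Definition l2_orthonormal_basis (e : half_integer -> half_integer -> C) : Prop :=
  (forall a, in_l2 (e a)) /\
  (forall a, is_l2_inner (e a) (e a) 1) /\
  (forall a b, a <> b -> is_l2_inner (e a) (e b) 0) /\
  (forall f, in_l2 f -> forall eps : R, 0 < eps ->
     exists l : list (C * half_integer),
       l2_norm (fun x => f x - lin_comb e l x)%C < eps).

(** * Gamma and Gauss hypergeometric functions *)

(* t ^ s for t > 0, that is exp (s ln t). *)
Definition RCpower (t : R) (s : C) : C :=
  (exp (Re s * ln t) * cos (Im s * ln t), exp (Re s * ln t) * sin (Im s * ln t)).

(* Pochhammer symbol A (A + 1) ... (A + n - 1). *)
Fixpoint poch (A : C) (n : nat) : C :=
  match n with
  | O => 1
  | S m => poch A m * (A + INR m)
  end%C.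

(* Euler-Gauss product: lim n! n^s / (s (s + 1) ... (s + n)), valid for every s
   that is not a pole 0, -1, -2, ... *)
Definition CGamma (s : C) : C :=
  iota (T := C_CompleteNormedModule) (fun l : C =>
    filterlim (U := C_UniformSpace)
      (fun n => INR (fact n) * RCpower (INR n) s / poch s (S n))%C
      eventually (locally (T := C_UniformSpace) l)).

Definition nonpos_int (c : C) : Prop := exists n : nat, c = (- INR n)%C.

Definition hyp2F1_coeff (A B c : C) (n : nat) : C :=
  (poch A n * poch B n / (poch c n * INR (fact n)))%C.

Definition analytic_at (f : C -> C) (p : C) : Prop :=
  exists (b : nat -> C) (r : R), 0 < r /\
    forall u : C, Cmod (u - p) < r ->
      is_pseries (K := C_AbsRing) (V := C_NormedModule) b (u - p)%C (f u).

(* v is the value at w of the analytic continuation, along the segment [0, w],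
   of the hypergeometric series.  C \ [1, +oo) is star-shaped about 0 and simply
   connected, so for w in it v is the value at w of F(A, B; c; .) continued to
   C \ [1, +oo). *)
Definition is_hyp2F1 (A B c w v : C) : Prop :=
  exists f : C -> C,
    (exists r : R, 0 < r /\ forall u : C, Cmod u < r ->
       is_pseries (K := C_AbsRing) (V := C_NormedModule)
         (hyp2F1_coeff A B c) u (f u)) /\
    (forall t : R, 0 <= t <= 1 -> analytic_at f (t * w)%C) /\
    f w = v.

Definition hyp2F1 (A B c w : C) : C :=
  iota (T := C_CompleteNormedModule) (fun v : C => is_hyp2F1 A B c w v).

(* F(A, B; c; w) / Gamma(c), which is a priori undefined for c = 0, -1, -2, ...,
   extended to these c by continuity. *)
Definition hyp2F1_div_Gamma (A B c w : C) : C :=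
  if excluded_middle_informative (nonpos_int c)
  then iota (T := C_CompleteNormedModule) (fun l : C =>
    filterlim (T := C_UniformSpace) (U := C_UniformSpace)
      (fun c' : C => hyp2F1 A B c' w / CGamma c')%C
      (locally' (T := C_UniformSpace) c) (locally (T := C_UniformSpace) l))
  else (hyp2F1 A B c w / CGamma c)%C.

(** * The functions psi_a *)

Definition principal_series (z z' : C) : Prop := Im z <> 0 /\ z' = Cconj z.

Definition complementary_series (z z' : C) : Prop :=
  Im z = 0 /\ Im z' = 0 /\
  exists m : Z, IZR m < Re z < IZR m + 1 /\ IZR m < Re z' < IZR m + 1.

(* The positive square root of a complex number that is a positive real. *)
Definition pos_sqrt (g : C) : R :=
  iota (T := R_CompleteNormedModule) (fun r : R => 0 < r /\ RtoC (r * r) = g).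

Definition psi (z z' : C) (xi : R) (a x : half_integer) : C :=
  (pos_sqrt (CGamma (hval x + z + / 2) * CGamma (hval x + z' + / 2) /
             (CGamma (z - hval a + / 2) * CGamma (z' - hval a + / 2)))
   * Rpower xi (/ 2 * (hval x + hval a))
   * RCpower (1 - xi) (/ 2 * (z + z') - hval a)
   * hyp2F1_div_Gamma (- z + hval a + / 2) (- z' + hval a + / 2)
       (hval x + hval a + 1) (RtoC (xi / (xi - 1))))%C.

(* Main.v *)
Require Import Defs.
From Stdlib Require Import Reals ZArith List Permutation Lra Lia.
From Stdlib Require Import Classical ClassicalDescription ClassicalEpsilon FunctionalExtensionality.
From Coquelicot Require Import Coquelicot.
Import ListNotations.
Open Scope R_scope.

(** With [s = sqrt xi], write [N = x + a] and
    [g_a(x) = [omega^N] (1 - s omega)^(a - z' - 1/2) (1 - s/omega)^(z - a - 1/2)]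
    for the coefficient of [omega^N] in the Laurent expansion on the unit circle.
    Pfaff's transformation rewrites the hypergeometric function at
    [xi/(xi - 1)] as a convergent series at [xi], and that series is, up to
    powers and a ratio of Gamma values, the convolution of two binomial series
    which defines [g_a(x)].  Thus [psi_a(x)] is [g_a(x)] times a square root of
    Gamma ratios and a factor depending on [a] only ([psi_laurent]).

    Orthonormality.  Since [psi] does not change when [z] and [z'] are exchanged,
    [psi_b(x)] is also a multiple of the Laurent coefficient [g~_b(x)] with
    exchanged parameters, and in the product [psi_a(x) psi_b(x)] all the Gamma
    factors that depend on [x] cancel.  The sum over [x] of [g_a(x) g~_b(x)] is
    the coefficient of [omega^(a-b)] in the product of the two Laurent series
    (the second one at [1/omega]), that is, in
    [(1 - s omega)^(a-b-1) (1 - s/omega)^(b-a-1)].  One of the factors is a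
    polynomial whose degree is too small for this coefficient to be nonzero,
    unless [a = b], when the coefficient is [1/(1 - xi)]
    ([laurent_biorthogonal], [psi_orthonormal]).

    Completeness.  Pfaff's transformation turns [psi_a(x; z, z')] and
    [psi_x(a; -z, -z')] into the same series, so that the two are equal
    ([psi_duality]).  The parameters [-z, -z'] are of the same kind, hence the
    columns of the matrix [psi_a(x)] are orthonormal too.  In particular
    [sum_a psi_a(x)^2 = 1], which says that the delta function at [x] is at
    distance zero from the span of the [psi_a] ([orthonormal_basis_of_matrix]).

    Three analytic facts connect this computation with the functions in the
    definition of [psi].  The Euler-Gauss product for Gamma converges to a
    nonzero limit, because its factors are [1 + O(1/n^2)]
    ([gamma_seq_converges]).  The hypergeometric series has exactly one
    continuation along the negative axis: existence comes from substituting
    [u/(u - 1)] into a power series ([pfaff_series_taylor]), uniqueness from the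
    identity theorem on a segment ([is_hyp2F1_unique]).  At the poles of
    [Gamma(c)] the quotient has a limit by dominated convergence
    ([hyp2F1_div_Gamma_value]).

    All sums are unordered ([has_sum]), so that the rearrangements of absolutely
    convergent multiple series reduce to changes of the index set. *)

(** * Unordered sums over an arbitrary index type *)

Lemma Cmod_sub_le (a b c : C) : Cmod (a - b) <= Cmod (c - a) + Cmod (c - b).
Proof.
  rewrite <- (Cmod_opp (c - a)).
  replace (a - b)%C with (- (c - a) + (c - b))%C by ring. apply Cmod_triangle.
Qed.

Lemma Cmod_le_plus (a b : C) : Cmod a <= Cmod (a + b) + Cmod b.
Proof.
  rewrite <- (Cmod_opp b). replace a with ((a + b) + - b)%C at 1 by ring.
  apply Cmod_triangle.
Qed.

Lemma Ceq_of_close (a b : C) :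
  (forall eps, 0 < eps -> exists c, Cmod (c - a) < eps /\ Cmod (c - b) < eps) -> a = b.
Proof.
  intros H. apply NNPP; intros Hne.
  assert (Hp : 0 < Cmod (a - b)).
  { apply Cmod_gt_0. intros E. apply Hne.
    replace a with ((a - b) + b)%C by ring. rewrite E; ring. }
  destruct (H (Cmod (a - b) / 2)) as [c [H1 H2]]; [lra|].
  generalize (Cmod_sub_le a b c). lra.
Qed.

Definition csum {T : Type} (f : T -> C) (l : list T) : C :=
  fold_right (fun t s => f t + s)%C (RtoC 0) l.

Definition rsum {T : Type} (f : T -> R) (l : list T) : R :=
  fold_right (fun t s => f t + s) 0 l.

(** Convergence along finite sets ordered by inclusion: it does not refer to an
    enumeration, hence is invariant under every change of variables. *)
Definition has_sum {T : Type} (f : T -> C) (s : C) : Prop :=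
  forall eps, 0 < eps -> exists l0, forall l,
    NoDup l -> incl l0 l -> Cmod (csum f l - s) < eps.

(** Summability of a nonnegative family is expressed by a bound on its finite
    subsums. *)
Definition bounded_sums {T : Type} (g : T -> R) (M : R) : Prop :=
  forall l, NoDup l -> rsum g l <= M.

Definition abs_summable {T : Type} (f : T -> C) : Prop :=
  exists M, bounded_sums (fun t => Cmod (f t)) M.

Lemma csum_app {T} (f : T -> C) l1 l2 :
  csum f (l1 ++ l2) = (csum f l1 + csum f l2)%C.
Proof.
  induction l1 as [|a l1 IH]; simpl. ring. rewrite IH; ring.
Qed.

Lemma rsum_app {T} (f : T -> R) l1 l2 :
  rsum f (l1 ++ l2) = rsum f l1 + rsum f l2.
Proof.
  induction l1 as [|a l1 IH]; simpl. ring. rewrite IH; ring.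
Qed.

Lemma csum_perm {T} (f : T -> C) l1 l2 :
  Permutation l1 l2 -> csum f l1 = csum f l2.
Proof.
  induction 1; simpl; try congruence. ring.
Qed.

Lemma rsum_perm {T} (f : T -> R) l1 l2 :
  Permutation l1 l2 -> rsum f l1 = rsum f l2.
Proof.
  induction 1; simpl; try congruence. ring.
Qed.

Lemma csum_ext {T} (f g : T -> C) l :
  (forall t, In t l -> f t = g t) -> csum f l = csum g l.
Proof.
  induction l as [|a l IH]; simpl; intros H; auto.
  rewrite H, IH; auto.
Qed.

Lemma rsum_ext {T} (f g : T -> R) l :
  (forall t, In t l -> f t = g t) -> rsum f l = rsum g l.
Proof.
  induction l as [|a l IH]; simpl; intros H; auto.
  rewrite H, IH; auto.
Qed.

Lemma csum_plus {T} (f g : T -> C) l :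
  csum (fun t => f t + g t)%C l = (csum f l + csum g l)%C.
Proof.
  induction l as [|a l IH]; simpl. ring. rewrite IH; ring.
Qed.

Lemma csum_scal {T} k (f : T -> C) l :
  csum (fun t => k * f t)%C l = (k * csum f l)%C.
Proof.
  induction l as [|a l IH]; simpl. ring. rewrite IH; ring.
Qed.

Lemma rsum_scal {T} k (f : T -> R) l :
  rsum (fun t => k * f t) l = k * rsum f l.
Proof.
  induction l as [|a l IH]; simpl. ring. rewrite IH; ring.
Qed.

Lemma csum_RtoC {T} (f : T -> R) l :
  csum (fun t => RtoC (f t)) l = RtoC (rsum f l).
Proof.
  induction l as [|a l IH]; simpl; auto. rewrite IH, RtoC_plus; auto.
Qed.

Lemma csum_0 {T} (f : T -> C) l :
  (forall t, In t l -> f t = 0) -> csum f l = 0.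
Proof.
  induction l as [|a l IH]; simpl; intros H; auto.
  rewrite H, IH by auto. ring.
Qed.

Lemma csum_map {T U} (f : T -> C) (g : U -> T) l :
  csum f (map g l) = csum (fun u => f (g u)) l.
Proof. induction l; simpl; congruence. Qed.

Lemma rsum_map {T U} (f : T -> R) (g : U -> T) l :
  rsum f (map g l) = rsum (fun u => f (g u)) l.
Proof. induction l; simpl; congruence. Qed.

Lemma rsum_filter {T} (p : T -> bool) (f : T -> R) l :
  rsum f l = rsum f (filter p l) + rsum f (filter (fun t => negb (p t)) l).
Proof.
  induction l as [|a l IH]; simpl; [ring|].
  rewrite IH. destruct (p a); simpl; ring.
Qed.

Lemma rsum_le {T} (f g : T -> R) l :
  (forall t, In t l -> f t <= g t) -> rsum f l <= rsum g l.
Proof.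
  induction l as [|a l IH]; simpl; intros H; [lra|].
  apply Rplus_le_compat; auto.
Qed.

Lemma rsum_ge0 {T} (f : T -> R) l : (forall t, 0 <= f t) -> 0 <= rsum f l.
Proof.
  intros H. induction l as [|a l IH]; simpl; [lra|]. specialize (H a); lra.
Qed.

Lemma Cmod_csum {T} (f : T -> C) l :
  Cmod (csum f l) <= rsum (fun t => Cmod (f t)) l.
Proof.
  induction l as [|a l IH]; simpl. rewrite Cmod_0; lra.
  eapply Rle_trans; [apply Cmod_triangle|]. lra.
Qed.

Lemma incl_split {T} (l0 l : list T) :
  NoDup l0 -> NoDup l -> incl l0 l ->
  exists l1, Permutation l (l0 ++ l1) /\ NoDup l1.
Proof.
  revert l. induction l0 as [|a l0 IH]; intros l H0 Hl Hi.
  - exists l; simpl; auto.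
  - assert (Ha : In a l) by (apply Hi; simpl; auto).
    destruct (in_split _ _ Ha) as [u [v ->]].
    inversion_clear H0 as [|? ? Hna Hnd].
    destruct (IH (u ++ v)) as [l1 [Hp Hn]]; auto.
    + apply NoDup_remove_1 in Hl; auto.
    + intros x Hx. specialize (Hi x (or_intror Hx)).
      apply in_app_or in Hi. apply in_or_app.
      destruct Hi as [Hi|[<-|Hi]]; auto. contradiction.
    + exists l1; split; auto. simpl.
      eapply perm_trans; [symmetry; apply Permutation_middle|]. auto.
Qed.

Definition classical_eq_dec (T : Type) : forall x y : T, {x = y} + {x <> y} :=
  fun x y => excluded_middle_informative (x = y).

Definition dedup {T} (l : list T) := nodup (classical_eq_dec T) l.

Lemma dedup_NoDup {T} (l : list T) : NoDup (dedup l).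
Proof. apply NoDup_nodup. Qed.

Lemma dedup_In {T} (l : list T) x : In x (dedup l) <-> In x l.
Proof. apply nodup_In. Qed.

Lemma rsum_incl {T} (g : T -> R) l l' :
  (forall t, 0 <= g t) -> NoDup l -> NoDup l' -> incl l l' ->
  rsum g l <= rsum g l'.
Proof.
  intros Hg H1 H2 Hi. destruct (incl_split l l') as [l1 [Hp _]]; auto.
  rewrite (rsum_perm _ _ _ Hp), rsum_app.
  generalize (rsum_ge0 g l1 Hg); lra.
Qed.

Lemma has_sum_unique {T} (f : T -> C) s s' :
  has_sum f s -> has_sum f s' -> s = s'.
Proof.
  intros H H'. apply Ceq_of_close. intros eps He.
  destruct (H eps He) as [l1 H1]. destruct (H' eps He) as [l2 H2].
  exists (csum f (dedup (l1 ++ l2))).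
  split; [apply H1|apply H2]; try apply dedup_NoDup;
    intros x Hx; apply dedup_In, in_or_app; auto.
Qed.

Lemma has_sum_ext {T} (f g : T -> C) s :
  (forall t, f t = g t) -> has_sum f s -> has_sum g s.
Proof.
  intros H. replace g with f; auto. apply functional_extensionality; auto.
Qed.

Lemma has_sum_plus {T} (f g : T -> C) a b :
  has_sum f a -> has_sum g b -> has_sum (fun t => f t + g t)%C (a + b)%C.
Proof.
  intros H H' eps He.
  destruct (H (eps / 2)) as [l1 H1]; [lra|].
  destruct (H' (eps / 2)) as [l2 H2]; [lra|].
  exists (l1 ++ l2). intros l Hl Hi.
  specialize (H1 l Hl (fun x h => Hi x (in_or_app _ _ _ (or_introl h)))).
  specialize (H2 l Hl (fun x h => Hi x (in_or_app _ _ _ (or_intror h)))).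
  rewrite csum_plus.
  replace (csum f l + csum g l - (a + b))%C
    with ((csum f l - a) + (csum g l - b))%C by ring.
  eapply Rle_lt_trans; [apply Cmod_triangle|]. lra.
Qed.

Lemma has_sum_scal {T} k (f : T -> C) a :
  has_sum f a -> has_sum (fun t => k * f t)%C (k * a)%C.
Proof.
  intros H eps He.
  assert (Hk := Cmod_ge_0 k).
  destruct (H (eps / (Cmod k + 1))) as [l0 H0].
  { apply Rdiv_lt_0_compat; lra. }
  exists l0. intros l Hl Hi. specialize (H0 l Hl Hi).
  rewrite csum_scal. replace (k * csum f l - k * a)%C with (k * (csum f l - a))%C by ring.
  rewrite Cmod_mult.
  apply Rle_lt_trans with ((Cmod k) * (eps / (Cmod k + 1))).
  { apply Rmult_le_compat_l; lra. }
  apply Rmult_lt_reg_r with (Cmod k + 1); [lra|].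
  field_simplify; lra.
Qed.

Lemma has_sum_finite {T} (f : T -> C) l :
  NoDup l -> (forall t, ~ In t l -> f t = 0) -> has_sum f (csum f l).
Proof.
  intros Hl H0 eps He. exists l. intros l' Hl' Hi.
  destruct (incl_split l l') as [l1 [Hp Hn]]; auto.
  rewrite (csum_perm _ _ _ Hp), csum_app.
  rewrite (csum_0 f l1).
  - replace (csum f l + 0 - csum f l)%C with (RtoC 0) by ring. rewrite Cmod_0; auto.
  - intros t Ht. apply H0. intros Hin.
    apply (Permutation_NoDup Hp) in Hl'.
    apply in_split in Hin. destruct Hin as [u [v ->]].
    rewrite <- app_assoc in Hl'. simpl in Hl'.
    apply NoDup_remove_2 in Hl'. apply Hl'.
    apply in_or_app; right. apply in_or_app; auto.
Qed.

Lemma has_sum_0 {T} : has_sum (fun _ : T => RtoC 0) 0.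
Proof. apply (has_sum_finite (fun _ : T => RtoC 0) []); auto. constructor. Qed.

(** Increasing finite subsums of a nonnegative family converge to their
    supremum. *)
Lemma has_sum_nonneg {T} (g : T -> R) M :
  (forall t, 0 <= g t) -> bounded_sums g M ->
  exists s : R, has_sum (fun t => RtoC (g t)) s.
Proof.
  intros Hg HM.
  destruct (completeness (fun x => exists l, NoDup l /\ x = rsum g l)) as [s [Hub Hlub]].
  { exists M. intros x [l [Hl ->]]. auto. }
  { exists 0, []. split; [constructor|reflexivity]. }
  exists s. intros eps He.
  assert (Hex : exists l, NoDup l /\ s - eps < rsum g l).
  { apply NNPP; intros Hn.
    assert (s <= s - eps); [|lra].
    apply Hlub. intros x [l [Hl ->]]. apply Rnot_lt_le; intros Hlt.
    apply Hn; exists l; auto. }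
  destruct Hex as [l0 [Hl0 Hs]]. exists l0. intros l Hl Hi.
  rewrite csum_RtoC, <- RtoC_minus, Cmod_R.
  assert (rsum g l <= s) by (apply Hub; exists l; auto).
  assert (rsum g l0 <= rsum g l) by (apply rsum_incl; auto).
  rewrite Rabs_left1; lra.
Qed.

Lemma has_sum_bound {T} (f : T -> C) s M :
  bounded_sums (fun t => Cmod (f t)) M -> has_sum f s -> Cmod s <= M.
Proof.
  intros HM Hs. apply Rnot_lt_le; intros Hlt.
  destruct (Hs (Cmod s - M)) as [l0 H0]; [lra|].
  assert (Hi : incl l0 (dedup l0)) by (intros x Hx; apply dedup_In; auto).
  specialize (H0 _ (dedup_NoDup l0) Hi). specialize (HM _ (dedup_NoDup l0)).
  generalize (Cmod_csum f (dedup l0)). intros H1.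
  generalize (Cmod_le_plus s (csum f (dedup l0) - s)).
  replace (s + (csum f (dedup l0) - s))%C with (csum f (dedup l0)) by ring. lra.
Qed.

Lemma bounded_sums_le {T} (g h : T -> R) M :
  (forall t, h t <= g t) -> bounded_sums g M -> bounded_sums h M.
Proof.
  intros H HM l Hl. eapply Rle_trans; [apply rsum_le|apply HM; auto]. auto.
Qed.

Lemma bounded_sums_scal {T} (g : T -> R) M k :
  0 <= k -> bounded_sums g M -> bounded_sums (fun t => k * g t) (k * M).
Proof.
  intros Hk H l Hl. rewrite rsum_scal. apply Rmult_le_compat_l; auto.
Qed.

Lemma bounded_sums_ge0 {T} (g : T -> R) M : bounded_sums g M -> 0 <= M.
Proof. intros H. apply (H []). constructor. Qed.

Lemma abs_summable_le {T} (f g : T -> C) :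
  (forall t, Cmod (f t) <= Cmod (g t)) -> abs_summable g -> abs_summable f.
Proof.
  intros H [M HM]. exists M. eapply bounded_sums_le; [|exact HM]. auto.
Qed.

Lemma abs_summable_scal {T} (f : T -> C) k :
  abs_summable f -> abs_summable (fun t => k * f t)%C.
Proof.
  intros [M HM]. exists (Cmod k * M).
  eapply bounded_sums_le; [|apply bounded_sums_scal; [apply Cmod_ge_0|exact HM]].
  intros t; simpl. rewrite Cmod_mult; lra.
Qed.

Lemma abs_summable_bounded {T} (f : T -> C) :
  abs_summable f -> exists M, 0 <= M /\ forall t, Cmod (f t) <= M.
Proof.
  intros [M HM]. exists M. split; [apply (bounded_sums_ge0 _ _ HM)|].
  intros t. assert (H := HM [t] ltac:(constructor; [intros []|constructor])).
  simpl in H. lra.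
Qed.

Lemma abs_summable_mul_bounded {T} (f g : T -> C) M :
  (forall t, Cmod (g t) <= M) -> abs_summable f -> abs_summable (fun t => g t * f t)%C.
Proof.
  intros Hg Hf. apply (abs_summable_le _ (fun t => RtoC M * f t)%C).
  - intros t. rewrite !Cmod_mult, Cmod_R. apply Rmult_le_compat_r; [apply Cmod_ge_0|].
    generalize (Hg t) (Rle_abs M). lra.
  - apply abs_summable_scal, Hf.
Qed.

Lemma im_le_Cmod (c : C) : Rabs (Im c) <= Cmod c.
Proof.
  eapply Rle_trans; [apply Rmax_r|]. apply (Rmax_Cmod c).
Qed.

(** Split into the positive and negative parts of the real and imaginary
    parts. *)
Lemma abs_summable_has_sum {T} (f : T -> C) :
  abs_summable f -> exists s, has_sum f s.
Proof.
  intros [M HM].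
  assert (Hr : forall h : T -> R, (forall t, Rabs (h t) <= Cmod (f t)) ->
     exists s, has_sum (fun t => RtoC (h t)) s).
  { intros h Hh.
    destruct (has_sum_nonneg (fun t => (Rabs (h t) + h t) / 2) M) as [a Ha].
    { intros t. assert (H1 := Rle_abs (- h t)). rewrite Rabs_Ropp in H1. lra. }
    { eapply bounded_sums_le; [|exact HM]. intros t. simpl.
      specialize (Hh t). assert (H1 := Rle_abs (h t)). lra. }
    destruct (has_sum_nonneg (fun t => (Rabs (h t) - h t) / 2) M) as [b Hb].
    { intros t. assert (H1 := Rle_abs (h t)). lra. }
    { eapply bounded_sums_le; [|exact HM]. intros t. simpl.
      specialize (Hh t). assert (H1 := Rle_abs (- h t)). rewrite Rabs_Ropp in H1. lra. }
    exists (a + (-1) * b)%C.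
    eapply has_sum_ext; [|apply has_sum_plus; [apply Ha|apply has_sum_scal, Hb]].
    intros t; simpl. rewrite <- RtoC_mult, <- RtoC_plus. f_equal. field. }
  destruct (Hr (fun t => Re (f t))) as [a Ha]. { intros; apply re_le_Cmod. }
  destruct (Hr (fun t => Im (f t))) as [b Hb]. { intros; apply im_le_Cmod. }
  exists (a + Ci * b)%C.
  eapply has_sum_ext; [|apply has_sum_plus; [apply Ha|apply has_sum_scal, Hb]].
  intros t; simpl. destruct (f t) as [x y]. unfold Ci, RtoC, Cplus, Cmult; simpl.
  f_equal; ring.
Qed.

(** The terms outside the image are zero, so that a finite list and its trace
    on the image have the same sum.  All changes of variables below are
    instances: bijections, the extension by zero from the natural numbers to Z,
    and triangular index sets. *)
Lemma has_sum_inj {T U} (phi : T -> U) (f : U -> C) s :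
  (forall x y, phi x = phi y -> x = y) ->
  (forall u, (forall t, phi t <> u) -> f u = 0) ->
  has_sum f s <-> has_sum (fun t => f (phi t)) s.
Proof.
  intros Hinj H0.
  assert (Hmap : forall l, NoDup l -> NoDup (map phi l)).
  { induction 1; simpl; constructor; auto.
    intros Hin. apply in_map_iff in Hin. destruct Hin as [y [Hy Hin]].
    apply Hinj in Hy; subst; auto. }
  (* the part of a list that lies in the image of phi *)
  assert (Hpre : forall l : list U, NoDup l -> exists l', NoDup l' /\
     incl (map phi l') l /\ (forall t, In (phi t) l -> In t l') /\ csum f l = csum (fun t => f (phi t)) l').
  { induction 1 as [|u l Hu Hl [l' [Hn [Hi [Hi' Hs]]]]].
    - exists []. repeat split; try constructor. intros x []. intros t [].
    - destruct (classic (exists t, phi t = u)) as [[t Ht]|Hne].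
      + exists (t :: l'). repeat split.
        * constructor; auto. intros Hin. apply Hu. rewrite <- Ht. apply Hi, in_map; auto.
        * simpl. intros x [<-|Hx]; [left; auto|right; auto].
        * intros t' [E|Hin]; [left|right; auto]. apply Hinj. congruence.
        * simpl. rewrite Ht, Hs; auto.
      + exists l'. repeat split; auto.
        * intros x Hx; right; auto.
        * intros t [E|Hin]; auto. exfalso; apply Hne; exists t; auto.
        * simpl. rewrite H0, Hs. ring. intros t E; apply Hne; exists t; auto. }
  split; intros H eps He; destruct (H eps He) as [l0 Hl0].
  - destruct (Hpre (dedup l0) (dedup_NoDup _)) as [l1 [Hn [Hi [Hi' _]]]].
    exists l1. intros l Hl Hincl.
    (* the union of l0 and phi l has the same sum as phi l *)
    assert (Hd : NoDup (dedup (l0 ++ map phi l))) by apply dedup_NoDup.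
    destruct (incl_split (map phi l) (dedup (l0 ++ map phi l))) as [l2 [Hp Hn2]]; auto.
    { intros x Hx; apply dedup_In, in_or_app; auto. }
    rewrite <- (csum_map f phi).
    replace (csum f (map phi l)) with (csum f (dedup (l0 ++ map phi l))).
    { apply Hl0; auto. intros x Hx; apply dedup_In, in_or_app; auto. }
    rewrite (csum_perm _ _ _ Hp), csum_app, (csum_0 f l2). ring.
    intros u Hu. apply H0. intros t Ht; subst u.
    assert (Hin : In (phi t) (dedup (l0 ++ map phi l))).
    { eapply Permutation_in; [symmetry; exact Hp|]. apply in_or_app; auto. }
    assert (Hin2 : In (phi t) (map phi l)).
    { apply dedup_In, in_app_or in Hin. destruct Hin as [Hin|Hin]; auto.
      apply in_map, Hincl, Hi', dedup_In; auto. }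
    apply (Permutation_NoDup Hp) in Hd.
    apply in_split in Hin2. destruct Hin2 as [a [b E]]. rewrite E in Hd.
    rewrite <- app_assoc in Hd. simpl in Hd. apply NoDup_remove_2 in Hd.
    apply Hd, in_or_app; right; apply in_or_app; auto.
  - exists (map phi l0). intros l Hl Hincl.
    destruct (Hpre l Hl) as [l1 [Hn [Hi [Hi' Hs]]]].
    rewrite Hs. apply Hl0; auto. intros t Ht. apply Hi', Hincl, in_map; auto.
Qed.

Lemma bounded_sums_inj {T U} (phi : T -> U) (g : U -> R) M :
  (forall x y, phi x = phi y -> x = y) ->
  bounded_sums g M -> bounded_sums (fun t => g (phi t)) M.
Proof.
  intros Hinj H l Hl. rewrite <- (rsum_map g phi). apply H.
  induction Hl; simpl; constructor; auto.
  intros Hin. apply in_map_iff in Hin. destruct Hin as [y [Hy Hin]].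
  apply Hinj in Hy; subst; auto.
Qed.

Lemma abs_summable_inj {T U} (phi : T -> U) (f : U -> C) :
  (forall x y, phi x = phi y -> x = y) ->
  abs_summable f -> abs_summable (fun t => f (phi t)).
Proof.
  intros Hinj [M H]. exists M.
  apply (bounded_sums_inj phi (fun u => Cmod (f u))); auto.
Qed.

(** Summation by rows: near the total sum, finitely many rows can be replaced
    by their complete sums at an arbitrarily small cost. *)
Lemma has_sum_rows {T U} (F : T * U -> C) (g : T -> C) s :
  has_sum F s -> (forall t, has_sum (fun u => F (t, u)) (g t)) -> has_sum g s.
Proof.
  intros HF Hg eps He.
  destruct (HF (eps / 2)) as [L0 HL0]; [lra|].
  exists (map fst L0). intros l Hl Hi.
  set (eta := eps / 2 / (INR (length l) + 1)).
  assert (Hlen := pos_INR (length l)).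
  assert (Heta : 0 < eta) by (apply Rdiv_lt_0_compat; lra).
  assert (HL : exists L, NoDup L /\ (forall p, In p L -> In (fst p) l) /\
     (forall p, In p L0 -> In (fst p) l -> In p L) /\
     Cmod (csum F L - csum g l) <= INR (length l) * eta).
  { clear Hi Hlen. clearbody eta. induction Hl as [|t l Ht Hl IH].
    - exists []. simpl. split; [constructor|]. repeat split; auto.
      replace (0 - 0)%C with (RtoC 0) by ring. rewrite Cmod_0; lra.
    - destruct IH as [L [Hn [H1 [H2 H3]]]].
      destruct (Hg t eta Heta) as [m0 Hm0].
      set (m := dedup (m0 ++ map snd L0)).
      specialize (Hm0 m (dedup_NoDup _)).
      assert (Him : incl m0 m) by (intros x Hx; apply dedup_In, in_or_app; auto).
      specialize (Hm0 Him).
      exists (map (pair t) m ++ L). repeat split.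
      + apply NoDup_app; auto.
        * apply NoDup_map_NoDup_ForallPairs; [|apply dedup_NoDup].
          intros x y _ _ E. injection E; auto.
        * intros [x y] Hin Hin'. apply in_map_iff in Hin.
          destruct Hin as [y' [E _]]. apply H1 in Hin'. inversion E; subst; auto.
      + intros p Hp. apply in_app_or in Hp. destruct Hp as [Hp|Hp].
        * apply in_map_iff in Hp. destruct Hp as [y [<- _]]. left; auto.
        * right; auto.
      + intros p Hp [E|Hin].
        * apply in_or_app; left. destruct p as [x y]; simpl in E; subst x.
          apply in_map, dedup_In, in_or_app. right.
          apply (in_map snd) in Hp; auto.
        * apply in_or_app; auto.
      + rewrite csum_app, csum_map. simpl csum. simpl length. rewrite S_INR.
        match goal with |- Cmod (?a + ?b - (?c + ?d)) <= _ =>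
          replace (a + b - (c + d))%C with ((a - c) + (b - d))%C by ring end.
        eapply Rle_trans; [apply Cmod_triangle|].
        simpl in Hm0. lra. }
  destruct HL as [L [Hn [H1 [H2 H3]]]].
  assert (HLs : Cmod (csum F L - s) < eps / 2).
  { apply HL0; auto. intros p Hp. apply H2; auto. apply Hi, in_map; auto. }
  replace (csum g l - s)%C with (- (csum F L - csum g l) + (csum F L - s))%C by ring.
  eapply Rle_lt_trans; [apply Cmod_triangle|]. rewrite Cmod_opp.
  assert (INR (length l) * eta <= eps / 2).
  { unfold eta. apply Rmult_le_reg_r with (INR (length l) + 1); [lra|].
    field_simplify; [|lra]. nra. }
  lra.
Qed.

Lemma bounded_sums_rows {T U} (G : T * U -> R) (m : T -> R) M :
  (forall t, bounded_sums (fun u => G (t, u)) (m t)) ->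
  bounded_sums m M -> bounded_sums G M.
Proof.
  intros Hr HM.
  assert (H : forall l, NoDup l -> forall L, NoDup L ->
            (forall p, In p L -> In (fst p) l) -> rsum G L <= rsum m l).
  { induction 1 as [|t l Ht Hl IH]; intros L HL Hin.
    - destruct L as [|p L]; simpl; [lra|]. destruct (Hin p); simpl; auto.
    - set (p := fun q : T * U => if classical_eq_dec T (fst q) t then true else false).
      rewrite (rsum_filter p). simpl. apply Rplus_le_compat.
      + rewrite (rsum_ext _ (fun q => G (t, snd q))).
        * rewrite <- (rsum_map (fun u => G (t, u)) snd). apply Hr.
          apply NoDup_map_NoDup_ForallPairs; [|apply NoDup_filter; auto].
          intros [x u] [y v] Hx Hy E. apply filter_In in Hx, Hy. unfold p in Hx, Hy.
          simpl in *. destruct (classical_eq_dec T x t), (classical_eq_dec T y t); try easy. congruence.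
        * intros [x u] Hx. apply filter_In in Hx. unfold p in Hx. simpl in *.
          destruct (classical_eq_dec T x t); [congruence|easy].
      + apply IH; [apply NoDup_filter; auto|].
        intros q Hq. apply filter_In in Hq. destruct Hq as [Hq Hp].
        destruct (Hin q Hq) as [E|]; auto. unfold p in Hp.
        destruct (classical_eq_dec T (fst q) t); [easy|congruence]. }
  intros L HL. eapply Rle_trans; [apply (H (dedup (map fst L)))|].
  - apply dedup_NoDup.
  - auto.
  - intros p Hp. apply dedup_In, in_map; auto.
  - apply HM, dedup_NoDup.
Qed.

Lemma bounded_sums_prod {T U} (f : T -> R) (g : U -> R) M N :
  (forall t, 0 <= f t) -> bounded_sums f M -> bounded_sums g N ->
  bounded_sums (fun p => f (fst p) * g (snd p)) (M * N).
Proof.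
  intros Hf HM HN. apply bounded_sums_rows with (fun t => f t * N).
  - intros t. simpl. apply bounded_sums_scal; auto.
  - intros l Hl. rewrite (rsum_ext _ (fun t => N * f t)).
    + rewrite rsum_scal, Rmult_comm. apply Rmult_le_compat_r; auto.
      apply (bounded_sums_ge0 g); auto.
    + intros; ring.
Qed.

Lemma abs_summable_prod {T U} (f : T -> C) (g : U -> C) :
  abs_summable f -> abs_summable g ->
  abs_summable (fun p => f (fst p) * g (snd p))%C.
Proof.
  intros [M HM] [N HN]. exists (M * N).
  eapply bounded_sums_le; [|apply bounded_sums_prod; [|exact HM|exact HN]].
  - intros p; simpl. rewrite Cmod_mult; lra.
  - intros; apply Cmod_ge_0.
Qed.

Lemma has_sum_prod {T U} (f : T -> C) (g : U -> C) a b :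
  abs_summable f -> abs_summable g -> has_sum f a -> has_sum g b ->
  has_sum (fun p => f (fst p) * g (snd p))%C (a * b)%C.
Proof.
  intros Sf Sg Hf Hg.
  destruct (abs_summable_has_sum _ (abs_summable_prod f g Sf Sg)) as [s Hs].
  replace (a * b)%C with s; auto.
  apply (has_sum_unique (fun t => f t * b)%C).
  - eapply has_sum_rows; [exact Hs|]. intros t; simpl. apply has_sum_scal; auto.
  - rewrite Cmult_comm. eapply has_sum_ext; [|apply has_sum_scal; exact Hf].
    intros; simpl; ring.
Qed.

Lemma has_sum_swap {T U} (F : T * U -> C) s :
  has_sum F s -> has_sum (fun p => F (snd p, fst p)) s.
Proof.
  intros H. apply (has_sum_inj (fun p : U * T => (snd p, fst p)) F); auto.
  - intros [a b] [c d]; simpl; congruence.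
  - intros [a b] Hn. destruct (Hn (b, a)); auto.
Qed.

Lemma abs_summable_swap {T U} (F : T * U -> C) :
  abs_summable F -> abs_summable (fun p => F (snd p, fst p)).
Proof.
  apply (abs_summable_inj (fun p : U * T => (snd p, fst p)) F).
  intros [a b] [c d]; simpl; congruence.
Qed.

(** Both iterated sums equal the sum over the product. *)
Lemma has_sum_exchange {T U} (F : T * U -> C) (g : T -> C) (h : U -> C) s :
  abs_summable F ->
  (forall t, has_sum (fun u => F (t, u)) (g t)) ->
  (forall u, has_sum (fun t => F (t, u)) (h u)) ->
  has_sum g s -> has_sum h s.
Proof.
  intros SF Hg Hh Hs. destruct (abs_summable_has_sum _ SF) as [s' Hs'].
  replace s with s'.
  - apply (has_sum_rows (fun p => F (snd p, fst p))); auto.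
    apply has_sum_swap; auto.
  - apply (has_sum_unique g); auto. apply (has_sum_rows F); auto.
Qed.

Lemma bounded_sums_row {T U} (G : T * U -> R) M t :
  bounded_sums G M -> bounded_sums (fun u => G (t, u)) M.
Proof.
  apply (bounded_sums_inj (fun u => (t, u)) G). congruence.
Qed.

Lemma abs_summable_row {T U} (F : T * U -> C) t :
  abs_summable F -> abs_summable (fun u => F (t, u)).
Proof.
  apply (abs_summable_inj (fun u => (t, u)) F). congruence.
Qed.

(** ** Sums over the natural numbers and series *)

Lemma csum_seq (f : nat -> C) n :
  csum f (seq 0 (S n)) = sum_n (G := C_AbelianMonoid) f n.
Proof.
  induction n as [|n IH].
  - simpl. rewrite sum_O. apply Cplus_0_r.
  - rewrite seq_S, csum_app, IH, sum_Sn. simpl.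
    change (@plus C_AbelianMonoid) with Cplus. rewrite Cplus_0_r. reflexivity.
Qed.

Lemma rsum_seq (f : nat -> R) n : rsum f (seq 0 (S n)) = sum_n f n.
Proof.
  induction n as [|n IH].
  - simpl. rewrite sum_O. ring.
  - rewrite seq_S, rsum_app, IH, sum_Sn. simpl. unfold plus; simpl. ring.
Qed.

Lemma filterlim_C_iff {T} (F : (T -> Prop) -> Prop) {FF : Filter F} (f : T -> C) (l : C) :
  filterlim f F (locally (T := C_UniformSpace) l) <->
  (forall eps, 0 < eps -> F (fun x => Cmod (f x - l) < eps)).
Proof.
  split.
  - intros H eps He.
    apply (proj1 (filterlim_locally_ball_norm (K := C_AbsRing) (U := C_NormedModule) (F := F) f l) H (mkposreal eps He)).
  - intros H.
    apply (filterlim_locally_ball_norm (K := C_AbsRing) (U := C_NormedModule) (F := F) f l).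
    intros eps. exact (H eps (cond_pos eps)).
Qed.

Lemma is_series_C_iff (f : nat -> C) (s : C) :
  is_series (V := C_NormedModule) f s <->
  (forall eps, 0 < eps -> exists N, forall n, (N <= n)%nat ->
     Cmod (csum f (seq 0 (S n)) - s) < eps).
Proof.
  unfold is_series.
  split.
  - intros H eps He.
    destruct (proj1 (filterlim_C_iff _ _ _) H eps He) as [N HN].
    exists N. intros n Hn. rewrite csum_seq. apply HN; auto.
  - intros H. apply filterlim_C_iff. apply eventually_filter.
    intros eps He. destruct (H eps He) as [N HN]. exists N. intros n Hn.
    rewrite <- csum_seq. apply HN; auto.
Qed.

Lemma has_sum_is_series (f : nat -> C) s :
  has_sum f s -> is_series (V := C_NormedModule) f s.
Proof.
  intros H. apply is_series_C_iff. intros eps He.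
  destruct (H eps He) as [l0 H0]. exists (list_max l0). intros n Hn.
  apply H0. apply seq_NoDup. intros x Hx. apply in_seq.
  assert (Hm := proj1 (list_max_le l0 (list_max l0)) (le_n _)).
  rewrite Forall_forall in Hm. specialize (Hm x Hx). lia.
Qed.

Lemma is_series_C_unique (f : nat -> C) s s' :
  is_series (V := C_NormedModule) f s -> is_series (V := C_NormedModule) f s' -> s = s'.
Proof. apply (filterlim_locally_unique (F := eventually)). Qed.

Lemma bounded_sums_nat (g : nat -> R) M :
  (forall n, 0 <= g n) -> (forall n, rsum g (seq 0 n) <= M) -> bounded_sums g M.
Proof.
  intros Hg H l Hl. eapply Rle_trans; [|apply (H (S (list_max l)))].
  apply rsum_incl; auto. apply seq_NoDup.
  intros x Hx. apply in_seq.
  assert (Hm := proj1 (list_max_le l (list_max l)) (le_n _)).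
  rewrite Forall_forall in Hm. specialize (Hm x Hx). lia.
Qed.

Lemma ex_series_bounded_sums (g : nat -> R) :
  (forall n, 0 <= g n) -> ex_series g -> bounded_sums g (Series g).
Proof.
  intros Hg Hs. apply bounded_sums_nat; auto. intros n.
  assert (Hn : rsum g (seq 0 n) <= rsum g (seq 0 (S n))).
  { apply rsum_incl; auto; try apply seq_NoDup. intros x Hx.
    apply in_seq in Hx; apply in_seq; lia. }
  eapply Rle_trans; [exact Hn|]. rewrite rsum_seq.
  assert (Hser := Series_correct g Hs).
  apply (is_lim_seq_incr_compare (sum_n g)); auto.
  intros k. rewrite sum_Sn. unfold plus; simpl. specialize (Hg (S k)); lra.
Qed.

Lemma bounded_sums_ex_series (g : nat -> R) M :
  (forall n, 0 <= g n) -> bounded_sums g M -> ex_series g /\ Series g <= M.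
Proof.
  intros Hg HM.
  assert (Hn : forall n, sum_n g n <= M).
  { intros n. rewrite <- rsum_seq. apply HM, seq_NoDup. }
  assert (Hi : forall n, sum_n g n <= sum_n g (S n)).
  { intros k. rewrite sum_Sn. unfold plus; simpl. specialize (Hg (S k)); lra. }
  destruct (ex_finite_lim_seq_incr (sum_n g) M) as [l Hl]; auto.
  assert (Hsl : is_series g l) by exact Hl.
  split; [exists l; auto|]. rewrite (is_series_unique g l Hsl).
  apply (is_lim_seq_le (sum_n g) (fun _ => M) l M); auto. apply is_lim_seq_const.
Qed.

Lemma has_sum_RtoC_nonneg_bound {T} (g : T -> R) (s : R) :
  (forall t, 0 <= g t) -> has_sum (fun t => RtoC (g t)) s -> bounded_sums g s.
Proof.
  intros Hg H l Hl. apply Rnot_lt_le; intros Hlt.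
  destruct (H (rsum g l - s)) as [l0 H0]; [lra|].
  specialize (H0 (dedup (l0 ++ l)) (dedup_NoDup _)).
  assert (Hi : incl l0 (dedup (l0 ++ l))) by (intros x Hx; apply dedup_In, in_or_app; auto).
  specialize (H0 Hi). rewrite csum_RtoC, <- RtoC_minus, Cmod_R in H0.
  assert (Hle : rsum g l <= rsum g (dedup (l0 ++ l))).
  { apply rsum_incl; auto. apply dedup_NoDup. intros x Hx; apply dedup_In, in_or_app; auto. }
  assert (Hab := Rle_abs (rsum g (dedup (l0 ++ l)) - s)). lra.
Qed.

(** * Pochhammer symbols and Vandermonde's identity *)

Lemma RtoC_neq0 (x : R) : x <> 0 -> RtoC x <> 0.
Proof. intros H E. apply H. injection E; auto. Qed.

Lemma fact_C_neq0 n : RtoC (INR (fact n)) <> 0.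
Proof. apply RtoC_neq0, INR_fact_neq_0. Qed.

Lemma INR_S_C_neq0 n : RtoC (INR (S n)) <> 0.
Proof. apply RtoC_neq0, not_0_INR. lia. Qed.

Lemma Cmult_cancel_l (k a b : C) : k <> 0 -> (k * a = k * b)%C -> a = b.
Proof.
  intros Hk E. replace a with (/ k * (k * a))%C by (field; auto).
  rewrite E. field; auto.
Qed.

Lemma RtoC_INR_S n : RtoC (INR (S n)) = (INR n + 1)%C.
Proof. rewrite S_INR, RtoC_plus. reflexivity. Qed.

Lemma fact_S_C n : RtoC (INR (fact (S n))) = (INR (S n) * INR (fact n))%C.
Proof. rewrite <- RtoC_mult, <- mult_INR. reflexivity. Qed.

Lemma poch_add a n m : poch a (n + m) = (poch a n * poch (a + INR n) m)%C.
Proof.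
  induction m as [|m IH].
  - rewrite Nat.add_0_r. simpl. ring.
  - rewrite Nat.add_succ_r. simpl. rewrite IH, plus_INR, RtoC_plus. ring.
Qed.

Lemma poch_front a n : poch a (S n) = (a * poch (a + 1) n)%C.
Proof.
  change (S n) with (1 + n)%nat. rewrite poch_add. simpl.
  replace (a + 0)%C with a by ring. ring.
Qed.

Lemma poch_reflect x n : poch (1 - x - INR n) n = ((-1) ^ n * poch x n)%C.
Proof.
  induction n as [|n IH].
  - simpl. ring.
  - rewrite poch_front. replace (1 - x - INR (S n) + 1)%C with (1 - x - INR n)%C.
    + rewrite IH, RtoC_INR_S. simpl. ring.
    + rewrite RtoC_INR_S. ring.
Qed.

Lemma poch_neq0 c n : ~ nonpos_int c -> poch c n <> 0.
Proof.
  intros H. induction n as [|n IH]; simpl.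
  - apply RtoC_neq0; lra.
  - apply Cmult_neq_0; auto. intros E. apply H. exists n.
    replace c with ((c + INR n) + - INR n)%C by ring. rewrite E; ring.
Qed.

(** Taylor coefficients of [(1 - y)^(-a)]. *)
Definition binc (a : C) (n : nat) : C := (poch a n / INR (fact n))%C.

Lemma binc_0 a : binc a 0 = 1.
Proof. unfold binc; simpl. field. Qed.

Lemma binc_S a n : (INR (S n) * binc a (S n) = (a + INR n) * binc a n)%C.
Proof.
  unfold binc. rewrite fact_S_C. simpl poch. field.
  split; auto using INR_S_C_neq0, fact_C_neq0.
Qed.

Lemma binc_reflect x n : binc (1 - x - INR n) n = ((-1) ^ n * binc x n)%C.
Proof. unfold binc. rewrite poch_reflect. unfold Cdiv; ring. Qed.

Definition conv (b d : nat -> C) (k : nat) : C :=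
  csum (fun i => b i * d (k - i)%nat)%C (seq 0 (S k)).

Lemma csum_seq_front (f : nat -> C) n :
  csum f (seq 0 (S n)) = (f O + csum (fun i => f (S i)) (seq 0 n))%C.
Proof. simpl. rewrite <- seq_shift, csum_map. reflexivity. Qed.

Lemma csum_seq_back (f : nat -> C) n :
  csum f (seq 0 (S n)) = (csum f (seq 0 n) + f n)%C.
Proof. rewrite seq_S, csum_app. simpl. ring. Qed.

Lemma csum_scal_r {T} k (f : T -> C) l :
  csum (fun t => f t * k)%C l = (csum f l * k)%C.
Proof. rewrite Cmult_comm, <- csum_scal. apply csum_ext. intros; ring. Qed.

(** Both sides satisfy [(n + 1) v (n + 1) = (a + b + n) v n]: split the factor
    [n + 1] of the [n + 1]-st convolution as [i + (n + 1 - i)]. *)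
Lemma vandermonde a b n : conv (binc a) (binc b) n = binc (a + b) n.
Proof.
  induction n as [|n IH].
  - unfold conv; simpl. rewrite !binc_0. ring.
  - apply (Cmult_cancel_l (INR (S n))); [apply INR_S_C_neq0|].
    rewrite binc_S, <- IH. unfold conv. rewrite <- !csum_scal.
    rewrite (csum_ext _ (fun i => (INR i * binc a i) * binc b (S n - i)%nat +
        binc a i * (INR (S n - i) * binc b (S n - i)%nat))%C).
    2:{ intros i Hi. apply in_seq in Hi.
        rewrite (minus_INR (S n) i), RtoC_minus by lia. ring. }
    rewrite csum_plus, csum_seq_front, (csum_seq_back (fun i => binc a i * _)%C).
    replace (S n - S n)%nat with O by lia. simpl (INR 0).
    rewrite (csum_ext (fun i => INR (S i) * binc a (S i) * _)%C
               (fun i => (a + INR i) * binc a i * binc b (n - i)%nat)%C).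
    2:{ intros i Hi. rewrite binc_S. reflexivity. }
    rewrite (csum_ext (fun i => binc a i * (INR (S n - i) * _))%C
               (fun i => binc a i * ((b + INR (n - i)) * binc b (n - i)%nat))%C).
    2:{ intros i Hi. apply in_seq in Hi. replace (S n - i)%nat with (S (n - i)) by lia.
        rewrite binc_S. reflexivity. }
    match goal with |- (?z * _ * _ + ?x + (?y + ?t * (?z * _)))%C = _ =>
      transitivity (x + y)%C; [ring|] end.
    rewrite <- csum_plus. apply csum_ext. intros i Hi. apply in_seq in Hi.
    rewrite minus_INR, RtoC_minus by lia. ring.
Qed.

Lemma csum_triangle (X : nat -> nat -> C) k :
  csum (fun n => csum (fun m => X m (n - m)%nat) (seq 0 (S n))) (seq 0 (S k)) =
  csum (fun m => csum (X m) (seq 0 (S (k - m)))) (seq 0 (S k)).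
Proof.
  induction k as [|k IH]; [reflexivity|].
  rewrite csum_seq_back, IH.
  rewrite (csum_seq_back (fun m => X m (S k - m)%nat)).
  rewrite (csum_seq_back (fun m => csum (X m) (seq 0 (S (S k - m))))).
  rewrite Cplus_assoc, <- csum_plus. f_equal.
  - apply csum_ext. intros m Hm. apply in_seq in Hm.
    replace (S k - m)%nat with (S (k - m)) by lia.
    rewrite (csum_seq_back (X m) (S (k - m))). reflexivity.
  - replace (S k - S k)%nat with O by lia. simpl. ring.
Qed.

Lemma Cpow_m1_sq n : ((-1) ^ n * (-1) ^ n = 1)%C.
Proof.
  rewrite <- Cpow_mult_l. replace (-1 * -1)%C with (RtoC 1) by ring. apply Cpow_1_l.
Qed.

(** Pfaff's transformation
    [F(A,B;c;u) = (1-u)^(-A) F(A,c-B;c;u/(u-1))], coefficient by coefficient: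
    [(u/(u-1))^n] has coefficients [(-1)^n binc n (k-n)], and
    [(1-u)^(-A) = (1-y)^A] for [y = u/(u-1)].  Two reflections turn the inner
    sum, and then the outer one, into Vandermonde convolutions. *)
Lemma pfaff_coeff A B c k :
  ~ nonpos_int c ->
  csum (fun n => conv (hyp2F1_coeff A (c - B) c) (binc (- A)) n *
                 ((-1) ^ n * binc (INR n) (k - n)%nat))%C (seq 0 (S k)) =
  hyp2F1_coeff A B c k.
Proof.
  intros Hc. set (cc := hyp2F1_coeff A (c - B) c).
  rewrite (csum_ext _ (fun n => csum (fun m => cc m * (binc (- A) (n - m)%nat *
             ((-1) ^ k * binc (1 - INR k) (k - (m + (n - m)))%nat)))%C (seq 0 (S n)))).
  2:{ intros n Hn. apply in_seq in Hn. unfold conv. rewrite <- csum_scal_r.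
      apply csum_ext. intros m Hm. apply in_seq in Hm.
      replace (m + (n - m))%nat with n by lia.
      replace (1 - INR k)%C with (1 - INR n - INR (k - n))%C.
      2:{ rewrite minus_INR, RtoC_minus by lia. ring. }
      rewrite binc_reflect. replace k with (n + (k - n))%nat at 2 by lia.
      rewrite Cpow_add_r.
      transitivity (cc m * binc (- A) (n - m)%nat * (-1) ^ n * binc (INR n) (k - n)%nat *
        ((-1) ^ (k - n) * (-1) ^ (k - n)))%C; [rewrite Cpow_m1_sq; ring|ring]. }
  rewrite (csum_triangle (fun m j => cc m * (binc (- A) j *
      ((-1) ^ k * binc (1 - INR k) (k - (m + j))%nat)))%C).
  rewrite (csum_ext _ (fun m => (poch A k / poch c k * (-1) ^ k) *
      (binc (c - B) m * binc (1 - c - INR k) (k - m)%nat))%C).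
  - rewrite csum_scal. fold (conv (binc (c - B)) (binc (1 - c - INR k)) k).
    rewrite vandermonde.
    replace (c - B + (1 - c - INR k))%C with (1 - B - INR k)%C by ring.
    rewrite binc_reflect. unfold hyp2F1_coeff, binc.
    transitivity (poch A k * poch B k / (poch c k * INR (fact k)) * ((-1)^k * (-1)^k))%C.
    { field. split; [apply fact_C_neq0|apply poch_neq0; auto]. }
    rewrite Cpow_m1_sq; ring.
  - intros m Hm. apply in_seq in Hm. rewrite csum_scal.
    rewrite (csum_ext _ (fun i => (-1) ^ k *
       (binc (- A) i * binc (1 - INR k) (k - m - i)%nat))%C).
    2:{ intros i Hi. replace (k - (m + i))%nat with (k - m - i)%nat by lia. ring. }
    rewrite csum_scal. fold (conv (binc (- A)) (binc (1 - INR k)) (k - m)).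
    rewrite vandermonde.
    assert (HI : RtoC (INR (k - m)) = (INR k - INR m)%C).
    { rewrite minus_INR, RtoC_minus by lia. ring. }
    replace (- A + (1 - INR k))%C with (1 - (A + INR m) - INR (k - m))%C.
    2:{ rewrite HI. ring. }
    rewrite binc_reflect.
    replace (1 - c - INR k)%C with (1 - (c + INR m) - INR (k - m))%C.
    2:{ rewrite HI. ring. }
    rewrite binc_reflect. unfold cc, hyp2F1_coeff, binc.
    replace (poch A k) with (poch A m * poch (A + INR m) (k - m))%C.
    2:{ rewrite <- poch_add. f_equal; lia. }
    assert (E : poch c k = (poch c m * poch (c + INR m) (k - m))%C).
    { rewrite <- poch_add. f_equal; lia. }
    assert (N := poch_neq0 c k Hc).
    rewrite E in N |- *. field.
    assert (poch c m <> 0) by (apply poch_neq0; auto).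
    repeat split; auto using fact_C_neq0. intros E'; apply N; rewrite E'; ring.
Qed.

(** * Absolutely convergent power series *)

(** The change of variables [(i, j) -> (i + j, i)] turns the product family into
    a triangular array, whose row sums are the convolution. *)
Lemma has_sum_conv (b d : nat -> C) x y :
  abs_summable b -> abs_summable d -> has_sum b x -> has_sum d y ->
  has_sum (conv b d) (x * y)%C.
Proof.
  intros Sb Sd Hb Hd. assert (HF := has_sum_prod b d x y Sb Sd Hb Hd).
  set (G := fun p : nat * nat => if le_dec (snd p) (fst p)
            then (b (snd p) * d (fst p - snd p)%nat)%C else RtoC 0).
  apply (has_sum_rows G).
  - apply (has_sum_inj (fun p : nat * nat => (fst p + snd p, fst p)%nat) G).
    + intros [i j] [i' j']; simpl; intros E; injection E; intros; f_equal; lia.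
    + intros [k i] H. unfold G; simpl. destruct (le_dec i k); auto.
      destruct (H (i, k - i)%nat). simpl. f_equal; lia.
    + eapply has_sum_ext; [|exact HF]. intros [i j]. unfold G; simpl.
      destruct (le_dec i (i + j)); [|lia]. do 2 f_equal; lia.
  - intros k. unfold conv.
    rewrite (csum_ext _ (fun i => G (k, i))).
    + apply (has_sum_finite (fun i => G (k, i))). apply seq_NoDup.
      intros i Hi. unfold G; simpl. destruct (le_dec i k); auto.
      destruct Hi. apply in_seq; lia.
    + intros i Hi. apply in_seq in Hi. unfold G; simpl. destruct (le_dec i k); auto. lia.
Qed.

(** The l^1 norm is submultiplicative: apply the product rule to the moduli,
    whose convolution dominates. *)
Lemma bounded_sums_conv (b d : nat -> C) M N :
  bounded_sums (fun i => Cmod (b i)) M -> bounded_sums (fun i => Cmod (d i)) N ->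
  bounded_sums (fun i => Cmod (conv b d i)) (M * N).
Proof.
  intros HM HN.
  assert (Ha : forall (f : nat -> C) K, bounded_sums (fun i => Cmod (f i)) K ->
    bounded_sums (fun i => Cmod (RtoC (Cmod (f i)))) K).
  { intros f K. apply bounded_sums_le. intros t. rewrite Cmod_R, Rabs_pos_eq; [lra|apply Cmod_ge_0]. }
  destruct (has_sum_nonneg (fun i => Cmod (b i)) M) as [x Hx]; auto using Cmod_ge_0.
  destruct (has_sum_nonneg (fun i => Cmod (d i)) N) as [y Hy]; auto using Cmod_ge_0.
  assert (Hxy := has_sum_conv _ _ _ _ (ex_intro _ M (Ha b M HM)) (ex_intro _ N (Ha d N HN)) Hx Hy).
  assert (Hx' := has_sum_bound _ _ _ (Ha b M HM) Hx).
  assert (Hy' := has_sum_bound _ _ _ (Ha d N HN) Hy).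
  rewrite <- RtoC_mult in Hxy.
  assert (Hp : forall (f : nat -> C) (v : R), has_sum (fun i => RtoC (Cmod (f i))) v -> 0 <= v).
  { intros f v Hv. apply (bounded_sums_ge0 (fun i => Cmod (f i))).
    apply has_sum_RtoC_nonneg_bound; auto using Cmod_ge_0. }
  assert (Hx0 := Hp b x Hx). assert (Hy0 := Hp d y Hy).
  rewrite Cmod_R, Rabs_pos_eq in Hx', Hy' by auto.
  set (g := fun k => rsum (fun i => Cmod (b i) * Cmod (d (k - i)%nat)) (seq 0 (S k))).
  assert (HG : bounded_sums g (x * y)).
  { apply has_sum_RtoC_nonneg_bound.
    - intros k. apply rsum_ge0. intros. apply Rmult_le_pos; apply Cmod_ge_0.
    - eapply has_sum_ext; [|exact Hxy].
      intros k. unfold conv, g. rewrite <- csum_RtoC. apply csum_ext.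
      intros; rewrite RtoC_mult; auto. }
  intros l Hl. apply Rle_trans with (rsum g l).
  - apply rsum_le. intros k _. unfold conv, g. eapply Rle_trans; [apply Cmod_csum|].
    apply Req_le, rsum_ext. intros; apply Cmod_mult.
  - eapply Rle_trans; [apply HG; auto|]. apply Rmult_le_compat; auto.
Qed.

Lemma conv_pow (b d : nat -> C) h k :
  conv (fun i => b i * h ^ i)%C (fun i => d i * h ^ i)%C k = (conv b d k * h ^ k)%C.
Proof.
  unfold conv. rewrite <- csum_scal_r. apply csum_ext. intros i Hi.
  apply in_seq in Hi. replace k with (i + (k - i))%nat at 4 by lia.
  rewrite Cpow_add_r. ring.
Qed.

Lemma bounded_sums_ratio (g : nat -> R) q N :
  (forall n, 0 <= g n) -> q < 1 -> (forall n, (N <= n)%nat -> g (S n) <= q * g n) ->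
  exists M, bounded_sums g M.
Proof.
  intros Hg Hq H. exists (rsum g (seq 0 N) + g N / (1 - q)).
  assert (Hk : forall k, rsum g (seq 0 (N + k)) + g (N + k)%nat / (1 - q) <=
            rsum g (seq 0 N) + g N / (1 - q)).
  { induction k as [|k IH]; [rewrite Nat.add_0_r; lra|].
    eapply Rle_trans; [|exact IH]. rewrite Nat.add_succ_r, seq_S, rsum_app.
    simpl. specialize (H (N + k)%nat ltac:(lia)).
    assert (g (S (N + k)) / (1 - q) <= q * g (N + k)%nat / (1 - q)).
    { apply Rmult_le_compat_r; auto. apply Rlt_le, Rinv_0_lt_compat; lra. }
    assert (q * g (N + k)%nat / (1 - q) + g (N + k)%nat = g (N + k)%nat / (1 - q)) by (field; lra).
    lra. }
  apply bounded_sums_nat; auto. intros n.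
  eapply Rle_trans; [|apply (Hk n)].
  assert (rsum g (seq 0 n) <= rsum g (seq 0 (N + n))).
  { apply rsum_incl; auto; try apply seq_NoDup. intros x Hx.
    apply in_seq in Hx; apply in_seq; lia. }
  assert (0 <= g (N + n)%nat / (1 - q)).
  { apply Rdiv_le_0_compat; [auto|lra]. }
  lra.
Qed.

Lemma bounded_sums_geom q : 0 <= q < 1 -> bounded_sums (fun n => q ^ n) (/ (1 - q)).
Proof.
  intros Hq. apply bounded_sums_nat.
  - intros; apply pow_le; lra.
  - intros n. assert (E : rsum (fun n => q ^ n) (seq 0 n) = (1 - q ^ n) / (1 - q)).
    { induction n as [|n IH]; [simpl; field; lra|].
      rewrite seq_S, rsum_app, IH. simpl. field. lra. }
    rewrite E. assert (0 <= q ^ n) by (apply pow_le; lra).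
    apply Rle_trans with (1 / (1 - q)); [|lra].
    apply Rmult_le_compat_r; [|lra]. apply Rlt_le, Rinv_0_lt_compat; lra.
Qed.

Lemma abs_summable_geom (x : C) : Cmod x < 1 -> abs_summable (fun n => x ^ n)%C.
Proof.
  intros Hx. exists (/ (1 - Cmod x)).
  eapply bounded_sums_le; [|apply bounded_sums_geom; split; [apply Cmod_ge_0|exact Hx]].
  intros n. simpl. rewrite Cmod_pow. lra.
Qed.

Lemma has_sum_shift (f : nat -> C) s :
  has_sum f s <-> has_sum (fun n => f (S n)) (s - f O)%C.
Proof.
  assert (Hz : has_sum (fun n => match n with O => f O | _ => RtoC 0 end) (f O)).
  { assert (H := has_sum_finite (fun n => match n with O => f O | _ => RtoC 0 end) [O]).
    simpl in H. rewrite Cplus_0_r in H. apply H; [repeat constructor; auto|].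
    intros [|n] Hn; auto. destruct Hn; left; auto. }
  assert (Hi : forall s', has_sum (fun n => match n with O => RtoC 0 | S n => f (S n) end) s' <->
               has_sum (fun n => f (S n)) s').
  { intros s'. apply (has_sum_inj S (fun n => match n with O => RtoC 0 | S n => f (S n) end)).
    - intros; lia.
    - intros [|n] H; auto. destruct (H n); auto. }
  split; intros H.
  - apply Hi. assert (H1 := has_sum_plus _ _ _ _ H (has_sum_scal (-1) _ _ Hz)).
    replace (s - f O)%C with (s + -1 * f O)%C by ring.
    eapply has_sum_ext; [|exact H1]. intros [|n]; simpl; ring.
  - apply Hi in H. assert (H1 := has_sum_plus _ _ _ _ H Hz).
    replace (s - f O + f O)%C with s in H1 by ring.
    eapply has_sum_ext; [|exact H1]. intros [|n]; simpl; ring.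
Qed.

Lemma has_sum_geom (x : C) : Cmod x < 1 -> has_sum (fun n => x ^ n)%C (/ (1 - x))%C.
Proof.
  intros Hx. destruct (abs_summable_has_sum _ (abs_summable_geom x Hx)) as [s Hs].
  assert (Hn : (1 - x)%C <> 0).
  { intros E. assert (x = 1) by (replace x with (1 - (1 - x))%C by ring; rewrite E; ring).
    subst x. rewrite Cmod_1 in Hx. lra. }
  replace (/ (1 - x))%C with s; auto.
  assert (H1 := proj1 (has_sum_shift _ _) Hs).
  assert (H2 := has_sum_scal x _ _ Hs).
  assert (E : (s - x ^ 0 = x * s)%C) by (eapply has_sum_unique; [exact H1|exact H2]).
  simpl in E. apply (Cmult_cancel_l (1 - x)); auto.
  rewrite Cinv_r; auto. replace ((1 - x) * s)%C with ((s - 1) - x * s + 1)%C by ring.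
  rewrite E; ring.
Qed.

(** The ratio of consecutive terms tends to [x]. *)
Lemma hyp2F1_coeff_summable A D c x :
  Cmod x < 1 -> ~ nonpos_int c -> abs_summable (fun n => hyp2F1_coeff A D c n * x ^ n)%C.
Proof.
  intros Hx Hc.
  set (K := Cmod A + Cmod D + Cmod c).
  assert (HA := Cmod_ge_0 A). assert (HD := Cmod_ge_0 D). assert (HC := Cmod_ge_0 c).
  assert (HX := Cmod_ge_0 x).
  (* three factors 1 + dl absorb A, D and c in the ratio, and
     (1 + dl)^3 <= 1 + 7 dl keeps it below 1 *)
  set (dl := (1 - Cmod x) / 8). assert (Hdl : 0 < dl <= 1/8) by (unfold dl; lra).
  set (q := Cmod x * (1 + dl) ^ 3).
  assert (Hq : q < 1).
  { unfold q. apply Rle_lt_trans with (Cmod x * (1 + 7 * dl)).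
    - apply Rmult_le_compat_l; auto. simpl. nra.
    - unfold dl. nra. }
  destruct (INR_unbounded (2 * K / dl + 2 * K + 1)) as [N HN].
  destruct (bounded_sums_ratio (fun n => Cmod (hyp2F1_coeff A D c n * x ^ n)) q N) as [M HM].
  - intros; apply Cmod_ge_0.
  - exact Hq.
  - intros n Hn.
    assert (E : (hyp2F1_coeff A D c (S n) * x ^ S n =
      ((A + INR n) * (D + INR n) / ((c + INR n) * INR (S n)) * x) * (hyp2F1_coeff A D c n * x ^ n))%C).
    { unfold hyp2F1_coeff. simpl poch. rewrite fact_S_C. simpl Cpow. field.
      assert (Hp := poch_neq0 c (S n) Hc). simpl in Hp.
      repeat split; auto using fact_C_neq0, INR_S_C_neq0, poch_neq0.
      intros E; apply Hp; rewrite E; ring. }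
    rewrite E, Cmod_mult. apply Rmult_le_compat_r; [apply Cmod_ge_0|].
    apply le_INR in Hn.
    assert (HK : 0 <= K) by (unfold K; lra).
    assert (Hkd : 0 <= K / dl) by (apply Rdiv_le_0_compat; lra).
    assert (HnK : K <= dl / 2 * INR n).
    { apply Rmult_le_reg_l with (2 / dl). apply Rdiv_lt_0_compat; lra.
      field_simplify; lra. }
    set (t := INR n) in *.
    assert (H1 : Cmod (A + t) <= (1 + dl) * t).
    { eapply Rle_trans; [apply Cmod_triangle|]. rewrite Cmod_R, Rabs_pos_eq by lra.
      unfold K in HnK. nra. }
    assert (H2 : Cmod (D + t) <= (1 + dl) * t).
    { eapply Rle_trans; [apply Cmod_triangle|]. rewrite Cmod_R, Rabs_pos_eq by lra.
      unfold K in HnK. nra. }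
    assert (H3 : t / (1 + dl) <= Cmod (c + t)).
    { assert (t <= Cmod (c + t) + Cmod c).
      { rewrite <- (Rabs_pos_eq t) at 1 by lra. rewrite <- Cmod_R.
        replace (RtoC t) with ((c + t) + - c)%C at 1 by ring.
        eapply Rle_trans; [apply Cmod_triangle|]. rewrite Cmod_opp; lra. }
      apply Rmult_le_reg_r with (1 + dl); [lra|].
      unfold Rdiv. rewrite Rmult_assoc, Rinv_l by lra. unfold K in HnK. nra. }
    assert (H4 : t <= Cmod (INR (S n))).
    { rewrite Cmod_R, Rabs_pos_eq by apply pos_INR. rewrite S_INR. unfold t. lra. }
    assert (H5 : 0 < t / (1 + dl)) by (apply Rdiv_lt_0_compat; lra).
    rewrite Cmod_mult, Cmod_div.
    2:{ intros E2. assert (Cmod ((c + t) * INR (S n)) = 0) by (rewrite E2; apply Cmod_0).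
        rewrite Cmod_mult in H. nra. }
    rewrite !Cmod_mult. unfold q.
    rewrite (Rmult_comm (Cmod x)). apply Rmult_le_compat_r; auto.
    apply Rle_trans with (((1 + dl) * t) * ((1 + dl) * t) / (t / (1 + dl) * t)).
    2:{ apply Req_le. field. lra. }
    apply Rmult_le_compat.
    + apply Rmult_le_pos; apply Cmod_ge_0.
    + apply Rlt_le, Rinv_0_lt_compat. nra.
    + apply Rmult_le_compat; auto using Cmod_ge_0.
    + apply Rinv_le_contravar. nra. apply Rmult_le_compat; lra.
  - exists M. exact HM.
Qed.

Lemma nonpos_int_1 : ~ nonpos_int 1.
Proof.
  intros [n E]. injection E. intros H. assert (Hn := pos_INR n). lra.
Qed.

Lemma binc_summable a x : Cmod x < 1 -> abs_summable (fun n => binc a n * x ^ n)%C.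
Proof.
  intros Hx. replace (binc a) with (hyp2F1_coeff a 1 1).
  - apply hyp2F1_coeff_summable; auto. apply nonpos_int_1.
  - apply functional_extensionality. intros n. unfold hyp2F1_coeff, binc.
    field. split; [apply fact_C_neq0|apply poch_neq0, nonpos_int_1].
Qed.

(** * Analytic continuation of the hypergeometric series *)

Lemma pow_n_C (x : C) n : pow_n (K := C_Ring) x n = (x ^ n)%C.
Proof. induction n as [|n IH]; simpl; [reflexivity|]. rewrite IH. reflexivity. Qed.

Lemma is_pseries_C_iff (b : nat -> C) (x s : C) :
  is_pseries (K := C_AbsRing) (V := C_NormedModule) b x s <->
  is_series (V := C_NormedModule) (fun k => b k * x ^ k)%C s.
Proof.
  unfold is_pseries.
  assert (E : (fun k => scal (V := C_NormedModule) (pow_n (K := C_Ring) x k) (b k)) =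
              (fun k => b k * x ^ k)%C).
  { apply functional_extensionality. intros k. rewrite pow_n_C. apply Cmult_comm. }
  split; intros H.
  - rewrite <- E. exact H.
  - rewrite <- E in H. exact H.
Qed.

Lemma has_sum_is_pseries (b : nat -> C) x s :
  has_sum (fun k => b k * x ^ k)%C s ->
  is_pseries (K := C_AbsRing) (V := C_NormedModule) b x s.
Proof. intros H. apply is_pseries_C_iff, has_sum_is_series, H. Qed.

Lemma Re_csum {T} (f : T -> C) l : Re (csum f l) = rsum (fun t => Re (f t)) l.
Proof. induction l as [|a l IH]; simpl; auto. rewrite <- IH. reflexivity. Qed.

Lemma Im_csum {T} (f : T -> C) l : Im (csum f l) = rsum (fun t => Im (f t)) l.
Proof. induction l as [|a l IH]; simpl; auto. rewrite <- IH. reflexivity. Qed.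

Lemma is_series_Re_Im (f : nat -> C) s :
  is_series (V := C_NormedModule) f s ->
  is_series (fun n => Re (f n)) (Re s) /\ is_series (fun n => Im (f n)) (Im s).
Proof.
  intros H. rewrite is_series_C_iff in H.
  split;
    [change (is_lim_seq (sum_n (fun n => Re (f n))) (Re s))
    |change (is_lim_seq (sum_n (fun n => Im (f n))) (Im s))];
    apply is_lim_seq_spec; intros eps; destruct (H eps (cond_pos eps)) as [N HN]; exists N; intros n Hn;
    rewrite <- rsum_seq; specialize (HN n Hn).
  - rewrite <- (Re_csum f). eapply Rle_lt_trans; [|exact HN].
    eapply Rle_trans; [|apply re_le_Cmod]. apply Req_le. f_equal.
  - rewrite <- (Im_csum f). eapply Rle_lt_trans; [|exact HN].
    eapply Rle_trans; [|apply im_le_Cmod]. apply Req_le. f_equal.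
Qed.

(** ** Uniqueness *)

Lemma is_pseries_CV_radius (d : nat -> R) (x s : R) :
  is_pseries d x s -> Rbar_le (Rabs x) (CV_radius d).
Proof.
  intros H.
  assert (Hl : is_lim_seq (fun n => d n * x ^ n) 0).
  { apply ex_series_lim_0. exists s. apply is_pseries_R in H. exact H. }
  destruct (filterlim_bounded (fun n => d n * x ^ n)) as [M HM].
  { exists 0. exact Hl. }
  apply (proj1 (CV_radius_bounded d)). exists M. intros n. specialize (HM n).
  change (Rabs (d n * x ^ n) <= M) in HM.
  rewrite Rabs_mult, RPow_abs, Rabs_Rabsolu, <- Rabs_mult. exact HM.
Qed.

Lemma pseries_zero_left_const (d : nat -> R) (r : R) :
  0 < r -> Rbar_lt 0 (CV_radius d) ->
  (forall x, - r < x < 0 -> PSeries d x = 0) -> d O = 0.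
Proof.
  intros Hr Hd H. apply NNPP; intros Hne.
  assert (Hc : continuity_pt (PSeries d) 0).
  { apply PSeries_continuity. rewrite Rabs_R0; auto. }
  destruct (Hc (Rabs (d O))) as [al [Hal Hx]]; [apply Rabs_pos_lt; auto|].
  set (x := - (Rmin al r / 2)).
  assert (Hm : 0 < Rmin al r) by (apply Rmin_pos; lra).
  assert (Hm1 := Rmin_l al r). assert (Hm2 := Rmin_r al r).
  specialize (Hx x). simpl in Hx. unfold Rdist in Hx.
  rewrite H, PSeries_0 in Hx by (unfold x; lra).
  assert (Hlt : Rabs (0 - d O) < Rabs (d O)).
  { apply Hx. split.
    - split; [exact I|unfold x; lra].
    - unfold x. rewrite Rabs_left; lra. }
  rewrite Rminus_0_l, Rabs_Ropp in Hlt. lra.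
Qed.

(** The constant term vanishes by continuity from the left; dividing by [x]
    passes to the next coefficient. *)
Lemma pseries_zero_left (d : nat -> R) (r : R) :
  0 < r -> Rbar_lt 0 (CV_radius d) ->
  (forall x, - r < x < 0 -> PSeries d x = 0) -> forall n, d n = 0.
Proof.
  intros Hr Hd H n. revert d Hd H. induction n as [|n IH]; intros d Hd H.
  - apply (pseries_zero_left_const d r); auto.
  - apply (IH (PS_decr_1 d)).
    + rewrite CV_radius_decr_1; auto.
    + intros x Hx. assert (E := H x Hx).
      rewrite PSeries_decr_1_aux in E by (apply (pseries_zero_left_const d r); auto).
      apply Rmult_integral in E. destruct E; [lra|auto].
Qed.

Definition real_analytic_at (g : R -> R) (t0 : R) : Prop :=
  exists (d : nat -> R) (r : R), 0 < r /\
    forall t, Rabs (t - t0) < r -> is_pseries d (t - t0) (g t).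

Lemma real_analytic_zero_left (g : R -> R) t0 r :
  0 < r -> real_analytic_at g t0 -> (forall t, t0 - r < t < t0 -> g t = 0) ->
  exists r', 0 < r' /\ forall t, Rabs (t - t0) < r' -> g t = 0.
Proof.
  intros Hr [d [rho [Hrho Hd]]] Hz. exists rho; split; auto.
  assert (H0 : forall n, d n = 0).
  { apply (pseries_zero_left d (Rmin r rho)).
    - apply Rmin_pos; auto.
    - assert (Hr2 : is_pseries d (rho / 2) (g (t0 + rho / 2))).
      { replace (rho / 2) with (t0 + rho / 2 - t0) at 1 by ring. apply Hd.
        replace (t0 + rho / 2 - t0) with (rho / 2) by ring. rewrite Rabs_pos_eq; lra. }
      apply is_pseries_CV_radius in Hr2. rewrite Rabs_pos_eq in Hr2 by lra.
      eapply Rbar_lt_le_trans; [|exact Hr2]. simpl; lra.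
    - intros x Hx. assert (Hm1 := Rmin_l r rho). assert (Hm2 := Rmin_r r rho).
      specialize (Hd (t0 + x)). replace (t0 + x - t0) with x in Hd by ring.
      rewrite (Hz (t0 + x)) in Hd by lra. apply is_pseries_unique, Hd.
      apply Rabs_def1; lra. }
  intros t Ht. specialize (Hd t Ht). apply is_pseries_unique in Hd. rewrite <- Hd.
  rewrite <- (PSeries_const_0 (t - t0)). apply PSeries_ext. intros; auto.
Qed.

(** The supremum of the initial segments on which the function vanishes lies in
    the zero set, together with a neighbourhood. *)
Lemma real_identity_theorem (g : R -> R) r0 :
  0 < r0 -> (forall t, 0 <= t <= 1 -> real_analytic_at g t) ->
  (forall t, 0 <= t < r0 -> g t = 0) -> g 1 = 0.
Proof.
  intros Hr0 Ha Hz.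
  set (E := fun t => 0 <= t <= 1 /\ forall x, 0 <= x <= t -> g x = 0).
  assert (HE0 : E (Rmin 1 (r0 / 2))).
  { assert (Hm1 := Rmin_l 1 (r0/2)). assert (Hm2 := Rmin_r 1 (r0/2)).
    assert (0 < Rmin 1 (r0/2)) by (apply Rmin_pos; lra).
    split; [lra|]. intros x Hx. apply Hz. lra. }
  destruct (completeness E) as [T [Hub Hlub]].
  { exists 1. intros x [Hx _]; lra. }
  { eexists; exact HE0. }
  assert (HT0 : 0 < T).
  { apply Rlt_le_trans with (Rmin 1 (r0/2)); [apply Rmin_pos; lra|apply Hub; auto]. }
  assert (HT1 : T <= 1) by (apply Hlub; intros x [Hx _]; lra).
  assert (HzT : forall t, 0 <= t < T -> g t = 0).
  { intros t Ht. apply NNPP; intros Hne. assert (T <= t); [|lra].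
    apply Hlub. intros x [Hx Hgx]. apply Rnot_lt_le; intros Hlt.
    apply Hne, Hgx. lra. }
  destruct (real_analytic_zero_left g T T) as [r [Hr HrT]]; auto.
  { apply Ha; lra. }
  { intros t Ht. apply HzT. lra. }
  destruct (Rle_lt_or_eq_dec T 1 HT1) as [HT|HT].
  - exfalso. set (T' := Rmin 1 (T + r / 2)).
    assert (Hm1 := Rmin_l 1 (T + r/2)). assert (Hm2 := Rmin_r 1 (T + r/2)).
    assert (HT' : T < T') by (apply Rmin_glb_lt; lra).
    assert (T' <= T); [|lra]. apply Hub. fold T' in Hm1, Hm2. split; [lra|].
    intros x Hx. destruct (Rlt_le_dec x T); [apply HzT; lra|].
    apply HrT. rewrite Rabs_pos_eq; lra.
  - subst T. apply HrT. replace (1 - 1) with 0 by ring. rewrite Rabs_R0; auto.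
Qed.

Lemma Cpow_RtoC (x : R) n : (RtoC x ^ n)%C = RtoC (x ^ n).
Proof. induction n as [|n IH]; simpl; auto. rewrite IH, RtoC_mult; auto. Qed.

(** For the identity theorem only the values on the segment matter, so that
    real power series in the parameter of the segment suffice. *)
Lemma analytic_at_real (f : C -> C) (w t0 : R) :
  analytic_at f (t0 * w)%C ->
  real_analytic_at (fun t => Re (f (t * w)%C)) t0 /\
  real_analytic_at (fun t => Im (f (t * w)%C)) t0.
Proof.
  intros [b [r [Hr Hb]]].
  assert (Hw := Rabs_pos w).
  assert (H : forall t, Rabs (t - t0) < r / (Rabs w + 1) ->
     is_series (V := C_NormedModule) (fun k => b k * w ^ k * RtoC ((t - t0) ^ k))%C (f (t * w)%C)).
  { intros t Ht. specialize (Hb (t * w)%C).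
    replace (t * w - t0 * w)%C with (RtoC ((t - t0) * w)) in Hb.
    2:{ rewrite RtoC_mult, RtoC_minus. ring. }
    rewrite is_pseries_C_iff in Hb. eapply is_series_ext; [|apply Hb].
    - intros k. simpl. rewrite !Cpow_RtoC, Rpow_mult_distr, RtoC_mult. ring.
    - rewrite Cmod_R, Rabs_mult.
      apply Rle_lt_trans with (Rabs (t - t0) * (Rabs w + 1)).
      + apply Rmult_le_compat_l; [apply Rabs_pos|lra].
      + apply Rmult_lt_reg_r with (/ (Rabs w + 1)); [apply Rinv_0_lt_compat; lra|].
        rewrite Rmult_assoc, Rinv_r, Rmult_1_r by lra. exact Ht. }
  assert (Hr' : 0 < r / (Rabs w + 1)) by (apply Rdiv_lt_0_compat; lra).
  split.
  - exists (fun k => Re (b k * w ^ k)%C), (r / (Rabs w + 1)). split; auto.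
    intros t Ht. apply is_pseries_R.
    eapply is_series_ext; [|apply (is_series_Re_Im _ _ (H t Ht))].
    intros k. simpl. ring.
  - exists (fun k => Im (b k * w ^ k)%C), (r / (Rabs w + 1)). split; auto.
    intros t Ht. apply is_pseries_R.
    eapply is_series_ext; [|apply (is_series_Re_Im _ _ (H t Ht))].
    intros k. simpl. ring.
Qed.

Lemma real_analytic_minus g h t :
  real_analytic_at g t -> real_analytic_at h t -> real_analytic_at (fun x => g x - h x) t.
Proof.
  intros [d [r [Hr Hd]]] [d' [r' [Hr' Hd']]].
  exists (PS_minus d d'), (Rmin r r'). split; [apply Rmin_pos; auto|].
  intros x Hx. apply (is_pseries_minus d d').
  - apply Hd. eapply Rlt_le_trans; [exact Hx|apply Rmin_l].
  - apply Hd'. eapply Rlt_le_trans; [exact Hx|apply Rmin_r].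
Qed.

Lemma is_hyp2F1_unique A B c (w : R) v v' :
  is_hyp2F1 A B c w v -> is_hyp2F1 A B c w v' -> v = v'.
Proof.
  intros [f [[r [Hr Hf]] [Ha Hv]]] [f' [[r' [Hr' Hf']] [Ha' Hv']]].
  set (rho := Rmin r r' / (Rabs w + 1)).
  assert (Hw := Rabs_pos w).
  assert (Hm : 0 < Rmin r r') by (apply Rmin_pos; auto).
  assert (Hrho : 0 < rho) by (apply Rdiv_lt_0_compat; lra).
  assert (Heq : forall t, 0 <= t < rho -> f (t * w)%C = f' (t * w)%C).
  { intros t Ht.
    assert (Hlt : Cmod (t * w)%C < Rmin r r').
    { rewrite <- RtoC_mult, Cmod_R, Rabs_mult, (Rabs_pos_eq t) by lra.
      apply Rle_lt_trans with (t * (Rabs w + 1)).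
      - apply Rmult_le_compat_l; lra.
      - apply Rmult_lt_reg_r with (/ (Rabs w + 1)); [apply Rinv_0_lt_compat; lra|].
        rewrite Rmult_assoc, Rinv_r, Rmult_1_r by lra. apply Ht. }
    assert (H1 : is_pseries (K := C_AbsRing) (V := C_NormedModule) (hyp2F1_coeff A B c) (t * w)%C (f (t * w)%C)).
    { apply Hf. eapply Rlt_le_trans; [exact Hlt|apply Rmin_l]. }
    assert (H2 : is_pseries (K := C_AbsRing) (V := C_NormedModule) (hyp2F1_coeff A B c) (t * w)%C (f' (t * w)%C)).
    { apply Hf'. eapply Rlt_le_trans; [exact Hlt|apply Rmin_r]. }
    eapply is_series_C_unique; [exact (proj1 (is_pseries_C_iff _ _ _) H1)|exact (proj1 (is_pseries_C_iff _ _ _) H2)]. }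
  assert (HR : Re (f (1%R * w)%C) - Re (f' (1%R * w)%C) = 0).
  { apply (real_identity_theorem (fun t => Re (f (t * w)%C) - Re (f' (t * w)%C)) rho); auto.
    - intros t Ht. apply real_analytic_minus; apply analytic_at_real; auto.
    - intros t Ht. rewrite Heq by auto. ring. }
  assert (HI : Im (f (1%R * w)%C) - Im (f' (1%R * w)%C) = 0).
  { apply (real_identity_theorem (fun t => Im (f (t * w)%C) - Im (f' (t * w)%C)) rho); auto.
    - intros t Ht. apply real_analytic_minus; apply analytic_at_real; auto.
    - intros t Ht. rewrite Heq by auto. ring. }
  rewrite Cmult_1_l in HR, HI. rewrite Hv, Hv' in HR, HI.
  destruct v as [a b], v' as [a' b']; simpl in HR, HI. f_equal; lra.
Qed.

(** ** Existence *)

Definition pfaff_map (u : C) : C := (u / (u - 1))%C.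

(** Taylor coefficients of [pfaff_map] at the point [u0 = 1 - 1/q]:
    [u/(u-1) = 1 - q/(1 - q h)] for [u = u0 + h]. *)
Definition pfaff_map_coeff (q : R) (j : nat) : C :=
  match j with O => RtoC (1 - q) | S _ => RtoC (- q ^ (S j)) end.

Fixpoint pfaff_map_pow_coeff (q : R) (n : nat) : nat -> C :=
  match n with
  | O => fun j => match j with O => RtoC 1 | S _ => RtoC 0 end
  | S n => conv (pfaff_map_coeff q) (pfaff_map_pow_coeff q n)
  end.

Lemma bounded_sums_shift (g : nat -> R) M :
  (forall n, 0 <= g n) -> bounded_sums (fun n => g (S n)) M -> bounded_sums g (g O + M).
Proof.
  intros Hg H. apply bounded_sums_nat; auto. intros [|n].
  - simpl. assert (H0 := bounded_sums_ge0 _ _ H). specialize (Hg O); lra.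
  - simpl. rewrite <- seq_shift, rsum_map. apply Rplus_le_compat_l, H, seq_NoDup.
Qed.

(** The radius [1/3] makes the terms of positive order sum to at most [q/2]
    for every [q <= 1], which leaves a norm less than 1. *)
Lemma pfaff_map_coeff_bound q : 0 < q <= 1 ->
  bounded_sums (fun j => Cmod (pfaff_map_coeff q j * RtoC (1/3) ^ j)) (1 - q / 2).
Proof.
  intros Hq.
  replace (1 - q/2) with (Cmod (pfaff_map_coeff q 0 * RtoC (1/3) ^ 0) + q / 3 * / (1 - 1/3)).
  - apply bounded_sums_shift. intros; apply Cmod_ge_0.
    eapply bounded_sums_le; [|apply bounded_sums_scal, bounded_sums_geom; lra].
    intros n. unfold pfaff_map_coeff. rewrite Cpow_RtoC, <- RtoC_mult, Cmod_R, Rabs_mult.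
    rewrite Rabs_Ropp, !Rabs_pos_eq by (apply pow_le; lra).
    simpl. assert (0 <= (1/3)^n) by (apply pow_le; lra).
    assert (q ^ n <= 1). { rewrite <- (pow1 n). apply pow_incr; lra. }
    replace (q * (q * q ^ n) * (1 / 3 * (1 / 3) ^ n)) with (q / 3 * (1/3)^n * (q * q^n)) by field.
    rewrite <- (Rmult_1_r (q / 3 * (1/3)^n)) at 2.
    apply Rmult_le_compat_l. nra. nra.
  - simpl. rewrite Cmult_1_r, Cmod_R, Rabs_pos_eq by lra. field.
Qed.

Lemma pfaff_map_pow_coeff_bound q n : 0 < q <= 1 ->
  bounded_sums (fun j => Cmod (pfaff_map_pow_coeff q n j * RtoC (1/3) ^ j)) ((1 - q / 2) ^ n).
Proof.
  intros Hq. induction n as [|n IH].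
  - replace ((1 - q/2) ^ 0) with (Cmod (pfaff_map_pow_coeff q 0 0 * RtoC (1/3) ^ 0) + 0).
    + apply (bounded_sums_shift (fun j => Cmod (pfaff_map_pow_coeff q 0 j * RtoC (1/3) ^ j))).
      intros; apply Cmod_ge_0. intros l Hl. rewrite (rsum_ext _ (fun j => 0 * 0)).
      * rewrite rsum_scal; lra.
      * intros j _. simpl. rewrite Cmult_0_l, Cmod_0. ring.
    + simpl. rewrite Cmult_1_r, Cmod_R, Rabs_pos_eq; lra.
  - simpl pfaff_map_pow_coeff. simpl pow.
    eapply bounded_sums_le; [|apply bounded_sums_conv; [apply pfaff_map_coeff_bound; auto|exact IH]].
    intros j. apply Req_le. f_equal. symmetry. apply conv_pow.
Qed.

Lemma weight_le (b h : C) r k : Cmod h <= r -> Cmod (b * h ^ k) <= Cmod (b * RtoC r ^ k).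
Proof.
  intros H. assert (H0 := Cmod_ge_0 h). rewrite !Cmod_mult, !Cmod_pow, Cmod_R, Rabs_pos_eq by lra.
  apply Rmult_le_compat_l; [apply Cmod_ge_0|]. apply pow_incr; lra.
Qed.

Lemma pfaff_map_pow_summable q n h : 0 < q <= 1 -> Cmod h <= 1/3 ->
  abs_summable (fun j => pfaff_map_pow_coeff q n j * h ^ j)%C.
Proof.
  intros Hq Hh. exists ((1 - q/2)^n).
  eapply bounded_sums_le; [|apply (pfaff_map_pow_coeff_bound q n Hq)].
  intros j. apply weight_le; auto.
Qed.

Lemma one_minus_neq0 (x : C) : Cmod x < 1 -> (1 - x)%C <> 0.
Proof.
  intros Hx E. replace x with (RtoC 1) in Hx.
  - rewrite Cmod_1 in Hx; lra.
  - replace x with (1 - (1 - x))%C by ring. rewrite E; ring.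
Qed.

Lemma inv_one_minus_bounds t : t <= 0 -> 0 < / (1 - t) <= 1.
Proof.
  intros Ht. split; [apply Rinv_0_lt_compat; lra|].
  rewrite <- Rinv_1. apply Rinv_le_contravar; lra.
Qed.

Lemma pfaff_map_has_sum (t : R) h : t <= 0 -> Cmod h <= 1/3 ->
  has_sum (fun j => pfaff_map_coeff (/ (1 - t)) j * h ^ j)%C (pfaff_map (t + h)).
Proof.
  intros Ht Hh. set (q := / (1 - t)).
  assert (Hq : 0 < q <= 1) by (apply inv_one_minus_bounds; auto).
  assert (Hqh : Cmod (q * h) < 1).
  { rewrite Cmod_mult, Cmod_R, Rabs_pos_eq by lra. assert (H0 := Cmod_ge_0 h). nra. }
  assert (Hn := one_minus_neq0 _ Hqh).
  apply has_sum_shift.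
  assert (Hqc : RtoC q <> 0) by (apply RtoC_neq0; lra).
  replace (pfaff_map (t + h) - pfaff_map_coeff q 0 * h ^ 0)%C with (- q * q * h * / (1 - q * h))%C.
  - eapply has_sum_ext; [|apply has_sum_scal, has_sum_geom; exact Hqh].
    intros n. unfold pfaff_map_coeff. rewrite RtoC_opp, <- Cpow_RtoC.
    rewrite Cpow_mult_l. simpl. ring.
  - unfold pfaff_map, pfaff_map_coeff. simpl.
    replace (RtoC t) with (1 - / q)%C.
    2:{ rewrite <- RtoC_inv by lra. unfold q. rewrite Rinv_inv, RtoC_minus. ring. }
    rewrite RtoC_minus. field. repeat split; auto.
    intros E. apply Hn. replace (1 - q * h)%C with (- (q - 1 + h * q - q))%C by ring.
    rewrite E; ring.
Qed.

Lemma pfaff_map_pow_has_sum (t : R) h n : t <= 0 -> Cmod h <= 1/3 ->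
  has_sum (fun j => pfaff_map_pow_coeff (/ (1 - t)) n j * h ^ j)%C (pfaff_map (t + h) ^ n)%C.
Proof.
  intros Ht Hh. set (q := / (1 - t)).
  assert (Hq : 0 < q <= 1) by (apply inv_one_minus_bounds; auto).
  induction n as [|n IH].
  - apply has_sum_shift. simpl. replace (1 - 1 * 1)%C with (RtoC 0) by ring.
    eapply has_sum_ext; [|apply has_sum_0]. intros j; simpl; ring.
  - simpl. eapply has_sum_ext; [|apply has_sum_conv].
    + intros k. apply conv_pow.
    + exists (1 - q / 2). eapply bounded_sums_le; [|apply pfaff_map_coeff_bound; exact Hq].
      intros j. apply weight_le; auto.
    + apply pfaff_map_pow_summable; auto.
    + apply pfaff_map_has_sum; auto.
    + exact IH.
Qed.

(** The value is meaningful where the series converges, that is for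
    [Re u < 1/2]. *)
Definition pfaff_series (e : nat -> C) (u : C) : C :=
  epsilon (inhabits (RtoC 0)) (fun s => has_sum (fun n => e n * pfaff_map u ^ n)%C s).

Lemma pfaff_series_eq e u s :
  has_sum (fun n => e n * pfaff_map u ^ n)%C s -> pfaff_series e u = s.
Proof.
  intros H. unfold pfaff_series.
  eapply has_sum_unique; [|exact H]. apply epsilon_spec. exists s; auto.
Qed.

(** Substituting the Taylor series of the powers of [u/(u-1)] and summing by
    columns gives the Taylor series of [pfaff_series e] at [t <= 0]; the double
    series converges absolutely because the powers have weighted coefficient
    norms at most [(1 - q/2)^n]. *)
Lemma pfaff_series_taylor e (t : R) :
  (forall x, Cmod x < 1 -> abs_summable (fun n => e n * x ^ n)%C) -> t <= 0 ->
  exists b, (forall j, has_sum (fun n => e n * pfaff_map_pow_coeff (/ (1 - t)) n j)%C (b j)) /\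
    forall h, Cmod h <= 1/3 ->
      has_sum (fun j => b j * h ^ j)%C (pfaff_series e (t + h)).
Proof.
  intros He Ht. set (q := / (1 - t)).
  assert (Hq : 0 < q <= 1) by (apply inv_one_minus_bounds; auto).
  assert (SF : forall h, Cmod h <= 1/3 -> abs_summable
      (fun p : nat * nat => e (fst p) * (pfaff_map_pow_coeff q (fst p) (snd p) * h ^ snd p))%C).
  { intros h Hh. destruct (He (RtoC (1 - q/2))) as [M HM].
    { rewrite Cmod_R, Rabs_pos_eq; lra. }
    exists M. apply bounded_sums_rows with (fun n => Cmod (e n * RtoC (1 - q/2) ^ n)); auto.
    intros n. simpl. rewrite Cmod_mult, Cpow_RtoC, Cmod_R, Rabs_pos_eq by (apply pow_le; lra).
    eapply bounded_sums_le; [|apply bounded_sums_scal; [apply Cmod_ge_0|apply (pfaff_map_pow_coeff_bound q n Hq)]].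
    intros j. rewrite Cmod_mult. apply Rmult_le_compat_l; [apply Cmod_ge_0|].
    apply weight_le; auto. }
  assert (Hcol : forall j, abs_summable (fun n => e n * pfaff_map_pow_coeff q n j)%C).
  { intros j.
    assert (H13 : RtoC (1/3) <> 0) by (apply RtoC_neq0; lra).
    assert (H := abs_summable_row _ j (abs_summable_swap _ (SF (RtoC (1/3)) ltac:(rewrite Cmod_R, Rabs_pos_eq; lra)))).
    simpl in H. apply (abs_summable_scal _ (/ (RtoC (1/3) ^ j))%C) in H.
    eapply abs_summable_le; [|exact H]. intros n. apply Req_le. f_equal. field.
    apply Cpow_nz; auto. }
  assert (Hb : exists b : nat -> C, forall j, has_sum (fun n => e n * pfaff_map_pow_coeff q n j)%C (b j)).
  { exists (fun j => epsilon (inhabits (RtoC 0)) (fun s => has_sum (fun n => e n * pfaff_map_pow_coeff q n j)%C s)).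
    intros j. apply epsilon_spec. apply abs_summable_has_sum; auto. }
  destruct Hb as [b Hb]. exists b. split; auto.
  intros h Hh.
  assert (Hrow : forall n, has_sum (fun j => e n * (pfaff_map_pow_coeff q n j * h ^ j))%C
                  (e n * pfaff_map (t + h) ^ n)%C).
  { intros n. apply has_sum_scal. apply pfaff_map_pow_has_sum; auto. }
  destruct (abs_summable_has_sum _ (SF h Hh)) as [s Hs].
  assert (Hsr := has_sum_rows _ _ _ Hs Hrow). simpl in Hsr.
  rewrite (pfaff_series_eq _ _ _ Hsr).
  apply (has_sum_exchange (fun p => e (fst p) * (pfaff_map_pow_coeff q (fst p) (snd p) * h ^ snd p))%C
           (fun n => e n * pfaff_map (t + h) ^ n)%C); auto.
  intros j. simpl. eapply has_sum_ext; [|rewrite Cmult_comm; apply (has_sum_scal (h ^ j)), Hb].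
  intros n; simpl; ring.
Qed.

(** For [y = -u/(1-u)] the relation [(1-u) y^(n+1) = -u y^n] is a recursion of
    Pascal type, which the binomial coefficients satisfy. *)
Lemma pfaff_map_pow_coeff_origin n k :
  pfaff_map_pow_coeff 1 n k =
  if le_dec n k then ((-1) ^ n * binc (INR n) (k - n)%nat)%C else RtoC 0.
Proof.
  revert k. induction n as [|n IH]; intros k.
  - destruct (le_dec 0 k) as [_|]; [|lia]. destruct k as [|k]; simpl.
    + rewrite binc_0; ring.
    + unfold binc. rewrite poch_front. unfold Cdiv. ring.
  - assert (Hm : forall j, pfaff_map_coeff 1 (S j) = -1).
    { intros j. unfold pfaff_map_coeff. rewrite pow1. f_equal; ring. }
    assert (H0 : pfaff_map_pow_coeff 1 (S n) 0 = RtoC 0).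
    { simpl. unfold conv; simpl. replace (1 - 1) with 0 by ring. ring. }
    assert (HS : forall k, pfaff_map_pow_coeff 1 (S n) (S k) =
               (pfaff_map_pow_coeff 1 (S n) k - pfaff_map_pow_coeff 1 n k)%C).
    { clear k. intros k. simpl pfaff_map_pow_coeff. unfold conv.
      rewrite csum_seq_front. rewrite (csum_seq_front _ k).
      assert (Hm0 : pfaff_map_coeff 1 0 = RtoC 0) by (simpl; f_equal; ring).
      rewrite csum_seq_front, Hm, Hm0.
      replace (S k - 1)%nat with k by lia.
      rewrite (csum_ext (fun i => pfaff_map_coeff 1 (S (S i)) * _)%C
        (fun i => pfaff_map_coeff 1 (S i) * pfaff_map_pow_coeff 1 n (k - S i)%nat)%C).
      - ring.
      - intros i _. rewrite !Hm. reflexivity. }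
    induction k as [|k IHk].
    + rewrite H0. destruct (le_dec (S n) 0); [lia|auto].
    + rewrite HS, IHk, IH. destruct (le_dec (S n) (S k)) as [H1|H1].
      * destruct (le_dec n k) as [H2|]; [|lia].
        replace (S k - S n)%nat with (k - n)%nat by lia.
        destruct (le_dec (S n) k) as [H3|H3].
        -- replace (k - n)%nat with (S (k - S n)) by lia. set (m := (k - S n)%nat).
           apply (Cmult_cancel_l (INR (S m))); [apply INR_S_C_neq0|].
           transitivity ((-1) ^ S n * (INR (S m) * binc (INR (S n)) m) - (-1) ^ n * (INR (S m) * binc (INR n) (S m)))%C; [ring|].
           transitivity ((-1) ^ S n * (INR (S m) * binc (INR (S n)) (S m)))%C; [|ring].
           rewrite !binc_S. simpl Cpow.
           assert (Hr : (INR n * binc (INR (S n)) m = (INR n + INR m) * binc (INR n) m)%C).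
           { unfold binc. assert (Hp : (poch (INR n) (S m) = INR n * poch (INR (S n)) m)%C).
             { rewrite poch_front. f_equal. f_equal. rewrite RtoC_INR_S; auto. }
             change (poch (INR n) (S m)) with (poch (INR n) m * (INR n + INR m))%C in Hp.
             unfold Cdiv. rewrite !Cmult_assoc, <- Hp. ring. }
           rewrite <- Hr, !RtoC_INR_S. ring.
        -- replace (k - n)%nat with O by lia. rewrite !binc_0. simpl. ring.
      * destruct (le_dec (S n) k); [lia|]. destruct (le_dec n k); [lia|]. ring.
Qed.

(** Pfaff's formula provides the continuation of the hypergeometric series to
    the half-plane [Re u < 1/2], hence to the whole negative real axis. *)
Lemma is_hyp2F1_pfaff A B c (w y : R) s :
  ~ nonpos_int c -> w <= 0 -> pfaff_map w = y -> 0 <= y < 1 ->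
  has_sum (fun n => conv (hyp2F1_coeff A (c - B) c) (binc (- A)) n * y ^ n)%C s ->
  is_hyp2F1 A B c w s.
Proof.
  intros Hc Hw Hy Hy1 Hs.
  set (e := conv (hyp2F1_coeff A (c - B) c) (binc (- A))) in *.
  assert (He : forall x, Cmod x < 1 -> abs_summable (fun n => e n * x ^ n)%C).
  { intros x Hx. destruct (hyp2F1_coeff_summable A (c - B) c x Hx Hc) as [M HM].
    destruct (binc_summable (- A) x Hx) as [N HN].
    exists (M * N). eapply bounded_sums_le; [|apply (bounded_sums_conv _ _ _ _ HM HN)].
    intros k. apply Req_le. f_equal. symmetry. apply conv_pow. }
  exists (pfaff_series e). split; [|split].
  - destruct (pfaff_series_taylor e 0 He) as [b [Hb Hbs]]; [lra|].
    exists (1/3). split; [lra|]. intros u Hu.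
    replace (hyp2F1_coeff A B c) with b.
    { apply has_sum_is_pseries. specialize (Hbs u (Rlt_le _ _ Hu)).
      rewrite Cplus_0_l in Hbs. exact Hbs. }
    apply functional_extensionality. intros k.
    replace (/ (1 - 0)) with 1 in Hb by field.
    rewrite <- pfaff_coeff by auto. fold e.
    apply (has_sum_unique _ _ _ (Hb k)).
    rewrite (csum_ext _ (fun n => e n * pfaff_map_pow_coeff 1 n k)%C).
    + apply (has_sum_finite (fun n => e n * pfaff_map_pow_coeff 1 n k)%C); [apply seq_NoDup|].
      intros n Hn. rewrite pfaff_map_pow_coeff_origin.
      destruct (le_dec n k); [|ring]. destruct Hn. apply in_seq; lia.
    + intros n Hn. apply in_seq in Hn. rewrite pfaff_map_pow_coeff_origin.
      destruct (le_dec n k); [auto|lia].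
  - intros t Ht.
    destruct (pfaff_series_taylor e (t * w) He) as [b [_ Hbs]]; [nra|].
    exists b, (1/3). split; [lra|]. intros u Hu. apply has_sum_is_pseries.
    specialize (Hbs _ (Rlt_le _ _ Hu)).
    replace (RtoC (t * w) + (u - t * w))%C with u in Hbs by (rewrite RtoC_mult; ring).
    exact Hbs.
  - apply pfaff_series_eq. rewrite Hy. auto.
Qed.

Lemma hyp2F1_pfaff A B c (w y : R) s :
  ~ nonpos_int c -> w <= 0 -> pfaff_map w = y -> 0 <= y < 1 ->
  has_sum (fun n => conv (hyp2F1_coeff A (c - B) c) (binc (- A)) n * y ^ n)%C s ->
  hyp2F1 A B c w = s.
Proof.
  intros Hc Hw Hy Hy1 Hs.
  assert (H := is_hyp2F1_pfaff A B c w y s Hc Hw Hy Hy1 Hs).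
  apply (iota_unique (V := C_CompleteNormedModule)); auto.
  intros v Hv. eapply is_hyp2F1_unique; eauto.
Qed.

(** * The Gamma function *)

Definition cexp (s : C) : C := (exp (Re s) * cos (Im s), exp (Re s) * sin (Im s)).

Lemma cexp_plus a b : cexp (a + b) = (cexp a * cexp b)%C.
Proof.
  unfold cexp, Cmult; simpl. destruct a as [x y], b as [x' y']; simpl.
  rewrite exp_plus, cos_plus, sin_plus. f_equal; ring.
Qed.

Lemma cexp_R (x : R) : cexp x = exp x.
Proof. unfold cexp, RtoC; simpl. rewrite cos_0, sin_0. f_equal; ring. Qed.

Lemma cexp_0 : cexp 0 = 1.
Proof. rewrite cexp_R, exp_0. reflexivity. Qed.

Lemma cexp_neq0 a : cexp a <> 0.
Proof.
  intros E. assert (H : (cexp a * cexp (- a))%C = 1).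
  { rewrite <- cexp_plus, <- cexp_0. f_equal. ring. }
  rewrite E, Cmult_0_l in H. injection H; lra.
Qed.

Lemma RCpower_cexp t s : RCpower t s = cexp (ln t * s).
Proof.
  unfold RCpower, cexp. destruct s as [x y]. simpl.
  replace (ln t * x - 0 * y) with (x * ln t) by ring.
  replace (ln t * y + 0 * x) with (y * ln t) by ring. reflexivity.
Qed.

Lemma Cmod_le_Rabs (z : C) : Cmod z <= Rabs (Re z) + Rabs (Im z).
Proof.
  destruct z as [x y]. simpl.
  replace ((x, y) : C) with (RtoC x + Ci * RtoC y)%C.
  - eapply Rle_trans; [apply Cmod_triangle|].
    rewrite Cmod_mult, Cmod_Ci, !Cmod_R. lra.
  - unfold Ci, RtoC, Cplus, Cmult; simpl. f_equal; ring.
Qed.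

Lemma Rabs_sin_le y : Rabs (sin y) <= Rabs y.
Proof.
  assert (H := bounded_variation sin cos 1 0 y).
  rewrite sin_0, !Rminus_0_r, Rmult_1_l in H. apply H. intros t _. split.
  - apply is_derive_sin.
  - apply Rabs_le, COS_bound.
Qed.

Lemma one_minus_cos_le y : 0 <= 1 - cos y <= y ^ 2 / 2.
Proof.
  replace y with (2 * (y / 2)) at 1 2 by field.
  rewrite cos_2a_sin.
  assert (H := Rabs_sin_le (y / 2)). apply Rsqr_le_abs_1 in H. unfold Rsqr in H.
  nra.
Qed.

Lemma Rabs_sin_minus_le y : Rabs y <= 1 -> Rabs (sin y - y) <= y ^ 2.
Proof.
  intros Hy. assert (H0 := Rabs_pos y).
  assert (H := bounded_variation (fun t => sin t - t) (fun t => cos t - 1) (y ^ 2 / 2) 0 y).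
  cbv beta in H. rewrite sin_0, !Rminus_0_r in H. eapply Rle_trans; [apply H|].
  - intros t Ht. rewrite Rminus_0_r in Ht. split; [auto_derive; auto; ring|].
    assert (Hc := one_minus_cos_le t). rewrite Rabs_left1 by lra.
    assert (Ht2 : Rabs t ^ 2 <= Rabs y ^ 2) by (apply pow_incr; split; [apply Rabs_pos|auto]).
    rewrite !pow2_abs in Ht2. lra.
  - assert (H2 := pow2_ge_0 y). nra.
Qed.

Lemma exp_taylor1 x : Rabs x <= 1/2 -> 0 <= exp x - 1 - x <= 2 * x ^ 2.
Proof.
  intros Hx. apply Rabs_le_between in Hx.
  assert (H1 := exp_ineq1_le x). assert (H2 := exp_ineq1_le (- x)).
  split; [lra|].
  rewrite exp_Ropp in H2. assert (Hp := exp_pos x).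
  assert (H3 : exp x * (1 - x) <= 1).
  { apply Rmult_le_reg_l with (/ exp x); [apply Rinv_0_lt_compat; auto|].
    field_simplify; lra. }
  nra.
Qed.

Lemma cexp_taylor1 z : Cmod z <= 1/2 -> Cmod (cexp z - 1 - z) <= 10 * Cmod z ^ 2.
Proof.
  intros Hz.
  assert (Hx := re_le_Cmod z). assert (Hy := im_le_Cmod z).
  destruct z as [x y]. simpl in Hx, Hy. set (m := Cmod (x, y)) in *.
  assert (Ex := exp_taylor1 x ltac:(lra)).
  assert (Ey := one_minus_cos_le y).
  assert (Es := Rabs_sin_minus_le y ltac:(lra)).
  assert (Ea := Rabs_sin_le y).
  assert (Hx2 : x ^ 2 <= m ^ 2).
  { rewrite <- (pow2_abs x). apply pow_incr. split; [apply Rabs_pos|auto]. }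
  assert (Hy2 : y ^ 2 <= m ^ 2).
  { rewrite <- (pow2_abs y). apply pow_incr. split; [apply Rabs_pos|auto]. }
  assert (Hxb : -(1/2) <= x <= 1/2) by (apply Rabs_le_between; lra).
  assert (Hep : 0 < exp x <= 2) by (split; [apply exp_pos|nra]).
  eapply Rle_trans; [apply Cmod_le_Rabs|]. unfold cexp; simpl.
  replace (exp x * cos y + - (1) + - x) with ((exp x - 1 - x) - exp x * (1 - cos y)) by ring.
  replace (exp x * sin y + - 0 + - y) with ((exp x - 1) * sin y + (sin y - y)) by ring.
  assert (A1 : Rabs ((exp x - 1 - x) - exp x * (1 - cos y)) <= 3 * m ^ 2).
  { apply Rabs_le_between. split; nra. }
  assert (A2 : Rabs ((exp x - 1) * sin y + (sin y - y)) <= 3 * m ^ 2).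
  { eapply Rle_trans; [apply Rabs_triang|]. rewrite Rabs_mult.
    assert (Rabs (exp x - 1) <= 2 * Rabs x).
    { unfold Rabs at 2. destruct (Rcase_abs x); apply Rabs_le_between; nra. }
    assert (0 <= Rabs (exp x - 1)) by apply Rabs_pos.
    assert (0 <= Rabs (sin y)) by apply Rabs_pos.
    assert (Rabs (exp x - 1) * Rabs (sin y) <= (2 * m) * m).
    { apply Rmult_le_compat; lra. }
    nra. }
  change (m * (m * 1)) with (m ^ 2).
  assert (0 <= m ^ 2) by apply pow2_ge_0. lra.
Qed.

Lemma exp_mono x y : x <= y -> exp x <= exp y.
Proof.
  intros [H| ->]; [apply Rlt_le, exp_increasing; auto|lra].
Qed.

(** ** Limits of complex functions *)

Lemma filterlim_C_mult {T} (F : (T -> Prop) -> Prop) {FF : Filter F} (u v : T -> C) (a b : C) :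
  filterlim u F (locally (T := C_UniformSpace) a) ->
  filterlim v F (locally (T := C_UniformSpace) b) ->
  filterlim (fun x => u x * v x)%C F (locally (T := C_UniformSpace) (a * b)%C).
Proof.
  rewrite !filterlim_C_iff by auto. intros Hu Hv eps He.
  assert (Ha := Cmod_ge_0 a). assert (Hb := Cmod_ge_0 b).
  set (K := Cmod a + Cmod b + 1). set (d := eps / (2 * K)).
  assert (HK : 0 < K) by (unfold K; lra).
  assert (Hd : 0 < d) by (apply Rdiv_lt_0_compat; lra).
  assert (Hm : 0 < Rmin 1 d) by (apply Rmin_pos; lra).
  generalize (filter_and _ _ (Hu _ Hm) (Hv d Hd)). apply filter_imp. intros x [H1 H2].
  assert (M1 := Rmin_l 1 d). assert (M2 := Rmin_r 1 d).
  replace (u x * v x - a * b)%C with ((u x - a) * b + u x * (v x - b))%C by ring.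
  eapply Rle_lt_trans; [apply Cmod_triangle|]. rewrite !Cmod_mult.
  assert (Hux : Cmod (u x) <= Cmod a + 1).
  { replace (u x) with ((u x - a) + a)%C by ring.
    eapply Rle_trans; [apply Cmod_triangle|]. lra. }
  assert (H5 := Cmod_ge_0 (u x)).
  assert (E : d * K = eps / 2) by (unfold d; field; lra).
  unfold K in E. nra.
Qed.

Lemma locally_Cmod (c : C) (P : C -> Prop) :
  locally (T := C_UniformSpace) c P <->
  exists d, 0 < d /\ forall y, Cmod (y - c) < d -> P y.
Proof.
  split.
  - intros H. apply (locally_norm_le_locally (V := C_NormedModule)) in H.
    destruct H as [d Hd]. exists d. split; [apply cond_pos|]. intros y Hy. apply Hd. exact Hy.
  - intros [d [Hd H]]. apply (locally_le_locally_norm (V := C_NormedModule)).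
    exists (mkposreal d Hd). intros y Hy. apply H. exact Hy.
Qed.

(** ** Sequences with summable relative increments *)

Definition Clim (u : nat -> C) (l : C) : Prop :=
  filterlim (U := C_UniformSpace) u eventually (locally (T := C_UniformSpace) l).

Lemma Clim_iff u l : Clim u l <->
  forall eps, 0 < eps -> exists N, forall n, (N <= n)%nat -> Cmod (u n - l) < eps.
Proof. apply (filterlim_C_iff eventually). Qed.

Lemma Clim_unique u l l' : Clim u l -> Clim u l' -> l = l'.
Proof. apply (filterlim_locally_unique (F := eventually) (V := C_NormedModule)). Qed.

Lemma Clim_ext_loc u v l N :
  (forall n, (N <= n)%nat -> u n = v n) -> Clim u l -> Clim v l.
Proof.
  intros H Hu. rewrite Clim_iff in *. intros eps He.
  destruct (Hu eps He) as [N' HN]. exists (max N N'). intros n Hn.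
  rewrite <- H by lia. apply HN. lia.
Qed.

Lemma Clim_const a : Clim (fun _ => a) a.
Proof.
  apply Clim_iff. intros eps He. exists O. intros n _.
  replace (a - a)%C with (RtoC 0) by ring. rewrite Cmod_0; auto.
Qed.

(** The increments of [/n] telescope, so that the growth of [u] from [N] on is
    controlled by [exp (D / N)]. *)
Lemma rel_incr_growth (u : nat -> C) D N n :
  0 <= D -> (1 <= N)%nat -> (N <= n)%nat ->
  (forall k, (N <= k)%nat -> Cmod (u (S k) - u k) <= D * (/ INR k - / INR (S k)) * Cmod (u k)) ->
  Cmod (u n - u N) <= Cmod (u N) * (exp (D * (/ INR N - / INR n)) - 1).
Proof.
  intros HD HN Hn H.
  assert (HuN := Cmod_ge_0 (u N)).
  induction Hn as [|n Hn IH].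
  - replace (u N - u N)%C with (RtoC 0) by ring. rewrite Cmod_0.
    rewrite Rminus_diag, Rmult_0_r, exp_0. lra.
  - specialize (H n Hn).
    set (d := D * (/ INR n - / INR (S n))) in *.
    replace (D * (/ INR N - / INR (S n))) with (D * (/ INR N - / INR n) + d)
      by (unfold d; ring).
    rewrite exp_plus. set (E := exp (D * (/ INR N - / INR n))) in *.
    assert (HE : 0 < E) by apply exp_pos.
    assert (Hu : Cmod (u n) <= Cmod (u N) * E).
    { replace (u n) with ((u n - u N) + u N)%C by ring.
      eapply Rle_trans; [apply Cmod_triangle|]. lra. }
    assert (Hd : 0 <= d).
    { unfold d. apply Rmult_le_pos; auto.
      assert (0 < INR n) by (apply lt_0_INR; lia).
      assert (/ INR (S n) <= / INR n); [|lra].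
      apply Rinv_le_contravar; auto. apply le_INR; lia. }
    assert (Hed := exp_ineq1_le d).
    replace (u (S n) - u N)%C with ((u (S n) - u n) + (u n - u N))%C by ring.
    eapply Rle_trans; [apply Cmod_triangle|].
    assert (0 <= Cmod (u N) * E) by (apply Rmult_le_pos; lra).
    nra.
Qed.

Lemma rel_incr_converges (u : nat -> C) D N :
  0 <= D -> (1 <= N)%nat ->
  (forall k, (N <= k)%nat -> Cmod (u (S k) - u k) <= D * (/ INR k - / INR (S k)) * Cmod (u k)) ->
  exists l, Clim u l /\
    forall n, (N <= n)%nat -> Cmod (l - u n) <= Cmod (u n) * (exp (D / INR n) - 1).
Proof.
  intros HD HN H.
  assert (Hg : forall n m, (N <= n)%nat -> (n <= m)%nat ->
     Cmod (u m - u n) <= Cmod (u n) * (exp (D / INR n) - 1)).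
  { intros n m Hn Hm. eapply Rle_trans.
    - apply (rel_incr_growth u D n m); auto; [lia|]. intros; apply H; lia.
    - apply Rmult_le_compat_l; [apply Cmod_ge_0|].
      apply Rplus_le_compat_r. apply exp_mono. unfold Rdiv. apply Rmult_le_compat_l; auto.
      assert (0 < / INR m) by (apply Rinv_0_lt_compat, lt_0_INR; lia). lra. }
  set (K := Cmod (u N) * exp (D / INR N)).
  assert (HK : forall n, (N <= n)%nat -> Cmod (u n) <= K).
  { intros n Hn. replace (u n) with ((u n - u N) + u N)%C by ring.
    eapply Rle_trans; [apply Cmod_triangle|]. specialize (Hg N n (le_n _) Hn).
    unfold K. lra. }
  assert (HL : exists l : C, Clim u l).
  { apply (filterlim_locally_cauchy (U := C_CompleteNormedModule) (F := eventually)).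
    intros [eps He].
    assert (HK0 : 0 <= K) by (apply Rle_trans with (2 := HK N (le_n _)), Cmod_ge_0).
    (* exp x - 1 <= 2 x for the small argument x = D / M *)
    destruct (INR_unbounded (2 * D + 8 * K * D / eps + 1)) as [M0 HM0].
    set (M := max N M0). assert (HM : 2 * D + 8 * K * D / eps + 1 <= INR M).
    { apply Rle_trans with (INR M0); [lra|]. apply le_INR. lia. }
    assert (HKD : 0 <= 8 * K * D / eps) by (apply Rdiv_le_0_compat; nra).
    set (x := D / INR M). assert (Ex : x * INR M = D) by (unfold x; field; lra).
    assert (Hx0 : 0 <= x) by (apply Rdiv_le_0_compat; lra).
    assert (HT := exp_taylor1 x ltac:(rewrite Rabs_pos_eq; nra)).
    assert (Hx2 : 8 * K * x <= eps).
    { apply Rmult_le_reg_r with (INR M / eps); [apply Rdiv_lt_0_compat; lra|].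
      replace (8 * K * x * (INR M / eps)) with (8 * K * (x * INR M) / eps) by (field; lra).
      rewrite Ex. replace (eps * (INR M / eps)) with (INR M) by (field; lra). lra. }
    assert (Hsm : forall n, (M <= n)%nat -> Cmod (u n - u M) < eps / 2).
    { intros n Hn. eapply Rle_lt_trans; [apply Hg; [unfold M; lia|auto]|]. fold x.
      apply Rle_lt_trans with (K * (2 * x)); [|nra].
      apply Rmult_le_compat; [apply Cmod_ge_0|lra|apply HK; unfold M; lia|nra]. }
    exists (fun n => (M <= n)%nat). split; [exists M; auto|].
    intros m n Hm Hn. apply C_NormedModule_mixin_compat1. simpl.
    change (Cmod (u n - u m) < eps).
    replace (u n - u m)%C with ((u n - u M) + - (u m - u M))%C by ring.
    eapply Rle_lt_trans; [apply Cmod_triangle|]. rewrite Cmod_opp.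
    generalize (Hsm m Hm) (Hsm n Hn). lra. }
  destruct HL as [l Hl]. exists l. split; auto.
  intros n Hn. apply Rnot_lt_le; intros Hlt.
  destruct (proj1 (Clim_iff _ _) Hl (Cmod (l - u n) - Cmod (u n) * (exp (D / INR n) - 1))) as [M HM]; [lra|].
  specialize (HM (max n M) ltac:(lia)). specialize (Hg n (max n M) Hn ltac:(lia)).
  generalize (Cmod_sub_le l (u n) (u (max n M))). lra.
Qed.

(** ** Convergence of the Euler-Gauss product *)

Definition gamma_seq (s : C) (n : nat) : C :=
  (INR (fact n) * RCpower (INR n) s / poch s (S n))%C.

Lemma ln_succ_ratio n : (1 <= n)%nat ->
  / INR (S n) <= ln (INR (S n)) - ln (INR n) <= / INR n.
Proof.
  intros Hn. assert (Hp : 0 < INR n) by (apply lt_0_INR; lia).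
  assert (Hp' : 0 < INR (S n)) by (apply lt_0_INR; lia).
  assert (Hln : forall x, 0 < x -> ln x <= x - 1).
  { intros x Hx. assert (H := exp_ineq1_le (ln x)). rewrite exp_ln in H; lra. }
  rewrite <- ln_div by auto. split.
  - assert (H := Hln (INR n / INR (S n)) ltac:(apply Rdiv_lt_0_compat; auto)).
    rewrite ln_div in H |- * by auto. 
    replace (INR n / INR (S n) - 1) with (- / INR (S n)) in H; [lra|].
    rewrite S_INR in *. field. lra.
  - assert (H := Hln (INR (S n) / INR n) ltac:(apply Rdiv_lt_0_compat; auto)).
    replace (INR (S n) / INR n - 1) with (/ INR n) in H; [lra|].
    rewrite S_INR in *. field. lra.
Qed.

Lemma gamma_seq_ratio s n : ~ nonpos_int s -> (1 <= n)%nat ->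
  gamma_seq s (S n) = (gamma_seq s n *
    (cexp ((ln (INR (S n)) - ln (INR n))%R * s) * INR (S n) / (s + INR (S n))))%C.
Proof.
  intros Hs Hn. unfold gamma_seq. rewrite !RCpower_cexp.
  replace (ln (INR (S n)) * s)%C with (ln (INR n) * s + (ln (INR (S n)) - ln (INR n))%R * s)%C
    by (rewrite RtoC_minus; ring).
  rewrite cexp_plus, fact_S_C.
  change (poch s (S (S n))) with (poch s (S n) * (s + INR (S n)))%C.
  assert (H := poch_neq0 s (S (S n)) Hs).
  change (poch s (S (S n))) with (poch s (S n) * (s + INR (S n)))%C in H.
  assert (H1 : poch s (S n) <> 0) by (apply poch_neq0; auto).
  assert (H2 : (s + INR (S n))%C <> 0) by (intros E; apply H; rewrite E; ring).
  field. auto.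
Qed.

Lemma gamma_seq_neq0 s n : ~ nonpos_int s -> gamma_seq s n <> 0.
Proof.
  intros Hs. unfold gamma_seq. rewrite RCpower_cexp.
  apply Cmult_neq_0; [apply Cmult_neq_0; [apply fact_C_neq0|apply cexp_neq0]|].
  intros E. assert (H := poch_neq0 s (S n) Hs).
  assert (H1 : (/ poch s (S n) * poch s (S n))%C = 1) by (apply Cinv_l; auto).
  rewrite E, Cmult_0_l in H1. injection H1; lra.
Qed.

(** Each factor of the product is [1 + O(1/n^2)], with a constant proportional
    to [s]; the bound is expressed by the telescoping majorant
    [1/n - 1/(n+1)]. *)
Lemma gamma_seq_incr s S0 n : ~ nonpos_int s -> (1 <= n)%nat ->
  Cmod s <= S0 -> 2 * S0 <= INR n ->
  Cmod (gamma_seq s (S n) - gamma_seq s n) <=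
    4 * (20 * S0 + 1) * Cmod s * (/ INR n - / INR (S n)) * Cmod (gamma_seq s n).
Proof.
  intros Hs Hn HS HSn.
  rewrite gamma_seq_ratio by auto. set (L := ln (INR (S n)) - ln (INR n)).
  assert (HL := ln_succ_ratio n Hn). fold L in HL.
  assert (Hp : 1 <= INR n) by (apply (le_INR 1); auto).
  set (t := INR n) in *. assert (Et : INR (S n) = t + 1) by apply S_INR.
  rewrite Et in *. assert (Hs0 := Cmod_ge_0 s).
  assert (Hti' : 0 < / (t + 1)) by (apply Rinv_0_lt_compat; lra).
  assert (HLs : Cmod (L * s) <= Cmod s * / t).
  { rewrite Cmod_mult, Cmod_R, Rabs_pos_eq by lra. nra. }
  assert (Hst : Cmod s * / t <= 1/2).
  { apply Rmult_le_reg_r with t; [lra|]. rewrite Rmult_assoc, Rinv_l by lra. lra. }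
  assert (HT := cexp_taylor1 (L * s) ltac:(lra)).
  assert (Hden : t / 2 <= Cmod (s + (t + 1)%R)).
  { assert (t + 1 <= Cmod (s + (t + 1)%R) + Cmod s); [|lra].
    rewrite <- (Rabs_pos_eq (t + 1)) at 1 by lra. rewrite <- Cmod_R, (Cplus_comm s).
    apply Cmod_le_plus. }
  assert (Hdn : (s + (t + 1)%R)%C <> 0).
  { intros E. rewrite E, Cmod_0 in Hden. lra. }
  set (g := gamma_seq s n).
  replace (g * (cexp (L * s) * (t + 1)%R / (s + (t + 1)%R)) - g)%C with
    (g * (((cexp (L * s) - 1 - L * s) * (t + 1)%R + s * (L * (t + 1) - 1)%R) / (s + (t + 1)%R)))%C.
  2:{ rewrite RtoC_minus, RtoC_mult. field. auto. }
  rewrite Cmod_mult, (Rmult_comm (Cmod g)). apply Rmult_le_compat_r; [apply Cmod_ge_0|].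
  rewrite Cmod_div by auto.
  apply Rle_trans with ((10 * (Cmod s * / t) ^ 2 * (t + 1) + Cmod s * / t) / (t / 2)).
  - apply Rmult_le_compat.
    + apply Cmod_ge_0.
    + apply Rlt_le, Rinv_0_lt_compat; lra.
    + eapply Rle_trans; [apply Cmod_triangle|]. rewrite !Cmod_mult, !Cmod_R.
      rewrite (Rabs_pos_eq (t + 1)) by lra.
      apply Rplus_le_compat.
      * apply Rmult_le_compat_r; [lra|]. eapply Rle_trans; [exact HT|].
        apply Rmult_le_compat_l; [lra|]. apply pow_incr. split; [apply Cmod_ge_0|auto].
      * apply Rmult_le_compat_l; auto.
        assert (/ (t + 1) * (t + 1) = 1) by (apply Rinv_l; lra).
        assert (/ t * t = 1) by (apply Rinv_l; lra).
        rewrite Rabs_pos_eq by nra. nra.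
    + apply Rinv_le_contravar; lra.
  - apply Rle_trans with (4 * (20 * Cmod s + 1) * Cmod s * (/ t - / (t + 1))).
    + apply Rmult_le_reg_r with (t * t * (t + 1)); [nra|].
      replace ((10 * (Cmod s * / t) ^ 2 * (t + 1) + Cmod s * / t) / (t / 2) * (t * t * (t + 1)))
        with ((20 * Cmod s ^ 2 * (t + 1) + 2 * Cmod s * t) * (t + 1) / t) by (field; lra).
      replace (4 * (20 * Cmod s + 1) * Cmod s * (/ t - / (t + 1)) * (t * t * (t + 1)))
        with (4 * (20 * Cmod s + 1) * Cmod s * t) by (field; lra).
      apply Rmult_le_reg_r with t; [lra|]. unfold Rdiv. rewrite Rmult_assoc, Rinv_l by lra.
      assert (Hc : (t + 1) ^ 2 <= 4 * t ^ 2) by nra.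
      assert (Hm2 : 0 <= Cmod s ^ 2) by apply pow2_ge_0.
      assert (Cmod s * (t * (t + 1)) <= Cmod s * (2 * t ^ 2)) by (apply Rmult_le_compat_l; nra).
      nra.
    + apply Rmult_le_compat_r.
      { replace (/ t - / (t + 1)) with (/ t * / (t + 1)) by (field; lra). nra. }
      apply Rmult_le_compat_r; auto. lra.
Qed.

(** The limit is nonzero because it differs from a far term of the product by
    less than the modulus of that term. *)
Lemma gamma_seq_converges s : ~ nonpos_int s ->
  exists l, Clim (gamma_seq s) l /\ l <> 0.
Proof.
  intros Hs. assert (Hs0 := Cmod_ge_0 s).
  set (D := 4 * (20 * Cmod s + 1) * Cmod s).
  assert (HD : 0 <= D) by (unfold D; nra).
  destruct (INR_unbounded (2 * Cmod s + 1)) as [N HN].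
  assert (HN1 : (1 <= N)%nat) by (apply INR_le; simpl; lra).
  destruct (rel_incr_converges (gamma_seq s) D N HD HN1) as [l [Hl Hb]].
  { intros k Hk. apply gamma_seq_incr; auto; [lia|lra|].
    apply le_INR in Hk. lra. }
  exists l; split; auto. intros E; subst l.
  destruct (INR_unbounded (2 * D + 1)) as [M HM].
  specialize (Hb (max N M) ltac:(lia)).
  set (m := max N M) in *.
  assert (Hm : 2 * D + 1 <= INR m).
  { apply Rle_trans with (INR M); [lra|]. apply le_INR; lia. }
  assert (Hg : 0 < Cmod (gamma_seq s m)) by (apply Cmod_gt_0, gamma_seq_neq0; auto).
  replace (0 - gamma_seq s m)%C with (- gamma_seq s m)%C in Hb by ring.
  rewrite Cmod_opp in Hb.
  assert (Hd : 0 <= D / INR m < 1/2).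
  { split. apply Rdiv_le_0_compat; lra.
    apply Rmult_lt_reg_r with (INR m); [lra|]. unfold Rdiv. rewrite Rmult_assoc, Rinv_l; lra. }
  assert (HT := exp_taylor1 (D / INR m) ltac:(rewrite Rabs_pos_eq; lra)).
  assert (exp (D / INR m) - 1 < 1) by nra. nra.
Qed.

Lemma CGamma_Clim s l : Clim (gamma_seq s) l -> CGamma s = l.
Proof.
  intros H. apply (iota_unique (V := C_CompleteNormedModule)).
  - intros y Hy. eapply Clim_unique; [exact Hy|exact H].
  - exact H.
Qed.

Lemma CGamma_correct s : ~ nonpos_int s -> Clim (gamma_seq s) (CGamma s).
Proof.
  intros Hs. destruct (gamma_seq_converges s Hs) as [l [Hl _]].
  rewrite (CGamma_Clim s l); auto.
Qed.

Lemma CGamma_neq0 s : ~ nonpos_int s -> CGamma s <> 0.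
Proof.
  intros Hs. destruct (gamma_seq_converges s Hs) as [l [Hl Hn]].
  rewrite (CGamma_Clim s l); auto.
Qed.

Lemma nonpos_int_succ s : nonpos_int (s + 1) -> nonpos_int s.
Proof.
  intros [n E]. exists (S n). rewrite RtoC_INR_S.
  replace s with (s + 1 - 1)%C by ring. rewrite E. ring.
Qed.

Lemma Clim_INR_ratio s : Clim (fun n => INR n / (s + INR (S n)))%C 1.
Proof.
  apply Clim_iff. intros eps He.
  assert (Hs := Cmod_ge_0 (s + 1)).
  destruct (INR_unbounded (Cmod (s + 1) / eps + Cmod (s + 1))) as [N HN].
  exists N. intros n Hn. apply le_INR in Hn.
  assert (Hq : 0 <= Cmod (s + 1) / eps) by (apply Rdiv_le_0_compat; lra).
  assert (Hd : INR n - Cmod (s + 1) <= Cmod (s + INR (S n))).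
  { assert (INR n <= Cmod (s + INR (S n)) + Cmod (s + 1)); [|lra].
    rewrite <- (Rabs_pos_eq (INR n)) at 1 by apply pos_INR. rewrite <- Cmod_R.
    replace (s + INR (S n))%C with (INR n + (s + 1))%C by (rewrite RtoC_INR_S; ring).
    apply Cmod_le_plus. }
  assert (Hd2 : Cmod (s + 1) / eps < Cmod (s + INR (S n))) by lra.
  assert (Hnz : (s + INR (S n))%C <> 0).
  { intros E. rewrite E, Cmod_0 in Hd2. lra. }
  replace (INR n / (s + INR (S n)) - 1)%C with (- (s + 1) / (s + INR (S n)))%C.
  2:{ rewrite RtoC_INR_S in *. field. auto. }
  rewrite Cmod_div, Cmod_opp by auto.
  apply Rmult_lt_reg_r with (Cmod (s + INR (S n))); [lra|].
  unfold Rdiv. rewrite Rmult_assoc, Rinv_l, Rmult_1_r by lra.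
  apply Rmult_lt_compat_l with (r := eps) in Hd2; auto.
  replace (eps * (Cmod (s + 1) / eps)) with (Cmod (s + 1)) in Hd2 by (field; lra). auto.
Qed.

Lemma gamma_seq_succ s n : ~ nonpos_int s -> (1 <= n)%nat ->
  gamma_seq (s + 1) n = (s * gamma_seq s n * (INR n / (s + INR (S n))))%C.
Proof.
  intros Hs Hn. unfold gamma_seq. rewrite !RCpower_cexp.
  assert (Hp : 0 < INR n) by (apply lt_0_INR; lia).
  replace (ln (INR n) * (s + 1))%C with (ln (INR n) * s + ln (INR n))%C by ring.
  rewrite cexp_plus, cexp_R, exp_ln by auto.
  assert (E : (s * poch (s + 1) (S n) = poch s (S n) * (s + INR (S n)))%C).
  { rewrite <- poch_front. reflexivity. }
  assert (H1 : poch s (S n) <> 0) by (apply poch_neq0; auto).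
  assert (H2 : poch (s + 1) (S n) <> 0).
  { apply poch_neq0. intros H; apply Hs, nonpos_int_succ; auto. }
  assert (H3 : (s + INR (S n))%C <> 0).
  { intros E'. apply (poch_neq0 s (S (S n)) Hs).
    change (poch s (S (S n))) with (poch s (S n) * (s + INR (S n)))%C. rewrite E'; ring. }
  apply (Cmult_cancel_l (poch s (S n) * (s + INR (S n)))).
  { apply Cmult_neq_0; auto. }
  transitivity (s * (INR (fact n) * cexp (ln (INR n) * s) * INR n))%C.
  - rewrite <- E. field. auto.
  - field. auto.
Qed.

Lemma CGamma_succ s : ~ nonpos_int s -> CGamma (s + 1) = (s * CGamma s)%C.
Proof.
  intros Hs. apply CGamma_Clim.
  assert (H := filterlim_C_mult _ _ _ _ _ (filterlim_C_mult _ _ _ _ _ (Clim_const s) (CGamma_correct s Hs))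
                 (Clim_INR_ratio s)).
  rewrite Cmult_1_r in H. eapply (Clim_ext_loc _ _ _ 1); [|exact H].
  intros n Hn. symmetry. apply gamma_seq_succ; auto.
Qed.

Lemma nonpos_int_add s n : nonpos_int (s + INR n) -> nonpos_int s.
Proof.
  intros [m E]. exists (n + m)%nat. rewrite plus_INR, RtoC_plus.
  replace s with (s + INR n - INR n)%C by ring. rewrite E. ring.
Qed.

Lemma CGamma_add s n : ~ nonpos_int s -> CGamma (s + INR n) = (poch s n * CGamma s)%C.
Proof.
  intros Hs. induction n as [|n IH].
  - simpl. rewrite Cplus_0_r. ring.
  - rewrite RtoC_INR_S, Cplus_assoc, CGamma_succ, IH.
    + simpl. ring.
    + intros H; apply Hs, (nonpos_int_add s n); auto.
Qed.

Lemma poch_1 n : poch 1 n = INR (fact n).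
Proof.
  induction n as [|n IH]; [reflexivity|].
  rewrite fact_S_C, RtoC_INR_S. simpl poch. rewrite IH. ring.
Qed.

Lemma CGamma_1 : CGamma 1 = 1.
Proof.
  apply CGamma_Clim. eapply (Clim_ext_loc _ _ _ 1); [|apply (Clim_INR_ratio 0)].
  intros n Hn. unfold gamma_seq. rewrite poch_1, RCpower_cexp, fact_S_C.
  rewrite Cmult_1_r, cexp_R, exp_ln by (apply lt_0_INR; lia).
  rewrite Cplus_0_l. field. split; auto using INR_S_C_neq0, fact_C_neq0.
Qed.

Lemma CGamma_nat n : CGamma (INR (S n)) = INR (fact n).
Proof.
  rewrite RtoC_INR_S, Cplus_comm, CGamma_add, CGamma_1, poch_1.
  - ring.
  - apply nonpos_int_1.
Qed.

Lemma not_nonpos_int_small (e : C) : e <> 0 -> Cmod e < 1 -> ~ nonpos_int e.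
Proof.
  intros He H1 [n E]. rewrite E in He, H1. rewrite Cmod_opp, Cmod_R, Rabs_pos_eq in H1 by apply pos_INR.
  destruct n as [|n].
  - apply He. simpl. ring.
  - rewrite S_INR in H1. assert (H := pos_INR n). lra.
Qed.

(** For [Gamma(1 + e) = e Gamma(e)] the product may be compared with its first
    term [1/(1+e)]. *)
Lemma CGamma_near_1 (e : C) : e <> 0 -> Cmod e <= 1/2 ->
  Cmod (CGamma (1 + e) - / (1 + e)) <= 2 * (exp (44 * Cmod e) - 1).
Proof.
  intros He Hs. assert (Hn := not_nonpos_int_small e He ltac:(lra)).
  assert (He0 := Cmod_ge_0 e).
  assert (Hincr : forall k, (1 <= k)%nat -> Cmod (gamma_seq e (S k) - gamma_seq e k) <=
      44 * Cmod e * (/ INR k - / INR (S k)) * Cmod (gamma_seq e k)).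
  { intros k Hk. replace (44 * Cmod e) with (4 * (20 * (1/2) + 1) * Cmod e) by field.
    apply gamma_seq_incr; auto. apply (le_INR 1) in Hk. simpl in Hk. lra. }
  destruct (rel_incr_converges (gamma_seq e) (44 * Cmod e) 1 ltac:(lra) (le_n _) Hincr)
    as [l [Hl Hb]].
  specialize (Hb 1%nat (le_n _)). apply CGamma_Clim in Hl. subst l.
  rewrite Cplus_comm, CGamma_succ by auto.
  assert (H1e : (e + 1)%C <> 0).
  { rewrite Cplus_comm. replace (1 + e)%C with (1 - (- e))%C by ring.
    apply one_minus_neq0. rewrite Cmod_opp; lra. }
  assert (Hg : gamma_seq e 1 = (/ (e * (e + 1)))%C).
  { unfold gamma_seq. rewrite RCpower_cexp. simpl. rewrite ln_1, Cmult_0_l, cexp_0.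
    rewrite Cplus_0_r. field. auto. }
  rewrite Hg in Hb. simpl INR in Hb. rewrite Rdiv_1_r in Hb.
  replace (e * CGamma e - / (e + 1))%C with (e * (CGamma e - / (e * (e + 1))))%C
    by (field; auto).
  rewrite Cmod_mult.
  apply Rmult_le_compat_l with (r := Cmod e) in Hb; auto.
  eapply Rle_trans; [exact Hb|]. rewrite <- Rmult_assoc.
  apply Rmult_le_compat_r.
  { assert (H := exp_ineq1_le (44 * Cmod e)). lra. }
  rewrite <- Cmod_mult. replace (e * / (e * (e + 1)))%C with (/ (e + 1))%C by (field; auto).
  rewrite Cmod_inv by auto.
  replace 2 with (/ (1/2)) by field. apply Rinv_le_contravar; [lra|].
  assert (1 <= Cmod (e + 1) + Cmod e); [|lra].
  rewrite <- Cmod_1 at 1. rewrite (Cplus_comm e). apply Cmod_le_plus.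
Qed.

(** * The regularized hypergeometric function at integral [c] *)

(** ** Dominated convergence *)

Definition cont0 (f : C -> C) : Prop :=
  filterlim f (locally (T := C_UniformSpace) (RtoC 0)) (locally (T := C_UniformSpace) (f 0)).

Lemma cont0_iff (f : C -> C) : cont0 f <->
  forall eps, 0 < eps -> exists dl, 0 < dl /\
    forall e, Cmod e < dl -> Cmod (f e - f 0) < eps.
Proof.
  assert (E : forall e : C, (e - 0)%C = e) by (intros; ring).
  unfold cont0. rewrite (filterlim_C_iff (locally (T := C_UniformSpace) (RtoC 0))).
  split; intros H eps He; specialize (H eps He).
  - destruct (proj1 (locally_Cmod _ _) H) as [d [Hd Hlt]]. exists d. split; auto.
    intros e He'. apply Hlt. rewrite E. auto.
  - apply (proj2 (locally_Cmod _ _)). destruct H as [d [Hd H]]. exists d. split; auto.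
    intros e He'. apply H. rewrite E in He'. auto.
Qed.

Lemma cont0_const a : cont0 (fun _ => a).
Proof. apply filterlim_const. Qed.

Lemma cont0_shift a : cont0 (fun e => a + e)%C.
Proof.
  apply cont0_iff. intros eps He. exists eps. split; auto. intros e H.
  replace (a + e - (a + 0))%C with e by ring. auto.
Qed.

Lemma cont0_mult (f g : C -> C) : cont0 f -> cont0 g -> cont0 (fun e => f e * g e)%C.
Proof. apply (filterlim_C_mult (locally (T := C_UniformSpace) (RtoC 0))). Qed.

Lemma cont0_inv (f : C -> C) : f 0 <> 0 -> cont0 f -> cont0 (fun e => / f e)%C.
Proof.
  rewrite !cont0_iff. intros Hn Hf eps He.
  assert (Hp : 0 < Cmod (f 0)) by (apply Cmod_gt_0; auto).
  set (m := Cmod (f 0)) in *.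
  destruct (Hf (Rmin (m / 2) (eps * m * m / 2))) as [d [Hd H]].
  { apply Rmin_pos; [lra|]. assert (0 < eps * m * m) by (repeat apply Rmult_lt_0_compat; auto). lra. }
  exists d. split; auto. intros e Hlt. specialize (H e Hlt).
  assert (M1 := Rmin_l (m/2) (eps * m * m / 2)). assert (M2 := Rmin_r (m/2) (eps * m * m / 2)).
  assert (Hfe : m / 2 < Cmod (f e)).
  { generalize (Cmod_le_plus (f 0) (f e - f 0)).
    replace (f 0 + (f e - f 0))%C with (f e) by ring. fold m. lra. }
  assert (Hfn : f e <> 0) by (apply Cmod_gt_0; lra).
  replace (/ f e - / f 0)%C with (- (f e - f 0) / (f e * f 0))%C by (field; auto).
  rewrite Cmod_div, Cmod_opp, Cmod_mult by (apply Cmult_neq_0; auto). fold m.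
  apply Rmult_lt_reg_r with (Cmod (f e) * m); [apply Rmult_lt_0_compat; lra|].
  unfold Rdiv. rewrite Rmult_assoc, Rinv_l, Rmult_1_r.
  - apply Rlt_le_trans with (eps * m * m / 2); [lra|].
    replace (eps * m * m / 2) with (eps * m * (m / 2)) by field.
    replace (eps * (Cmod (f e) * m)) with (eps * m * Cmod (f e)) by ring.
    apply Rmult_le_compat_l; [|lra]. apply Rmult_le_pos; lra.
  - apply Rgt_not_eq. apply Rmult_lt_0_compat; lra.
Qed.

Lemma cont0_poch a n : cont0 (fun e => poch (a + e) n).
Proof.
  induction n as [|n IH]; simpl; [apply cont0_const|].
  apply cont0_mult; auto.
  replace (fun e => (a + e + INR n)%C) with (fun e => ((a + INR n) + e)%C).
  - apply cont0_shift.
  - apply functional_extensionality; intros; ring.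
Qed.

Lemma dominated_convergence {T} (t : C -> T -> C) (S : C -> C) (g : T -> R) M r :
  0 < r -> bounded_sums g M ->
  (forall e n, Cmod e <= r -> Cmod (t e n) <= g n) ->
  (forall n, cont0 (fun e => t e n)) ->
  (forall e, Cmod e <= r -> has_sum (t e) (S e)) ->
  cont0 S.
Proof.
  intros Hr HM Hb Hc HS. apply cont0_iff. intros eps He.
  assert (Hg : forall n, 0 <= g n).
  { intros n. eapply Rle_trans; [apply Cmod_ge_0|apply (Hb 0)]. rewrite Cmod_0; lra. }
  destruct (has_sum_nonneg g M Hg HM) as [G HG].
  assert (HGb := has_sum_RtoC_nonneg_bound g G Hg HG).
  destruct (HG (eps / 8)) as [l1 Hl1]; [lra|].
  set (l0 := dedup l1).
  assert (Htail : G - eps / 8 < rsum g l0).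
  { specialize (Hl1 l0 (dedup_NoDup _)).
    assert (Hi : incl l1 l0) by (intros x Hx; apply dedup_In; auto).
    specialize (Hl1 Hi). rewrite csum_RtoC, <- RtoC_minus, Cmod_R in Hl1.
    apply Rabs_def2 in Hl1. lra. }
  set (eta := eps / 4 / (INR (length l0) + 1)).
  assert (Hlen := pos_INR (length l0)).
  assert (Heta : 0 < eta) by (apply Rdiv_lt_0_compat; lra).
  assert (Hd : exists d, 0 < d /\ forall e n, Cmod e < d -> In n l0 -> Cmod (t e n - t 0 n) < eta).
  { clear Htail Hlen. clearbody l0 eta. induction l0 as [|n l IH].
    - exists 1. split; [lra|]. intros e n _ [].
    - destruct IH as [d [Hd H]]. destruct (proj1 (cont0_iff _) (Hc n) eta Heta) as [d' [Hd' H']].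
      exists (Rmin d d'). split; [apply Rmin_pos; auto|]. intros e k Hlt [<-|Hk].
      + apply H'. eapply Rlt_le_trans; [exact Hlt|apply Rmin_r].
      + apply H; auto. eapply Rlt_le_trans; [exact Hlt|apply Rmin_l]. }
  destruct Hd as [d [Hd Hdl]].
  exists (Rmin d r). split; [apply Rmin_pos; auto|]. intros e Hlt.
  assert (H1 := Rlt_le_trans _ _ _ Hlt (Rmin_l d r)).
  assert (H2 := Rlt_le_trans _ _ _ Hlt (Rmin_r d r)).
  assert (Hsum : has_sum (fun n => t e n - t 0 n)%C (S e - S 0)%C).
  { replace (S e - S 0)%C with (S e + -1 * S 0)%C by ring.
    eapply has_sum_ext; [|apply has_sum_plus; [apply HS; lra|apply has_sum_scal, HS]].
    - intros n; simpl; ring.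
    - rewrite Cmod_0; lra. }
  apply Rle_lt_trans with (eps / 4 + eps / 4); [|lra].
  apply (has_sum_bound (fun n => t e n - t 0 n)%C); auto.
  intros l Hl.
  (* inside l0 the terms are small by pointwise convergence, outside by
     domination *)
  set (p := fun n => if in_dec (classical_eq_dec T) n l0 then true else false).
  assert (Hp : forall n, p n = true <-> In n l0).
  { intros n. unfold p. destruct (in_dec _ n l0); split; auto; easy. }
  rewrite (rsum_filter p). apply Rplus_le_compat.
  - set (u := filter p l).
    assert (Hu : NoDup u) by (apply NoDup_filter; auto).
    assert (Hul : incl u l0) by (intros n Hn; apply filter_In in Hn; apply Hp; tauto).
    apply Rle_trans with (rsum (fun _ => eta) l0).
    + apply Rle_trans with (rsum (fun _ => eta) u).
      * apply rsum_le. intros n Hn. apply Rlt_le, Hdl; auto.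
      * apply rsum_incl; auto. intros; lra. apply dedup_NoDup.
    + assert (E : forall l, rsum (fun _ : T => eta) l = INR (length l) * eta).
      { clear. induction l as [|a l IH]; [simpl; ring|]. simpl length. rewrite S_INR. simpl. rewrite IH; ring. }
      rewrite E. unfold eta. apply Rmult_le_reg_r with (INR (length l0) + 1); [lra|].
      field_simplify; [|lra]. nra.
  - set (v := filter _ l).
    assert (Hv : NoDup v) by (apply NoDup_filter; auto).
    assert (Hvl : forall n, In n l0 -> ~ In n v).
    { intros n Hn Hn'. apply filter_In in Hn'. apply Hp in Hn. rewrite Hn in Hn'. easy. }
    apply Rle_trans with (rsum (fun n => 2 * g n) v).
    + apply rsum_le. intros n _. unfold Cminus. eapply Rle_trans; [apply Cmod_triangle|].
      rewrite Cmod_opp. assert (A1 := Hb e n ltac:(lra)).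
      assert (A2 := Hb 0 n ltac:(rewrite Cmod_0; lra)). lra.
    + rewrite rsum_scal.
      assert (Hn : NoDup (l0 ++ v)).
      { apply NoDup_app; auto. apply dedup_NoDup. }
      specialize (HGb _ Hn). rewrite rsum_app in HGb. lra.
Qed.

(** ** Limits in a punctured neighbourhood *)

Lemma filterlim_punctured (f : C -> C) (c l : C) :
  filterlim (T := C_UniformSpace) (U := C_UniformSpace) f
     (locally' (T := C_UniformSpace) c) (locally (T := C_UniformSpace) l) <->
  forall eps, 0 < eps -> exists d, 0 < d /\
    forall e : C, e <> 0 -> Cmod e < d -> Cmod (f (c + e)%C - l) < eps.
Proof.
  rewrite (filterlim_C_iff (locally' (T := C_UniformSpace) c)).
  split; intros H eps He; specialize (H eps He).
  - apply locally_Cmod in H. destruct H as [d [Hd H]]. exists d. split; auto.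
    intros e Hn Hlt. apply H.
    + replace (c + e - c)%C with e by ring. auto.
    + intros E. apply Hn. transitivity (c + e - c)%C; [ring|]. rewrite E; ring.
  - destruct H as [d [Hd H]]. apply locally_Cmod. exists d. split; auto.
    intros y Hy Hn. assert (Ey : (c + (y - c))%C = y) by ring.
    rewrite <- Ey. apply H; auto.
    intros E. apply Hn. rewrite <- Ey, E. apply Cplus_0_r.
Qed.

Lemma filterlim_punctured_unique (f : C -> C) (c l l' : C) :
  filterlim (T := C_UniformSpace) (U := C_UniformSpace) f
     (locally' (T := C_UniformSpace) c) (locally (T := C_UniformSpace) l) ->
  filterlim (T := C_UniformSpace) (U := C_UniformSpace) f
     (locally' (T := C_UniformSpace) c) (locally (T := C_UniformSpace) l') -> l = l'.
Proof.
  rewrite !filterlim_punctured. intros H H'. apply Ceq_of_close. intros eps He.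
  destruct (H eps He) as [d [Hd H1]]. destruct (H' eps He) as [d' [Hd' H1']].
  set (e := Rmin d d' / 2).
  assert (Hm : 0 < Rmin d d') by (apply Rmin_pos; auto).
  assert (M1 := Rmin_l d d'). assert (M2 := Rmin_r d d').
  assert (Hen : RtoC e <> 0) by (apply RtoC_neq0; unfold e; lra).
  assert (Hem : Cmod e = e) by (rewrite Cmod_R, Rabs_pos_eq; unfold e; lra).
  exists (f (c + e)%C). split; [apply H1|apply H1']; auto; rewrite Hem; unfold e; lra.
Qed.

(** ** The value of [hyp2F1_div_Gamma] *)

Definition inv_Gamma_Z (m : Z) : C :=
  if Z_le_dec m 0 then RtoC 0 else (/ INR (fact (Z.to_nat (m - 1))))%C.

Definition reg_coeff (A D : C) (c : Z) (n : nat) : C :=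
  (poch A n * poch D n / INR (fact n) * inv_Gamma_Z (c + Z.of_nat n))%C.

Lemma hyp2F1_value A B c (xi : R) h s :
  0 < xi < 1 -> ~ nonpos_int c ->
  has_sum (fun n => binc (- A) n * xi ^ n)%C h ->
  has_sum (fun n => hyp2F1_coeff A (c - B) c n * xi ^ n)%C s ->
  hyp2F1 A B c (RtoC (xi / (xi - 1))) = (h * s)%C.
Proof.
  intros Hx Hc Hh Hs.
  assert (Hxm : Cmod xi < 1) by (rewrite Cmod_R, Rabs_pos_eq; lra).
  apply (hyp2F1_pfaff A B c _ xi); auto.
  - assert (0 < xi / (1 - xi)) by (apply Rdiv_lt_0_compat; lra).
    replace (xi / (xi - 1)) with (- (xi / (1 - xi))) by (field; lra). lra.
  - unfold pfaff_map. rewrite <- RtoC_minus, <- RtoC_div.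
    + f_equal. field. lra.
    + replace (xi / (xi - 1) - 1) with (/ (xi - 1)) by (field; lra).
      apply Rinv_neq_0_compat. lra.
  - lra.
  - rewrite Cmult_comm. eapply has_sum_ext; [|apply has_sum_conv; [| |exact Hs|exact Hh]].
    + intros k. apply conv_pow.
    + apply hyp2F1_coeff_summable; auto.
    + apply binc_summable; auto.
Qed.

Lemma nonpos_int_IZR c : nonpos_int (RtoC (IZR c)) <-> (c <= 0)%Z.
Proof.
  split.
  - intros [n E]. rewrite <- RtoC_opp in E. injection E. intros H.
    apply le_IZR. rewrite H. assert (Hn := pos_INR n). lra.
  - intros H. exists (Z.to_nat (- c)). rewrite INR_IZR_INZ, Z2Nat.id by lia.
    rewrite <- RtoC_opp, <- opp_IZR. do 2 f_equal. lia.
Qed.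

Lemma Cmod_poch_le a x n : Cmod a <= x -> Cmod (poch a n) <= Cmod (poch (RtoC x) n).
Proof.
  intros H. assert (H0 := Cmod_ge_0 a). induction n as [|n IH]; simpl; [lra|].
  rewrite !Cmod_mult. apply Rmult_le_compat; auto using Cmod_ge_0.
  eapply Rle_trans; [apply Cmod_triangle|]. rewrite <- RtoC_plus, !Cmod_R.
  assert (Hn := pos_INR n). rewrite !Rabs_pos_eq; lra.
Qed.

Lemma Cmod_poch_ge (e : C) n : Cmod e <= 1/2 -> Cmod (poch (RtoC (1/2)) n) <= Cmod (poch (1 + e) n).
Proof.
  intros H. induction n as [|n IH]; simpl; [lra|].
  rewrite !Cmod_mult. apply Rmult_le_compat; auto using Cmod_ge_0.
  rewrite <- RtoC_plus, Cmod_R. assert (Hn := pos_INR n). rewrite Rabs_pos_eq by lra.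
  assert (1 + INR n <= Cmod (1 + e + INR n) + Cmod e); [|lra].
  rewrite <- (Rabs_pos_eq (1 + INR n)) at 1 by lra. rewrite <- Cmod_R.
  replace (1 + e + INR n)%C with (RtoC (1 + INR n) + e)%C by (rewrite RtoC_plus; ring).
  apply Cmod_le_plus.
Qed.

Lemma Cmod_poch_mul_le x n m : 0 <= x ->
  Cmod (poch (RtoC x) n) * Cmod (poch (RtoC x) m) <= Cmod (poch (RtoC x) (n + m)).
Proof.
  intros Hx. rewrite poch_add, Cmod_mult. apply Rmult_le_compat_l; [apply Cmod_ge_0|].
  rewrite <- RtoC_plus. apply Cmod_poch_le. rewrite Cmod_R, Rabs_pos_eq by auto.
  assert (Hn := pos_INR n). lra.
Qed.

(** [(c)_{m+1}/(c)_n] at [c = -m + e]: written without the common factors, it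
    makes sense at [e = 0] too. *)
Definition poch_quot (m n : nat) (e : C) : C :=
  if le_dec n m then poch (- INR m + INR n + e) (S m - n) else (/ poch (1 + e) (n - S m))%C.

Lemma not_nonpos_int_near m (e : C) : e <> 0 -> Cmod e < 1 -> ~ nonpos_int (- INR m + e).
Proof.
  intros He H1 [k E].
  assert (Ee : e = RtoC (IZR (Z.of_nat m - Z.of_nat k))).
  { rewrite minus_IZR, RtoC_minus, <- !INR_IZR_INZ.
    replace e with (INR m + (- INR m + e))%C by ring. rewrite E. ring. }
  rewrite Ee, Cmod_R, <- abs_IZR in H1. apply (lt_IZR _ 1) in H1.
  apply He. rewrite Ee. replace (Z.of_nat m - Z.of_nat k)%Z with 0%Z by lia. reflexivity.
Qed.

Lemma not_nonpos_int_1_plus (e : C) : Cmod e < 1 -> ~ nonpos_int (1 + e).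
Proof.
  intros H [k E].
  assert (Ee : e = RtoC (- INR (S k))).
  { replace e with ((1 + e) - 1)%C by ring. rewrite E, RtoC_opp, RtoC_INR_S. ring. }
  rewrite Ee, Cmod_R, Rabs_Ropp, Rabs_pos_eq, S_INR in H by apply pos_INR.
  assert (Hk := pos_INR k). lra.
Qed.

Lemma poch_quot_eq m n (e : C) : e <> 0 -> Cmod e < 1 ->
  poch_quot m n e = (poch (- INR m + e) (S m) / poch (- INR m + e) n)%C.
Proof.
  intros He H1. assert (Hn := not_nonpos_int_near m e He H1).
  unfold poch_quot. destruct (le_dec n m) as [H|H].
  - replace (S m) with (n + (S m - n))%nat at 2 by lia.
    rewrite poch_add.
    replace (- INR m + e + INR n)%C with (- INR m + INR n + e)%C by ring.
    field. apply poch_neq0; auto.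
  - replace (poch (- INR m + e) n) with (poch (- INR m + e) (S m) * poch (1 + e) (n - S m))%C.
    + field. split; apply poch_neq0; auto. apply not_nonpos_int_1_plus; auto.
    + replace n with (S m + (n - S m))%nat at 2 by lia. rewrite poch_add. do 2 f_equal.
      rewrite RtoC_INR_S. ring.
Qed.

Lemma poch_quot_0 m n : poch_quot m n 0 = inv_Gamma_Z (- Z.of_nat m + Z.of_nat n).
Proof.
  unfold poch_quot, inv_Gamma_Z.
  destruct (le_dec n m) as [H|H]; destruct (Z_le_dec _ _) as [H'|H']; try lia.
  - replace (S m - n)%nat with (S (m - n)) by lia. simpl.
    rewrite minus_INR, RtoC_minus by lia. ring.
  - rewrite Cplus_0_r, poch_1. do 3 f_equal. f_equal. lia.
Qed.

Lemma poch_quot_cont m n : cont0 (poch_quot m n).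
Proof.
  unfold poch_quot. destruct (le_dec n m).
  - apply cont0_poch.
  - apply cont0_inv; [|apply cont0_poch].
    apply poch_neq0. rewrite Cplus_0_r. apply nonpos_int_1.
Qed.

(** In the disc [|e| <= 1/2] the factors of [(1 + e)_k] are smallest at
    [e = -1/2], that is at [c = 1/2 - (m+1)]. *)
Lemma poch_quot_bound m n (e : C) : Cmod e <= 1/2 ->
  Cmod (poch_quot m n e) * Cmod (poch (RtoC (1/2 - INR (S m))) n) <=
  Cmod (poch (RtoC (INR (S m))) (S m)).
Proof.
  intros He. assert (Hm := pos_INR m).
  assert (Hc0 : Cmod (RtoC (1/2 - INR (S m))) <= INR (S m)).
  { rewrite Cmod_R, Rabs_left, S_INR; rewrite ?S_INR; lra. }
  unfold poch_quot. destruct (le_dec n m) as [H|H].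
  - apply Rle_trans with (Cmod (poch (RtoC (INR (S m))) (S m - n)) * Cmod (poch (RtoC (INR (S m))) n)).
    + apply Rmult_le_compat; auto using Cmod_ge_0.
      * apply Cmod_poch_le. eapply Rle_trans; [apply Cmod_triangle|].
        rewrite <- RtoC_opp, <- RtoC_plus, Cmod_R.
        assert (INR n <= INR m) by (apply le_INR; auto). assert (Hn := pos_INR n).
        rewrite Rabs_left1, S_INR by lra. lra.
      * apply Cmod_poch_le; auto.
    + eapply Rle_trans; [apply Cmod_poch_mul_le; apply pos_INR|].
      replace (S m - n + n)%nat with (S m) by lia. lra.
  - replace n with (S m + (n - S m))%nat at 2 by lia. rewrite poch_add, Cmod_mult.
    assert (Hge := Cmod_poch_ge e (n - S m) He).
    assert (Hpos : 0 < Cmod (poch (RtoC (1/2)) (n - S m))).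
    { apply Cmod_gt_0, poch_neq0. apply not_nonpos_int_small.
      - apply RtoC_neq0; lra.
      - rewrite Cmod_R, Rabs_pos_eq; lra. }
    rewrite Cmod_inv by (apply Cmod_gt_0; lra).
    replace (RtoC (1/2 - INR (S m)) + INR (S m))%C with (RtoC (1/2)) by (rewrite RtoC_minus; ring).
    set (u := Cmod (poch (RtoC (1/2)) _)) in *. set (v := Cmod (poch (1 + e) _)) in *.
    assert (Hp := Cmod_poch_le _ _ (S m) Hc0).
    set (p := Cmod (poch (RtoC (1/2 - INR (S m))) _)) in *.
    assert (Hp0 : 0 <= p) by apply Cmod_ge_0.
    apply Rle_trans with p; auto.
    apply Rmult_le_reg_l with v; [lra|]. rewrite <- Rmult_assoc, Rinv_r, Rmult_1_l by lra. nra.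
Qed.

(** Terms of [(c)_{m+1} F(A, c - B; c; xi)] at [c = -m + e]. *)
Definition near_pole_term (A B : C) (xi : R) (m : nat) (e : C) (n : nat) : C :=
  (poch A n * poch ((- INR m - B) + e) n / INR (fact n) * poch_quot m n e * xi ^ n)%C.

Lemma near_pole_majorant A B xi m : 0 < xi < 1 ->
  exists g M, bounded_sums g M /\ forall e n, Cmod e <= 1/2 ->
    Cmod (near_pole_term A B xi m e n) <= g n.
Proof.
  intros Hx. set (K := Cmod (- INR m - B) + 1/2).
  set (c0 := 1/2 - INR (S m)). set (Q := Cmod (poch (RtoC (INR (S m))) (S m))).
  assert (Hxm : Cmod xi < 1) by (rewrite Cmod_R, Rabs_pos_eq; lra).
  assert (Hc0 : ~ nonpos_int c0).
  { unfold c0. replace (RtoC (1/2 - INR (S m))) with (- INR m + RtoC (-(1/2)))%C.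
    - apply not_nonpos_int_near; [apply RtoC_neq0; lra|].
      rewrite Cmod_R, Rabs_left; lra.
    - rewrite <- RtoC_opp, <- RtoC_plus, S_INR. f_equal; lra. }
  destruct (hyp2F1_coeff_summable (RtoC (Cmod A)) K c0 xi Hxm Hc0) as [M HM].
  exists (fun n => Q * Cmod (hyp2F1_coeff (RtoC (Cmod A)) K c0 n * xi ^ n)), (Q * M).
  split; [apply bounded_sums_scal; auto; apply Cmod_ge_0|].
  intros e n He. unfold near_pole_term, hyp2F1_coeff.
  assert (Hpn : poch c0 n <> 0) by (apply poch_neq0; auto).
  rewrite !Cmod_mult, !Cmod_div, !Cmod_mult by (auto using fact_C_neq0, Cmult_neq_0).
  assert (Hf : 0 < Cmod (INR (fact n))) by (apply Cmod_gt_0, fact_C_neq0).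
  assert (Hp : 0 < Cmod (poch c0 n)) by (apply Cmod_gt_0; auto).
  rewrite <- Rmult_assoc. apply Rmult_le_compat_r; [apply Cmod_ge_0|].
  assert (HA : Cmod (poch A n) <= Cmod (poch (RtoC (Cmod A)) n)) by (apply Cmod_poch_le; lra).
  assert (HB : Cmod (poch (- INR m - B + e) n) <= Cmod (poch K n)).
  { apply Cmod_poch_le. unfold K. eapply Rle_trans; [apply Cmod_triangle|]. lra. }
  assert (HQ := poch_quot_bound m n e He). fold c0 Q in HQ.
  set (a := Cmod (poch A n)) in *. set (a' := Cmod (poch (RtoC (Cmod A)) n)) in *.
  set (b := Cmod (poch (- INR m - B + e) n)) in *. set (b' := Cmod (poch K n)) in *.
  set (q := Cmod (poch_quot m n e)) in *. set (p := Cmod (poch c0 n)) in *.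
  set (f := Cmod (INR (fact n))) in *.
  assert (Ha : 0 <= a) by apply Cmod_ge_0. assert (Hb : 0 <= b) by apply Cmod_ge_0.
  assert (Hq : 0 <= q) by apply Cmod_ge_0.
  replace (a * b / f * q) with ((a * b) * (q * p) * / (p * f)) by (field; lra).
  replace (Q * (a' * b' / (p * f))) with ((a' * b') * Q * / (p * f)) by (unfold Rdiv; ring).
  apply Rmult_le_compat_r.
  - apply Rlt_le, Rinv_0_lt_compat, Rmult_lt_0_compat; auto.
  - apply Rmult_le_compat; auto; apply Rmult_le_pos || apply Rmult_le_compat; auto; lra.
Qed.

Lemma near_pole_term_summable A B xi m e : 0 < xi < 1 -> Cmod e <= 1/2 ->
  abs_summable (near_pole_term A B xi m e).
Proof.
  intros Hx He. destruct (near_pole_majorant A B xi m Hx) as [g [M [HM Hg]]].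
  exists M. eapply bounded_sums_le; [|exact HM]. intros n; apply Hg; auto.
Qed.

Lemma near_pole_term_0 A B xi m n :
  near_pole_term A B xi m 0 n =
  (reg_coeff A (IZR (- Z.of_nat m) - B) (- Z.of_nat m) n * xi ^ n)%C.
Proof.
  unfold near_pole_term, reg_coeff. rewrite poch_quot_0, Cplus_0_r, opp_IZR, RtoC_opp.
  rewrite <- INR_IZR_INZ. reflexivity.
Qed.

Lemma reg_coeff_pos A D k n :
  reg_coeff A D (Z.of_nat (S k)) n = (/ INR (fact k) * hyp2F1_coeff A D (INR (S k)) n)%C.
Proof.
  assert (Hk : ~ nonpos_int (INR (S k))).
  { rewrite INR_IZR_INZ, nonpos_int_IZR. lia. }
  unfold reg_coeff, hyp2F1_coeff, inv_Gamma_Z.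
  destruct (Z_le_dec _ _) as [H|H]; [lia|].
  replace (Z.to_nat (Z.of_nat (S k) + Z.of_nat n - 1)) with (k + n)%nat by lia.
  assert (E : RtoC (INR (fact (k + n))) = (poch (INR (S k)) n * INR (fact k))%C).
  { rewrite <- !CGamma_nat, <- CGamma_add by auto. f_equal.
    rewrite <- RtoC_plus, <- plus_INR. reflexivity. }
  rewrite E. assert (Hp : poch (INR (S k)) n <> 0) by (apply poch_neq0; auto).
  field. repeat split; auto using fact_C_neq0.
Qed.

Lemma reg_coeff_summable A D c (xi : R) : 0 < xi < 1 ->
  abs_summable (fun n => reg_coeff A D c n * xi ^ n)%C.
Proof.
  intros Hx. assert (Hxm : Cmod xi < 1) by (rewrite Cmod_R, Rabs_pos_eq; lra).
  destruct (Z_le_dec c 0) as [H|H].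
  - replace c with (- Z.of_nat (Z.to_nat (- c)))%Z by lia. set (m := Z.to_nat (- c)).
    eapply abs_summable_le; [|apply (near_pole_term_summable A (IZR (- Z.of_nat m) - D) xi m 0 Hx)].
    + intros n. rewrite near_pole_term_0. apply Req_le. do 3 f_equal. ring.
    + rewrite Cmod_0; lra.
  - replace c with (Z.of_nat (S (Z.to_nat (c - 1)))) by lia. set (k := Z.to_nat (c - 1)).
    eapply abs_summable_le; [|apply abs_summable_scal, (hyp2F1_coeff_summable A D (INR (S k)) xi)].
    + intros n. rewrite reg_coeff_pos. rewrite Cmult_assoc. apply Rle_refl.
    + auto.
    + rewrite INR_IZR_INZ, nonpos_int_IZR. lia.
Qed.

(** At a pole [c = -m] the quotient is [h T(e)/Gamma(1 + e)] with [T] the sum of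
    the series [near_pole_term], which is continuous at [e = 0]. *)
Lemma hyp2F1_div_Gamma_value A B c (xi : R) h s :
  0 < xi < 1 ->
  has_sum (fun n => binc (- A) n * xi ^ n)%C h ->
  has_sum (fun n => reg_coeff A (IZR c - B) c n * xi ^ n)%C s ->
  hyp2F1_div_Gamma A B (IZR c) (RtoC (xi / (xi - 1))) = (h * s)%C.
Proof.
  intros Hx Hh Hs. unfold hyp2F1_div_Gamma.
  destruct (ClassicalDescription.excluded_middle_informative (nonpos_int (IZR c))) as [Hc|Hc].
  - rewrite nonpos_int_IZR in Hc.
    replace c with (- Z.of_nat (Z.to_nat (- c)))%Z in * by lia.
    set (m := Z.to_nat (- c)) in *. clearbody m. clear c Hc.
    assert (HT : exists T : C -> C, forall e, Cmod e <= 1/2 -> has_sum (near_pole_term A B xi m e) (T e)).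
    { exists (fun e => epsilon (inhabits (RtoC 0)) (fun s => has_sum (near_pole_term A B xi m e) s)).
      intros e He. apply epsilon_spec, abs_summable_has_sum, near_pole_term_summable; auto. }
    destruct HT as [T HT].
    assert (HT0 : T 0 = s).
    { eapply has_sum_unique; [apply HT; rewrite Cmod_0; lra|].
      eapply has_sum_ext; [|exact Hs]. intros n. rewrite near_pole_term_0. reflexivity. }
    assert (HTc : cont0 T).
    { destruct (near_pole_majorant A B xi m Hx) as [g [M [HM Hg]]].
      apply (dominated_convergence (near_pole_term A B xi m) T g M (1/2)); auto; [lra|].
      intros n. unfold near_pole_term.
      apply cont0_mult; [|apply cont0_const]. apply cont0_mult; [|apply poch_quot_cont].
      apply cont0_mult; [|apply cont0_const].
      apply cont0_mult; [apply cont0_const|apply cont0_poch]. }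
    assert (HG : cont0 (fun e => CGamma (1 + e))).
    { apply cont0_iff. intros eps He.
      assert (Hinv : cont0 (fun e => / (1 + e))%C).
      { apply (cont0_inv (fun e => 1 + e)%C); [|apply cont0_shift].
        rewrite Cplus_0_r. apply RtoC_neq0; lra. }
      destruct (proj1 (cont0_iff _) Hinv (eps / 2)) as [d [Hd H]]; [lra|].
      set (d' := Rmin (1/88) (eps / 400)).
      assert (M1 := Rmin_l (1/88) (eps / 400)). assert (M2 := Rmin_r (1/88) (eps / 400)).
      assert (Hd' : 0 < d') by (apply Rmin_pos; lra).
      exists (Rmin d d'). split; [apply Rmin_pos; auto|]. intros e Hlt.
      specialize (H e (Rlt_le_trans _ _ _ Hlt (Rmin_l _ _))).
      assert (Hlt' := Rlt_le_trans _ _ _ Hlt (Rmin_r d d')).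
      fold d' in M1, M2.
      rewrite Cplus_0_r in H |- *. rewrite CGamma_1.
      destruct (classic (e = 0)) as [->|Hne].
      { rewrite Cplus_0_r, CGamma_1. replace (1 - 1)%C with (RtoC 0) by ring. rewrite Cmod_0; auto. }
      assert (Hnear := CGamma_near_1 e Hne ltac:(lra)).
      assert (He0 := Cmod_ge_0 e).
      assert (HTay := exp_taylor1 (44 * Cmod e) ltac:(rewrite Rabs_pos_eq; lra)).
      assert (exp (44 * Cmod e) - 1 <= 88 * Cmod e) by nra.
      replace (CGamma (1 + e) - 1)%C with ((CGamma (1 + e) - / (1 + e)) + (/ (1 + e) - / 1))%C by (field; intros E; rewrite E in *; apply (not_nonpos_int_1_plus e); [lra|exists O; rewrite E; simpl; ring]).
      eapply Rle_lt_trans; [apply Cmod_triangle|]. lra. }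
    assert (HQ : cont0 (fun e => h * T e * / CGamma (1 + e))%C).
    { apply cont0_mult; [apply cont0_mult; [apply cont0_const|auto]|].
      apply (cont0_inv (fun e => CGamma (1 + e))); auto.
      rewrite Cplus_0_r, CGamma_1. apply RtoC_neq0; lra. }
    assert (HL : filterlim (T := C_UniformSpace) (U := C_UniformSpace)
       (fun c' => hyp2F1 A B c' (RtoC (xi / (xi - 1))) / CGamma c')%C
       (locally' (T := C_UniformSpace) (RtoC (IZR (- Z.of_nat m))))
       (locally (T := C_UniformSpace) (h * s)%C)).
    { apply filterlim_punctured. intros eps He.
      destruct (proj1 (cont0_iff _) HQ eps He) as [d [Hd H]].
      exists (Rmin d (1/2)). split; [apply Rmin_pos; lra|]. intros e Hne Hlt.
      assert (H1 := Rlt_le_trans _ _ _ Hlt (Rmin_l d (1/2))).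
      assert (H2 := Rlt_le_trans _ _ _ Hlt (Rmin_r d (1/2))).
      specialize (H e H1).
      rewrite Cplus_0_r, CGamma_1, HT0 in H.
      replace (h * s * / 1)%C with (h * s)%C in H by field.
      rewrite opp_IZR, <- INR_IZR_INZ, RtoC_opp.
      assert (Hc' := not_nonpos_int_near m e Hne ltac:(lra)).
      set (c' := (- INR m + e)%C) in *.
      assert (EG : CGamma (1 + e) = (poch c' (S m) * CGamma c')%C).
      { rewrite <- CGamma_add by auto. f_equal. unfold c'. rewrite RtoC_INR_S. ring. }
      assert (Hp : poch c' (S m) <> 0) by (apply poch_neq0; auto).
      assert (HGn : CGamma c' <> 0) by (apply CGamma_neq0; auto).
      rewrite (hyp2F1_value A B c' xi h (/ poch c' (S m) * T e)%C); auto.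
      - replace (h * (/ poch c' (S m) * T e) / CGamma c')%C with (h * T e * / CGamma (1 + e))%C; auto.
        rewrite EG. field. auto.
      - eapply has_sum_ext; [|apply has_sum_scal, (HT e); lra].
        intros n. unfold near_pole_term, hyp2F1_coeff.
        rewrite poch_quot_eq by (auto; lra). fold c'.
        replace (- INR m - B + e)%C with (c' - B)%C by (unfold c'; ring).
        assert (poch c' n <> 0) by (apply poch_neq0; auto).
        field. auto using fact_C_neq0. }
    apply (iota_unique (V := C_CompleteNormedModule)); auto.
    intros y Hy. eapply filterlim_punctured_unique; eauto.
  - rewrite nonpos_int_IZR in Hc.
    replace c with (Z.of_nat (S (Z.to_nat (c - 1)))) in * by lia.
    set (k := Z.to_nat (c - 1)) in *. clearbody k.
    rewrite <- INR_IZR_INZ in *.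
    rewrite (hyp2F1_value A B (INR (S k)) xi h (INR (fact k) * s)%C); auto.
    + rewrite CGamma_nat. field. apply fact_C_neq0.
    + rewrite INR_IZR_INZ, nonpos_int_IZR. lia.
    + eapply has_sum_ext; [|apply has_sum_scal, Hs].
      intros n. cbv beta. rewrite reg_coeff_pos. field. apply fact_C_neq0.
Qed.

(** * The binomial series at a real exponent *)

Fixpoint rpoch (a : R) (n : nat) : R :=
  match n with O => 1 | S m => rpoch a m * (a + INR m) end.

Lemma poch_RtoC a n : poch (RtoC a) n = RtoC (rpoch a n).
Proof.
  induction n as [|n IH]; simpl; auto. rewrite IH, RtoC_mult, RtoC_plus. reflexivity.
Qed.

Lemma binc_RtoC a n : binc (RtoC a) n = RtoC (rpoch a n / INR (fact n)).
Proof.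
  unfold binc. rewrite poch_RtoC, RtoC_div; auto. apply INR_fact_neq_0.
Qed.

(** [f(y) (1-y)^a] has derivative zero, because the recursion of the
    coefficients says [(1-y) f' = a f]. *)
Lemma binomial_series (a y : R) : 0 < y < 1 ->
  has_sum (fun n => binc a n * y ^ n)%C (exp (- a * ln (1 - y))).
Proof.
  intros Hy.
  set (b := fun n => rpoch a n / INR (fact n)).
  assert (Hcv : forall t, 0 <= t < 1 -> Rbar_lt (Rabs t) (CV_radius b)).
  { intros t Ht. set (u := (t + 1) / 2).
    assert (Hu : Cmod u < 1) by (rewrite Cmod_R, Rabs_pos_eq; unfold u; lra).
    destruct (abs_summable_has_sum _ (binc_summable a u Hu)) as [s Hs].
    apply has_sum_is_series, is_series_Re_Im in Hs. destruct Hs as [Hs _].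
    assert (Hp : is_pseries b u (Re s)).
    { apply is_pseries_R. eapply is_series_ext; [|exact Hs]. intros n. cbv beta.
      rewrite binc_RtoC, Cpow_RtoC, <- RtoC_mult. reflexivity. }
    apply is_pseries_CV_radius in Hp. eapply Rbar_lt_le_trans; [|exact Hp].
    simpl. rewrite !Rabs_pos_eq; unfold u; lra. }
  assert (Hrec : forall n, INR (S n) * b (S n) = (a + INR n) * b n).
  { intros n. unfold b. simpl rpoch. rewrite fact_simpl, mult_INR. field.
    split; [apply INR_fact_neq_0|apply not_0_INR; lia]. }
  assert (Hode : forall t, 0 <= t < 1 ->
     (1 - t) * PSeries (PS_derive b) t = a * PSeries b t).
  { intros t Ht. specialize (Hcv t Ht).
    assert (H1 : is_pseries (PS_derive b) t (PSeries (PS_derive b) t)).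
    { apply PSeries_correct, ex_pseries_derive. auto. }
    assert (H2 := is_pseries_incr_1 _ _ _ H1).
    assert (H3 := is_pseries_minus _ _ _ _ _ H1 H2).
    assert (H4 : is_pseries b t (PSeries b t)) by (apply PSeries_correct, CV_radius_inside; auto).
    assert (H5 := is_pseries_scal a _ _ _ (Rmult_comm _ _) H4).
    apply is_pseries_unique in H3. apply is_pseries_unique in H5.
    transitivity (PSeries (PS_scal a b) t); [|exact H5].
    transitivity (PSeries (PS_minus (PS_derive b) (PS_incr_1 (PS_derive b))) t).
    - rewrite H3. unfold minus, plus, opp, scal; simpl. unfold mult; simpl. ring.
    - apply PSeries_ext. intros [|n]; unfold PS_minus, PS_plus, PS_opp, PS_scal, PS_incr_1, PS_derive;
        unfold plus, opp, scal, zero; simpl; unfold mult; simpl.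
      + specialize (Hrec O). simpl in Hrec. lra.
      + assert (R1 := Hrec (S n)). rewrite S_INR in R1.
        change (match n with O => 1 | S _ => INR n + 1 end) with (INR (S n)).
        rewrite S_INR in *. lra. }
  assert (Hphi : PSeries b 0 * exp (a * ln (1 - 0)) = PSeries b y * exp (a * ln (1 - y))).
  { apply (eq_is_derive (fun t => PSeries b t * exp (a * ln (1 - t)))); [|lra].
    intros t Ht.
    assert (Hd : is_derive (PSeries b) t (PSeries (PS_derive b) t)).
    { apply is_derive_PSeries, Hcv. lra. }
    assert (He : is_derive (fun t => exp (a * ln (1 - t))) t (- a / (1 - t) * exp (a * ln (1 - t)))).
    { auto_derive; [lra|]. unfold Rdiv, Rminus; ring. }
    assert (Hm := is_derive_mult _ _ _ _ _ Hd He Rmult_comm).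
    replace (@zero R_NormedModule) with
      (plus (mult (PSeries (PS_derive b) t) (exp (a * ln (1 - t))))
            (mult (PSeries b t) (- a / (1 - t) * exp (a * ln (1 - t))))); auto.
    unfold plus, mult, zero; simpl.
    transitivity ((((1 - t) * PSeries (PS_derive b) t) - a * PSeries b t) * exp (a * ln (1 - t)) / (1 - t)).
    - field. lra.
    - rewrite Hode by lra. field. lra. }
  rewrite PSeries_0, Rminus_0_r, ln_1, Rmult_0_r, exp_0 in Hphi.
  assert (Hb0 : b O = 1) by (unfold b; simpl; field).
  rewrite Hb0 in Hphi.
  assert (Hym : Cmod y < 1) by (rewrite Cmod_R, Rabs_pos_eq; lra).
  replace (exp (- a * ln (1 - y))) with (PSeries b y).
  - destruct (abs_summable_has_sum _ (binc_summable a y Hym)) as [s Hs].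
    replace (RtoC (PSeries b y)) with s; auto.
    apply has_sum_is_series, is_series_Re_Im in Hs. destruct Hs as [Hs1 Hs2].
    assert (E : forall n, (binc a n * y ^ n)%C = RtoC (b n * y ^ n)).
    { intros n. rewrite binc_RtoC, Cpow_RtoC, <- RtoC_mult. reflexivity. }
    destruct s as [s1 s2]. change (Re (s1, s2)) with s1 in Hs1. change (Im (s1, s2)) with s2 in Hs2.
    unfold RtoC. f_equal.
    + symmetry. apply is_pseries_unique, is_pseries_R.
      eapply is_series_ext; [|exact Hs1]. intros n. cbv beta. rewrite E. reflexivity.
    + transitivity (0 * s2); [|ring]. apply is_series_unique in Hs2.
      rewrite <- Hs2, <- Series_scal_l. apply Series_ext.
      intros n. cbv beta. rewrite E. simpl. ring.
  - replace (- a * ln (1 - y)) with (- (a * ln (1 - y))) by ring.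
    rewrite exp_Ropp.
    assert (Hp := exp_pos (a * ln (1 - y))). apply Rmult_eq_reg_r with (exp (a * ln (1 - y))); [|lra].
    rewrite <- Hphi. field. lra.
Qed.

Lemma binc_sum_mult a b (x : C) u v : Cmod x < 1 ->
  has_sum (fun n => binc a n * x ^ n)%C u -> has_sum (fun n => binc b n * x ^ n)%C v ->
  has_sum (fun n => binc (a + b) n * x ^ n)%C (u * v)%C.
Proof.
  intros Hx Hu Hv. eapply has_sum_ext; [|apply has_sum_conv; [| |exact Hu|exact Hv]].
  - intros k. rewrite conv_pow, vandermonde. reflexivity.
  - apply binc_summable; auto.
  - apply binc_summable; auto.
Qed.

(** * Biorthogonality of Laurent coefficients *)

Lemma abs_summable_inj_iff {T U} (phi : T -> U) (f : U -> C) :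
  (forall x y, phi x = phi y -> x = y) ->
  (forall u, (forall t, phi t <> u) -> f u = 0) ->
  abs_summable (fun t => f (phi t)) -> abs_summable f.
Proof.
  intros Hi H0 [M HM].
  destruct (has_sum_nonneg (fun t => Cmod (f (phi t))) M) as [s Hs]; auto using Cmod_ge_0.
  exists s. apply has_sum_RtoC_nonneg_bound; [auto using Cmod_ge_0|].
  apply (has_sum_inj phi (fun u => RtoC (Cmod (f u)))); auto.
  intros u Hu. rewrite H0, Cmod_0; auto.
Qed.

Lemma abs_summable_rows {T U} (F : T * U -> C) (g : T -> C) :
  abs_summable F -> (forall t, has_sum (fun u => F (t, u)) (g t)) -> abs_summable g.
Proof.
  intros [M HM] Hg.
  destruct (has_sum_nonneg (fun p => Cmod (F p)) M) as [s Hs]; auto using Cmod_ge_0.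
  assert (Hm : exists m : T -> R, forall t, has_sum (fun u => RtoC (Cmod (F (t, u)))) (m t)).
  { exists (fun t => epsilon (inhabits 0) (fun s : R => has_sum (fun u => RtoC (Cmod (F (t, u)))) s)).
    intros t. apply epsilon_spec. apply (has_sum_nonneg (fun u => Cmod (F (t, u))) M).
    - auto using Cmod_ge_0.
    - apply (bounded_sums_row (fun p => Cmod (F p))); auto. }
  destruct Hm as [m Hm].
  assert (Hmb : forall t, bounded_sums (fun u => Cmod (F (t, u))) (m t)).
  { intros t. apply has_sum_RtoC_nonneg_bound; auto using Cmod_ge_0. }
  exists s. apply (bounded_sums_le m).
  - intros t. apply (has_sum_bound (fun u => F (t, u))); auto.
  - apply has_sum_RtoC_nonneg_bound.
    + intros t. apply (bounded_sums_ge0 _ _ (Hmb t)).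
    + eapply has_sum_rows; [exact Hs|]. auto.
Qed.

(** Taylor coefficients of [(1 - s omega)^(-a)], as a sequence on Z. *)
Definition binz (s : R) (a : C) (n : Z) : C :=
  if Z_lt_dec n 0 then RtoC 0 else (binc a (Z.to_nat n) * s ^ (Z.to_nat n))%C.

Lemma binz_nat s a n : binz s a (Z.of_nat n) = (binc a n * s ^ n)%C.
Proof.
  unfold binz. destruct (Z_lt_dec _ _); [lia|]. rewrite Nat2Z.id. reflexivity.
Qed.

Lemma binz_neg s a n : (n < 0)%Z -> binz s a n = 0.
Proof. unfold binz. destruct (Z_lt_dec n 0); auto; lia. Qed.

Lemma binz_outside s a u : (forall n, Z.of_nat n <> u) -> binz s a u = 0.
Proof.
  intros H. apply binz_neg. destruct (Z_lt_dec u 0) as [|Hu]; auto.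
  destruct (H (Z.to_nat u)). lia.
Qed.

Lemma binz_summable s a : 0 < s < 1 -> abs_summable (binz s a).
Proof.
  intros Hs. apply (abs_summable_inj_iff Z.of_nat).
  - intros; lia.
  - apply binz_outside.
  - eapply abs_summable_le; [|apply (binc_summable a s)].
    + intros n. rewrite binz_nat. lra.
    + rewrite Cmod_R, Rabs_pos_eq; lra.
Qed.

Lemma binz_vandermonde s a b N :
  has_sum (fun i => binz s a i * binz s b (N - i))%C (binz s (a + b) N).
Proof.
  destruct (Z_lt_dec N 0) as [HN|HN].
  - rewrite binz_neg by auto. eapply has_sum_ext; [|apply has_sum_0].
    intros i. simpl. destruct (Z_lt_dec i 0).
    + rewrite (binz_neg s a) by auto. ring.
    + rewrite (binz_neg s b) by lia. ring.
  - apply (has_sum_inj Z.of_nat (fun i => binz s a i * binz s b (N - i))%C).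
    + intros; lia.
    + intros u Hu. rewrite binz_outside by auto. ring.
    + replace N with (Z.of_nat (Z.to_nat N)) by lia. set (k := Z.to_nat N).
      rewrite binz_nat, <- vandermonde, <- conv_pow. unfold conv.
      rewrite (csum_ext _ (fun i => binz s a (Z.of_nat i) * binz s b (Z.of_nat k - Z.of_nat i))%C).
      * apply (has_sum_finite (fun i => binz s a (Z.of_nat i) * binz s b (Z.of_nat k - Z.of_nat i))%C).
        apply seq_NoDup. intros i Hi. rewrite (binz_neg s b); [ring|].
        rewrite in_seq in Hi. lia.
      * intros i Hi. apply in_seq in Hi.
        rewrite <- Nat2Z.inj_sub, !binz_nat by lia. reflexivity.
Qed.

(** [g] lists the coefficients of the Laurent series
    [(1 - s omega)^(-a) (1 - s/omega)^(-b)]. *)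
Definition laurent (s : R) (a b : C) (g : Z -> C) : Prop :=
  forall n, has_sum (fun k => binz s a (n + k) * binz s b k)%C (g n).

Lemma laurent_summable_row s a b n : 0 < s < 1 ->
  abs_summable (fun k => binz s a (n + k) * binz s b k)%C.
Proof.
  intros Hs. destruct (abs_summable_bounded _ (binz_summable s a Hs)) as [M [HM0 HM]].
  apply (abs_summable_mul_bounded _ (fun k => binz s a (n + k)) M), binz_summable; auto.
Qed.

Lemma has_sum_bij {T U} (phi : T -> U) (psi : U -> T) (f : U -> C) s :
  (forall t, psi (phi t) = t) -> (forall u, phi (psi u) = u) ->
  has_sum f s <-> has_sum (fun t => f (phi t)) s.
Proof.
  intros H1 H2. apply has_sum_inj.
  - intros x y E. rewrite <- (H1 x), E. auto.
  - intros u Hu. destruct (Hu (psi u)); auto.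
Qed.

Lemma poch_neg_nat k n : (k < n)%nat -> poch (- INR k) n = 0.
Proof.
  induction 1 as [|n H IH]; simpl.
  - ring.
  - rewrite IH. ring.
Qed.

Lemma binc_1 n : binc 1 n = 1.
Proof. unfold binc. rewrite poch_1. field. apply fact_C_neq0. Qed.

(** The sum is the coefficient of [omega^d] in the product of the first series
    and the second one at [1/omega].  The factors in [omega] combine to
    [(1 - s omega)^(d-1)], those in [1/omega] to [(1 - s/omega)^(-d-1)].  For
    [d > 0] the first is a polynomial of degree [d - 1], and for [d < 0] the
    second has degree [-d - 1] in [1/omega]: neither reaches [omega^d]. *)
Lemma laurent_biorthogonal s a b a' b' (d : Z) g g' :
  0 < s < 1 -> laurent s a b g -> laurent s a' b' g' ->
  (a + b' = 1 - IZR d)%C -> (b + a' = 1 + IZR d)%C ->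
  abs_summable (fun n => g n * g' (n - d)%Z)%C /\
  has_sum (fun n => g n * g' (n - d)%Z)%C
    (if Z.eq_dec d 0 then RtoC (/ (1 - s ^ 2)) else RtoC 0).
Proof.
  intros Hs Hg Hg' Eab Eba.
  set (F := fun p : Z * (Z * Z) => let '(n, (k, l)) := p in
    ((binz s a (n + k) * binz s b k) * (binz s a' (n - d + l) * binz s b' l))%C).
  set (H := fun p : Z * (Z * Z) => let '(i, (l, k)) := p in
    (binz s a i * (binz s b' l * binz s b k) * binz s a' (i + l - k - d))%C).
  set (G := fun p : Z * (Z * Z) => let '(N, (i, k)) := p in
    ((binz s a i * binz s b' (N - i)) * (binz s b k * binz s a' (N - d - k)))%C).
  set (phi := fun p : Z * (Z * Z) => let '(n, (k, l)) := p in ((n + k)%Z, (l, k))).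
  set (phi' := fun p : Z * (Z * Z) => let '(i, (l, k)) := p in ((i - k)%Z, (k, l))).
  set (chi := fun p : Z * (Z * Z) => let '(N, (i, k)) := p in (i, ((N - i)%Z, k))).
  set (chi' := fun p : Z * (Z * Z) => let '(i, (l, k)) := p in ((i + l)%Z, (i, k))).
  assert (B1 : forall p, phi' (phi p) = p) by (intros [n [k l]]; simpl; repeat f_equal; lia).
  assert (B2 : forall p, phi (phi' p) = p) by (intros [n [k l]]; simpl; repeat f_equal; lia).
  assert (B3 : forall p, chi' (chi p) = p) by (intros [n [k l]]; simpl; repeat f_equal; lia).
  assert (B4 : forall p, chi (chi' p) = p) by (intros [n [k l]]; simpl; repeat f_equal; lia).
  assert (EF : forall p, H (phi p) = F p).
  { intros [n [k l]]. simpl. replace (n + k + l - k - d)%Z with (n - d + l)%Z by lia. ring. }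
  assert (EG : forall p, H (chi p) = G p).
  { intros [N [i k]]. simpl. replace (i + (N - i) - k - d)%Z with (N - d - k)%Z by lia. ring. }
  assert (SH : abs_summable H).
  { destruct (abs_summable_bounded _ (binz_summable s a' Hs)) as [M [HM0 HM]].
    apply (abs_summable_le _ (fun p : Z * (Z * Z) => binz s a' (fst p + fst (snd p) - snd (snd p) - d) *
       (binz s a (fst p) * (binz s b' (fst (snd p)) * binz s b (snd (snd p)))))%C).
    - intros [i [l k]]. simpl. apply Req_le. f_equal. ring.
    - apply abs_summable_mul_bounded with M; auto.
      apply (abs_summable_prod (binz s a) (fun q : Z * Z => binz s b' (fst q) * binz s b (snd q))%C);
        [|apply abs_summable_prod]; apply binz_summable; auto. }
  assert (SF : abs_summable F).
  { replace F with (fun p => H (phi p)) by (apply functional_extensionality; auto).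
    apply abs_summable_inj; auto. intros p q E. rewrite <- (B1 p), E; auto. }
  assert (HF : forall n, has_sum (fun q => F (n, q)) (g n * g' (n - d)%Z)%C).
  { intros n.
    assert (P := has_sum_prod _ _ _ _ (laurent_summable_row s a b n Hs)
                  (laurent_summable_row s a' b' (n - d) Hs) (Hg n) (Hg' (n - d)%Z)).
    eapply has_sum_ext; [|exact P]. intros [k l]. reflexivity. }
  split; [apply (abs_summable_rows F); auto|].
  destruct (abs_summable_has_sum H SH) as [S HS].
  assert (SumF : has_sum F S).
  { apply (has_sum_bij phi phi' H) in HS; auto. eapply has_sum_ext; [|exact HS]. exact EF. }
  assert (SumG : has_sum G S).
  { apply (has_sum_bij chi chi' H) in HS; auto. eapply has_sum_ext; [|exact HS]. exact EG. }
  replace (if Z.eq_dec d 0 then RtoC (/ (1 - s ^ 2)) else RtoC 0) with S.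
  { apply (has_sum_rows F); auto. }
  assert (Sc : forall x y N, abs_summable (fun i => binz s x i * binz s y (N - i))%C).
  { intros x y N. destruct (abs_summable_bounded _ (binz_summable s y Hs)) as [M [HM0 HM]].
    apply (abs_summable_le _ (fun i => binz s y (N - i) * binz s x i)%C).
    - intros i. rewrite Cmult_comm. lra.
    - apply abs_summable_mul_bounded with M; auto. apply binz_summable; auto. }
  assert (HG : has_sum (fun N => binz s (1 - IZR d) N * binz s (1 + IZR d) (N - d))%C S).
  { apply (has_sum_rows G); auto. intros N. rewrite <- Eab, <- Eba.
    assert (P := has_sum_prod _ _ _ _ (Sc a b' N) (Sc b a' (N - d)%Z)
       (binz_vandermonde s a b' N) (binz_vandermonde s b a' (N - d)%Z)).
    eapply has_sum_ext; [|exact P]. intros [i k]. reflexivity. }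
  eapply has_sum_unique; [exact HG|].
  destruct (Z.eq_dec d 0) as [->|Hd].
  - apply (has_sum_inj Z.of_nat (fun N => binz s (1 - 0) N * binz s (1 + 0) (N - 0))%C).
    + intros; lia.
    + intros u Hu. rewrite binz_outside by auto. ring.
    + rewrite RtoC_inv, RtoC_minus by nra.
      eapply has_sum_ext; [|apply has_sum_geom].
      * intros n. simpl. rewrite Z.sub_0_r, !binz_nat.
        replace (1 - 0)%C with (RtoC 1) by ring. replace (1 + 0)%C with (RtoC 1) by ring.
        rewrite binc_1, !Cpow_RtoC, Rmult_1_r, !Cmult_1_l, <- RtoC_mult.
        rewrite Rpow_mult_distr. reflexivity.
      * rewrite Cmod_R, Rabs_pos_eq; nra.
  - eapply has_sum_ext; [|apply has_sum_0]. intros N. simpl.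
    destruct (Z_lt_dec N 0) as [HN|HN]; [rewrite (binz_neg s (1 - IZR d)) by auto; ring|].
    destruct (Z_lt_dec (N - d) 0) as [HNd|HNd]; [rewrite (binz_neg s (1 + IZR d)) by auto; ring|].
    assert (Hz : forall e n, (0 < e)%Z -> (e <= n)%Z -> binz s (1 - IZR e) n = 0).
    { intros e n He Hn. unfold binz. destruct (Z_lt_dec n 0); [lia|].
      replace (1 - IZR e)%C with (- INR (Z.to_nat (e - 1)))%C.
      - unfold binc. rewrite poch_neg_nat by lia. unfold Cdiv. ring.
      - rewrite INR_IZR_INZ, Z2Nat.id, minus_IZR, RtoC_minus by lia. ring. }
    destruct (Z_lt_dec 0 d).
    + rewrite Hz by lia. ring.
    + replace (1 + IZR d)%C with (1 - IZR (- d))%C by (rewrite opp_IZR, RtoC_opp; ring).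
      rewrite (Hz (- d)%Z) by lia. ring.
Qed.

(** * Orthogonal matrices indexed by the half-integers *)

Lemma bounded_sums_plus {T} (f g : T -> R) M N :
  bounded_sums f M -> bounded_sums g N -> bounded_sums (fun t => f t + g t) (M + N).
Proof.
  intros HM HN l Hl. assert (E : rsum (fun t => f t + g t) l = rsum f l + rsum g l).
  { clear. induction l as [|a l IH]; simpl; [ring|]. rewrite IH; ring. }
  rewrite E. specialize (HM l Hl). specialize (HN l Hl). lra.
Qed.

Lemma has_sum_csum {T U} (F : T -> U -> C) (s : T -> C) (L : list T) :
  (forall t, In t L -> has_sum (F t) (s t)) ->
  has_sum (fun u => csum (fun t => F t u) L) (csum s L).
Proof.
  induction L as [|a L IH]; simpl; intros H; [apply has_sum_0|].
  apply has_sum_plus; auto.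
Qed.

Lemma has_sum_is_hsum (u : half_integer -> C) s :
  abs_summable (fun i => u (HalfInt i)) -> has_sum (fun i => u (HalfInt i)) s -> is_hsum u s.
Proof.
  intros Su Hu. set (f := fun i => u (HalfInt i)) in *.
  set (f1 := fun i => if Z_lt_dec i 0 then RtoC 0 else f i).
  set (f2 := fun i => if Z_lt_dec i 0 then f i else RtoC 0).
  assert (Hle : forall g : Z -> C, (forall i, g i = f i \/ g i = 0) -> exists s', has_sum g s').
  { intros g Hg. apply abs_summable_has_sum. apply (abs_summable_le g f); auto.
    intros i. destruct (Hg i) as [-> | ->]; [lra|]. rewrite Cmod_0; apply Cmod_ge_0. }
  destruct (Hle f1) as [s1 H1].
  { intros i. unfold f1. destruct (Z_lt_dec i 0); auto. }
  destruct (Hle f2) as [s2 H2].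
  { intros i. unfold f2. destruct (Z_lt_dec i 0); auto. }
  exists s1, s2. split; [|split].
  - apply has_sum_is_series. apply (has_sum_inj Z.of_nat) in H1.
    + eapply has_sum_ext; [|exact H1]. intros n. unfold f1.
      destruct (Z_lt_dec _ _); [lia|reflexivity].
    + intros; lia.
    + intros i Hi. unfold f1. destruct (Z_lt_dec i 0); auto.
      destruct (Hi (Z.to_nat i)). lia.
  - apply has_sum_is_series. apply (has_sum_inj (fun n => (- Z.of_nat n - 1)%Z)) in H2.
    + eapply has_sum_ext; [|exact H2]. intros n. unfold f2.
      destruct (Z_lt_dec _ _); [reflexivity|lia].
    + intros; lia.
    + intros i Hi. unfold f2. destruct (Z_lt_dec i 0); auto.
      destruct (Hi (Z.to_nat (- i - 1))). lia.
  - apply (has_sum_unique f); auto.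
    eapply has_sum_ext; [|apply has_sum_plus; [exact H1|exact H2]].
    intros i. simpl. unfold f1, f2. destruct (Z_lt_dec i 0); ring.
Qed.

(** Bounds the squared l^2 norm through finite subsums, so that no convergence
    has to be known beforehand. *)
Definition sq_bounded (f : half_integer -> C) (M : R) : Prop :=
  bounded_sums (fun i => Cmod (f (HalfInt i)) ^ 2) M.

Lemma sq_bounded_series f M : sq_bounded f M ->
  in_l2 f /\
  Series (fun n => Cmod (f (HalfInt (Z.of_nat n))) ^ 2) +
  Series (fun n => Cmod (f (HalfInt (- Z.of_nat n - 1)%Z)) ^ 2) <= 2 * M.
Proof.
  intros H.
  assert (H1 := bounded_sums_inj Z.of_nat _ _ ltac:(intros; lia) H).
  assert (H2 := bounded_sums_inj (fun n => (- Z.of_nat n - 1)%Z) _ _ ltac:(intros x y E; cbv beta in E; lia) H).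
  apply bounded_sums_ex_series in H1; [|intros; apply pow2_ge_0].
  apply bounded_sums_ex_series in H2; [|intros; apply pow2_ge_0].
  destruct H1 as [E1 B1], H2 as [E2 B2]. split; [split; auto|].
  eapply Rle_trans; [apply Rplus_le_compat; [exact B1|exact B2]|]. lra.
Qed.

Lemma bounded_sums_Z (g : Z -> R) M N :
  bounded_sums (fun n => g (Z.of_nat n)) M ->
  bounded_sums (fun n => g (- Z.of_nat n - 1)%Z) N -> bounded_sums g (M + N).
Proof.
  intros HM HN l Hl. rewrite (rsum_filter (Z.leb 0)).
  assert (Hpart : forall (p : Z -> bool) (f : nat -> Z) (f' : Z -> nat) K,
     (forall i, p i = true -> f (f' i) = i) -> bounded_sums (fun n => g (f n)) K ->
     rsum g (filter p l) <= K).
  { intros p f f' K Hf HK.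
    rewrite (rsum_ext g (fun i => g (f (f' i)))).
    - rewrite <- (rsum_map (fun n => g (f n)) f'). apply HK.
      apply NoDup_map_NoDup_ForallPairs; [|apply NoDup_filter; auto].
      intros x y Hx Hy E. apply filter_In in Hx, Hy.
      rewrite <- (Hf x), <- (Hf y), E; tauto.
    - intros i Hi. apply filter_In in Hi. rewrite Hf; tauto. }
  apply Rplus_le_compat.
  - apply (Hpart _ Z.of_nat Z.to_nat); auto. intros i Hi. apply Z.leb_le in Hi. lia.
  - apply (Hpart _ (fun n => (- Z.of_nat n - 1)%Z) (fun i => Z.to_nat (- i - 1))); auto.
    intros i Hi. apply Bool.negb_true_iff, Z.leb_gt in Hi. lia.
Qed.

Lemma in_l2_summable f : in_l2 f -> exists M, sq_bounded f M.
Proof.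
  intros [H1 H2]. eexists. apply bounded_sums_Z.
  - exact (ex_series_bounded_sums _ (fun n => pow2_ge_0 _) H1).
  - exact (ex_series_bounded_sums _ (fun n => pow2_ge_0 _) H2).
Qed.

Lemma lin_comb_app e l1 l2 x :
  lin_comb e (l1 ++ l2) x = (lin_comb e l1 x + lin_comb e l2 x)%C.
Proof.
  unfold lin_comb. induction l1 as [|p l1 IH]; simpl; [ring|]. rewrite IH. ring.
Qed.

Lemma lin_comb_scal e k l x :
  lin_comb e (map (fun p => (k * fst p, snd p)%C) l) x = (k * lin_comb e l x)%C.
Proof.
  unfold lin_comb. induction l as [|p l IH]; simpl; [ring|]. rewrite IH. ring.
Qed.

Lemma lin_comb_map e (c : half_integer -> C) l x :
  lin_comb e (map (fun a => (c a, a)) l) x = csum (fun a => c a * e a x)%C l.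
Proof.
  unfold lin_comb. induction l as [|p l IH]; simpl; [reflexivity|]. rewrite IH. reflexivity.
Qed.

(** Distances are measured by their squares; this gives the same closure and
    needs [|u + v|^2 <= 2 |u|^2 + 2 |v|^2] instead of the triangle inequality. *)
Definition in_closed_span (e : half_integer -> half_integer -> C) (f : half_integer -> C) : Prop :=
  forall eps, 0 < eps -> exists l, sq_bounded (fun x => f x - lin_comb e l x)%C eps.

Lemma Cmod_plus_sq (u v : C) : Cmod (u + v) ^ 2 <= 2 * Cmod u ^ 2 + 2 * Cmod v ^ 2.
Proof.
  assert (H := Cmod_triangle u v). assert (H0 := Cmod_ge_0 (u + v)).
  assert (Cmod (u + v) ^ 2 <= (Cmod u + Cmod v) ^ 2) by (apply pow_incr; lra).
  assert (H2 := pow2_ge_0 (Cmod u - Cmod v)). lra.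
Qed.

Lemma sq_bounded_plus f g h M N :
  (forall x, h x = f x + g x)%C -> sq_bounded f M -> sq_bounded g N ->
  sq_bounded h (2 * M + 2 * N).
Proof.
  intros E HM HN.
  eapply bounded_sums_le; [|apply bounded_sums_plus; apply bounded_sums_scal; [|exact HM| |exact HN]; lra].
  intros i. cbv beta. rewrite E. apply Cmod_plus_sq.
Qed.

Lemma in_closed_span_plus e f g :
  in_closed_span e f -> in_closed_span e g -> in_closed_span e (fun x => f x + g x)%C.
Proof.
  intros Hf Hg eps He.
  destruct (Hf (eps / 4)) as [l1 H1]; [lra|]. destruct (Hg (eps / 4)) as [l2 H2]; [lra|].
  exists (l1 ++ l2). replace eps with (2 * (eps / 4) + 2 * (eps / 4)) by field.
  apply (sq_bounded_plus _ _ _ _ _) with (2 := H1) (3 := H2).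
  intros x. rewrite lin_comb_app. ring.
Qed.

Lemma in_closed_span_scal e k f : in_closed_span e f -> in_closed_span e (fun x => k * f x)%C.
Proof.
  intros Hf eps He. assert (Hk := Cmod_ge_0 k).
  set (K := Cmod k ^ 2 + 1). assert (HK : 0 < K) by (unfold K; nra).
  destruct (Hf (eps / K)) as [l H]; [apply Rdiv_lt_0_compat; auto|].
  exists (map (fun p => (k * fst p, snd p)%C) l).
  intros L HL. eapply Rle_trans.
  - apply (bounded_sums_scal _ _ (Cmod k ^ 2)) in H; [|apply pow2_ge_0].
    eapply Rle_trans; [|apply (H L HL)]. apply Req_le, rsum_ext. intros i _.
    rewrite lin_comb_scal. rewrite <- Rpow_mult_distr, <- Cmod_mult. do 2 f_equal. ring.
  - apply Rmult_le_reg_r with K; auto. unfold Rdiv.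
    replace (Cmod k ^ 2 * (eps * / K) * K) with (Cmod k ^ 2 * eps) by (field; lra).
    unfold K. nra.
Qed.

Lemma in_closed_span_limit e f :
  (forall eps, 0 < eps -> exists g, in_closed_span e g /\ sq_bounded (fun x => f x - g x)%C eps) ->
  in_closed_span e f.
Proof.
  intros H eps He. destruct (H (eps / 4)) as [g [Hg Hb]]; [lra|].
  destruct (Hg (eps / 4)) as [l Hl]; [lra|]. exists l.
  replace eps with (2 * (eps / 4) + 2 * (eps / 4)) by field.
  apply (sq_bounded_plus _ _ _ _ _) with (2 := Hb) (3 := Hl).
  intros x. ring.
Qed.

Definition delta (i : Z) (x : half_integer) : C :=
  if Z.eq_dec (hfloor x) i then RtoC 1 else RtoC 0.

Lemma in_closed_span_finite e (c : Z -> C) (L : list Z) :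
  (forall i, in_closed_span e (delta i)) ->
  in_closed_span e (fun x => csum (fun i => c i * delta i x)%C L).
Proof.
  intros H. induction L as [|i L IH]; simpl.
  - intros eps He. exists []. intros l _. rewrite (rsum_ext _ (fun _ => 0 * 0)).
    + rewrite rsum_scal. lra.
    + intros j _. unfold lin_comb; simpl. replace (0 - 0)%C with (RtoC 0) by ring.
      rewrite Cmod_0. ring.
  - apply in_closed_span_plus; auto. apply in_closed_span_scal; auto.
Qed.

Lemma csum_delta (c : Z -> C) (L : list Z) j : NoDup L ->
  csum (fun i => c i * delta i (HalfInt j))%C L = if in_dec Z.eq_dec j L then c j else RtoC 0.
Proof.
  unfold delta; simpl. induction 1 as [|i L Hi HL IH]; [reflexivity|].
  simpl csum. rewrite IH. simpl in_dec.
  destruct (Z.eq_dec j i) as [->|Hne].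
  - destruct (Z.eq_dec i i) as [_|]; [|congruence].
    destruct (in_dec Z.eq_dec i L); [contradiction|]. ring.
  - destruct (Z.eq_dec i j); [congruence|].
    destruct (in_dec Z.eq_dec j L); ring.
Qed.

(** Truncation: the finitely supported functions are dense. *)
Lemma in_closed_span_l2 e f :
  (forall i, in_closed_span e (delta i)) -> in_l2 f -> in_closed_span e f.
Proof.
  intros He Hf. apply in_closed_span_limit. intros eps Heps.
  destruct (in_l2_summable f Hf) as [M HM].
  destruct (has_sum_nonneg _ M (fun i => pow2_ge_0 (Cmod (f (HalfInt i)))) HM) as [s Hs].
  assert (Hb := has_sum_RtoC_nonneg_bound _ _ (fun i => pow2_ge_0 (Cmod (f (HalfInt i)))) Hs).
  destruct (Hs eps Heps) as [l0 Hl0]. set (L := dedup l0).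
  exists (fun x => csum (fun i => f (HalfInt i) * delta i x)%C L).
  split; [apply in_closed_span_finite; auto|].
  assert (HL : NoDup L) by apply dedup_NoDup.
  assert (HsL : s - eps < rsum (fun i => Cmod (f (HalfInt i)) ^ 2) L).
  { specialize (Hl0 L HL). assert (Hi : incl l0 L) by (intros x Hx; apply dedup_In; auto).
    specialize (Hl0 Hi). rewrite csum_RtoC, <- RtoC_minus, Cmod_R in Hl0.
    apply Rabs_def2 in Hl0. lra. }
  intros l Hl. rewrite (rsum_ext _ (fun i => if in_dec Z.eq_dec i L then 0 else Cmod (f (HalfInt i)) ^ 2)).
  2:{ intros i _. rewrite csum_delta by auto. destruct (in_dec Z.eq_dec i L).
      - replace (f (HalfInt i) - f (HalfInt i))%C with (RtoC 0) by ring. rewrite Cmod_0. ring.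
      - do 2 f_equal. ring. }
  set (p := fun i => if in_dec Z.eq_dec i L then true else false).
  rewrite (rsum_filter p).
  rewrite (rsum_ext _ (fun _ => 0 * 0) (filter p l)), rsum_scal.
  2:{ intros i Hi. apply filter_In in Hi. unfold p in Hi.
      destruct (in_dec Z.eq_dec i L); [ring|easy]. }
  set (l' := filter (fun i => negb (p i)) l).
  assert (Hl' : forall i, In i l' -> ~ In i L).
  { intros i Hi. apply filter_In in Hi. unfold p in Hi.
    simpl in Hi. destruct (in_dec Z.eq_dec i L); [easy|assumption]. }
  rewrite (rsum_ext _ (fun i => Cmod (f (HalfInt i)) ^ 2) l').
  2:{ intros i Hi. destruct (in_dec Z.eq_dec i L); auto. destruct (Hl' i); auto. }
  assert (Hn : NoDup (L ++ l')).
  { apply NoDup_app; auto. apply NoDup_filter; auto. intros x Hx Hx'. apply (Hl' x); auto. }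
  specialize (Hb _ Hn). rewrite rsum_app in Hb. lra.
Qed.

Lemma csum_indicator (c : Z -> C) (L : list Z) j : NoDup L -> In j L ->
  csum (fun k => c k * (if Z.eq_dec j k then RtoC 1 else RtoC 0))%C L = c j.
Proof.
  intros HL Hj. rewrite <- (csum_ext (fun i => c i * delta i (HalfInt j))%C).
  - rewrite csum_delta by auto. destruct (in_dec Z.eq_dec j L); [auto|contradiction].
  - intros k _. reflexivity.
Qed.

Lemma Cconj_csum {T} (f : T -> C) l : Cconj (csum f l) = csum (fun t => Cconj (f t)) l.
Proof.
  induction l as [|a l IH]; simpl; [apply injective_projections; simpl; ring|].
  rewrite Cplus_conj, IH. reflexivity.
Qed.

(** The squared distance from [delta i] to a partial sum of its expansion along
    the rows is 1 minus a partial sum of the squares in the [i]-th column. *)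
Lemma orthonormal_basis_of_matrix (E : Z -> Z -> C) :
  (forall j i, Cconj (E j i) = E j i) ->
  (forall j k, abs_summable (fun i => E j i * E k i)%C /\
     has_sum (fun i => E j i * E k i)%C
       (if Z.eq_dec j k then RtoC 1 else RtoC 0)) ->
  (forall i, has_sum (fun j => E j i * E j i)%C 1) ->
  l2_orthonormal_basis (fun a x => E (hfloor a) (hfloor x)).
Proof.
  intros Hre Horth Hcol. set (e := fun a x => E (hfloor a) (hfloor x)).
  assert (Hspan : forall i, in_closed_span e (delta i)).
  { intros i eps He. destruct (Hcol i eps He) as [l0 Hl0].
    set (L := dedup l0). assert (HL : NoDup L) by apply dedup_NoDup.
    set (c := fun j => E j i).
    specialize (Hl0 L HL). assert (Hi : incl l0 L) by (intros x Hx; apply dedup_In; auto).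
    specialize (Hl0 Hi).
    exists (map (fun a => (c (hfloor a), a)) (map HalfInt L)).
    set (u := fun x => (delta i x - lin_comb e (map (fun a => (c (hfloor a), a)) (map HalfInt L)) x)%C).
    set (v := fun y => csum (fun j => c j * E j y)%C L).
    assert (Eu : forall y, u (HalfInt y) = (delta i (HalfInt y) - v y)%C).
    { intros y. unfold u. rewrite lin_comb_map, csum_map. reflexivity. }
    set (q := csum (fun j => c j * c j)%C L).
    assert (Hd : has_sum (fun y => delta i (HalfInt y)) 1).
    { assert (D := has_sum_finite (fun y => delta i (HalfInt y)) [i] ltac:(constructor; [intros []|constructor])).
      simpl in D. unfold delta in D at 3. simpl in D.
      destruct (Z.eq_dec i i) as [_|]; [|congruence]. rewrite Cplus_0_r in D. apply D.
      intros y Hy. unfold delta; simpl. destruct (Z.eq_dec y i); auto. subst. destruct Hy; left; auto. }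
    assert (Hdv : has_sum (fun y => delta i (HalfInt y) * v y)%C q).
    { assert (D := has_sum_finite (fun y => delta i (HalfInt y) * v y)%C [i] ltac:(constructor; [intros []|constructor])).
      simpl in D. unfold delta in D at 3. simpl in D.
      destruct (Z.eq_dec i i) as [_|]; [|congruence].
      rewrite Cplus_0_r, Cmult_1_l in D. apply D.
      intros y Hy. unfold delta; simpl. destruct (Z.eq_dec y i); [|ring]. subst. destruct Hy; left; auto. }
    assert (Hvv : has_sum (fun y => v y * v y)%C q).
    { unfold q. rewrite (csum_ext _ (fun j => csum (fun k => c j * (c k * (if Z.eq_dec j k then RtoC 1 else RtoC 0)))%C L)).
      - eapply has_sum_ext; [|apply (has_sum_csum (fun j y => csum (fun k => c j * (c k *
           (E j y * E k y)))%C L))].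
        + intros y. cbv beta. unfold v. rewrite <- csum_scal_r. apply csum_ext. intros j _.
          rewrite <- csum_scal. apply csum_ext. intros k _. ring.
        + intros j _. apply (has_sum_csum (fun k y => (c j * (c k *
           (E j y * E k y)))%C)).
          intros k _. apply has_sum_scal, has_sum_scal, Horth.
      - intros j Hj. rewrite csum_scal, csum_indicator; auto. }
    assert (Hu : has_sum (fun y => RtoC (Cmod (u (HalfInt y)) ^ 2)) (1 - q)%C).
    { replace (1 - q)%C with (1 + (-2 * q + q))%C by ring.
      eapply has_sum_ext; [|apply has_sum_plus; [exact Hd|apply has_sum_plus; [apply has_sum_scal; exact Hdv|exact Hvv]]].
      intros y. cbv beta. rewrite Cmod2_conj, Eu.
      assert (Ev : Cconj (v y) = v y).
      { unfold v. rewrite Cconj_csum. apply csum_ext. intros j _. rewrite Cmult_conj. unfold c. rewrite !Hre. reflexivity. }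
      assert (Ed : Cconj (delta i (HalfInt y)) = delta i (HalfInt y)).
      { unfold delta. destruct (Z.eq_dec _ _); apply injective_projections; simpl; ring. }
      rewrite Cminus_conj, Ev, Ed.
      assert (Edd : (delta i (HalfInt y) * delta i (HalfInt y))%C = delta i (HalfInt y)).
      { unfold delta. destruct (Z.eq_dec _ _); ring. }
      rewrite <- Edd at 1. ring. }
    intros l Hl. apply Rle_trans with (Cmod (1 - q)).
    - assert (Hbd : exists s : R, (1 - q)%C = RtoC s /\ 0 <= s).
      { assert (Eq : q = RtoC (rsum (fun j => Cmod (c j) ^ 2) L)).
        { rewrite <- csum_RtoC. apply csum_ext. intros j _. rewrite Cmod2_conj. unfold c. rewrite Hre. reflexivity. }
        exists (1 - rsum (fun j => Cmod (c j) ^ 2) L). split.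
        - rewrite Eq, RtoC_minus. reflexivity.
        - assert (Hb : bounded_sums (fun j => Cmod (c j) ^ 2) 1); [|specialize (Hb L HL); lra].
          apply has_sum_RtoC_nonneg_bound; [intros; apply pow2_ge_0|].
          eapply has_sum_ext; [|apply (Hcol i)]. intros j. cbv beta. rewrite Cmod2_conj. unfold c. rewrite Hre. reflexivity. }
      destruct Hbd as [s [Es Hs]]. rewrite Es in Hu |- *.
      rewrite Cmod_R, Rabs_pos_eq by auto.
      apply (has_sum_RtoC_nonneg_bound (fun y => Cmod (u (HalfInt y)) ^ 2)); auto.
      intros; apply pow2_ge_0.
    - rewrite <- Cmod_opp. replace (- (1 - q))%C with (q - 1)%C by ring. apply Rlt_le. exact Hl0. }
  assert (Hl2 : forall j, sq_bounded (e (HalfInt j)) 1).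
  { intros j. apply has_sum_RtoC_nonneg_bound; [intros; apply pow2_ge_0|].
    destruct (Horth j j) as [_ H]. destruct (Z.eq_dec j j) as [_|]; [|congruence].
    eapply has_sum_ext; [|exact H]. intros i. unfold e; simpl hfloor.
    rewrite Cmod2_conj, Hre. reflexivity. }
  assert (Hin : forall j k, is_l2_inner (e (HalfInt j)) (e (HalfInt k)) (if Z.eq_dec j k then RtoC 1 else RtoC 0)).
  { intros j k. destruct (Horth j k) as [S H]. unfold is_l2_inner.
    replace (fun x => (e (HalfInt j) x * Cconj (e (HalfInt k) x))%C)
      with (fun x => (E j (hfloor x) * E k (hfloor x))%C).
    - apply has_sum_is_hsum; auto.
    - apply functional_extensionality. intros x. unfold e. rewrite Hre. reflexivity. }
  split; [|split; [|split]].
  - intros [j]. apply (sq_bounded_series _ 1), Hl2.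
  - intros [j]. specialize (Hin j j). destruct (Z.eq_dec j j); [auto|congruence].
  - intros [j] [k] Hne. specialize (Hin j k). destruct (Z.eq_dec j k); [congruence|auto].
  - intros f Hf eps He.
    assert (Hc := in_closed_span_l2 e f Hspan Hf).
    destruct (Hc (eps ^ 2 / 4)) as [l Hl]; [nra|]. exists l.
    destruct (sq_bounded_series _ _ Hl) as [_ Hs]. unfold l2_norm.
    rewrite <- (sqrt_pow2 eps) by lra. apply sqrt_lt_1_alt. split.
    + assert (Hnn : forall g : nat -> C, ex_series (fun n => Cmod (g n) ^ 2) -> 0 <= Series (fun n => Cmod (g n) ^ 2)).
      { intros g Hg. apply (bounded_sums_ge0 _ _ (ex_series_bounded_sums _ (fun n => pow2_ge_0 _) Hg)). }
      destruct (sq_bounded_series _ _ Hl) as [[E1 E2] _].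
      apply Rplus_le_le_0_compat.
      * apply (Hnn (fun n => (f (HalfInt (Z.of_nat n)) - lin_comb e l (HalfInt (Z.of_nat n)))%C)); auto.
      * apply (Hnn (fun n => (f (HalfInt (- Z.of_nat n - 1)) - lin_comb e l (HalfInt (- Z.of_nat n - 1)))%C)); auto.
    + eapply Rle_lt_trans; [exact Hs|]. nra.
Qed.

(** * Ratios of Gamma values *)

(** The common content of the two series of parameters: any step of a product of
    Gamma ratios in [z] and [z'] multiplies it by a positive number. *)
Definition admissible (z z' : C) : Prop :=
  forall k : Z, exists r : R, 0 < r /\ ((z + IZR k) * (z' + IZR k))%C = RtoC r.

Lemma admissible_principal z z' : principal_series z z' -> admissible z z'.
Proof.
  intros [Hz ->] k.
  assert (E : (Cconj z + IZR k)%C = Cconj (z + IZR k)).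
  { rewrite Cplus_conj. f_equal. unfold Cconj, RtoC; simpl. f_equal; ring. }
  exists (Cmod (z + IZR k) ^ 2). split.
  - apply pow_lt, Cmod_gt_0. intros E0. apply Hz.
    apply (f_equal Im) in E0. destruct z as [x y]; simpl in *. lra.
  - rewrite E. symmetry. apply Cmod2_conj.
Qed.

Lemma admissible_complementary z z' : complementary_series z z' -> admissible z z'.
Proof.
  destruct z as [x y], z' as [x' y']. intros [Hy [Hy' [m [Hx Hx']]]] k. simpl in *. subst.
  exists ((x + IZR k) * (x' + IZR k)). split.
  - destruct (Z_le_dec 0 (m + k)) as [H|H].
    + apply IZR_le in H. rewrite plus_IZR in H. apply Rmult_lt_0_compat; lra.
    + assert (H' : (m + k <= -1)%Z) by lia. apply IZR_le in H'. rewrite plus_IZR in H'. nra.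
  - unfold RtoC, Cplus, Cmult; simpl. f_equal; ring.
Qed.

Lemma admissible_swap z z' : admissible z z' -> admissible z' z.
Proof.
  intros H k. destruct (H k) as [r [Hr E]]. exists r. split; auto. rewrite <- E. ring.
Qed.

Lemma admissible_opp z z' : admissible z z' -> admissible (- z) (- z').
Proof.
  intros H k. destruct (H (- k)%Z) as [r [Hr E]]. exists r. split; auto.
  rewrite <- E, opp_IZR, RtoC_opp. ring.
Qed.

Definition not_int (a : C) : Prop := forall k : Z, (a + IZR k)%C <> 0.

Lemma not_int_shift a n : not_int a -> not_int (a + IZR n).
Proof.
  intros H k. replace (a + IZR n + IZR k)%C with (a + IZR (n + k))%C; auto.
  rewrite plus_IZR, RtoC_plus. ring.
Qed.

Lemma not_int_minus a j : not_int a -> not_int (a - IZR j).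
Proof.
  intros H. replace (a - IZR j)%C with (a + IZR (- j))%C; [apply not_int_shift; auto|].
  rewrite opp_IZR, RtoC_opp. ring.
Qed.

Lemma admissible_not_int z z' : admissible z z' -> not_int z.
Proof.
  intros H k E. destruct (H k) as [r [Hr E']]. rewrite E, Cmult_0_l in E'.
  injection E'. lra.
Qed.

Lemma not_int_not_nonpos a : not_int a -> ~ nonpos_int a.
Proof.
  intros H [n E]. apply (H (Z.of_nat n)). rewrite E, <- INR_IZR_INZ. ring.
Qed.

Definition gamma_ratio (a : C) (N : Z) : C := (CGamma (a + IZR N) / CGamma a)%C.

Lemma gamma_ratio_neq0 a N : not_int a -> gamma_ratio a N <> 0.
Proof.
  intros H. assert (H1 := CGamma_neq0 _ (not_int_not_nonpos _ (not_int_shift a N H))).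
  assert (H2 := CGamma_neq0 _ (not_int_not_nonpos _ H)).
  unfold gamma_ratio, Cdiv. apply Cmult_neq_0; auto. intros E.
  apply H2. assert (E2 : (CGamma a * / CGamma a)%C = 1) by (apply Cinv_r; auto).
  rewrite E, Cmult_0_r in E2. injection E2; lra.
Qed.

Lemma gamma_ratio_add a N M : not_int a ->
  gamma_ratio a (N + M) = (gamma_ratio a N * gamma_ratio (a + IZR N) M)%C.
Proof.
  intros H. assert (H1 := CGamma_neq0 _ (not_int_not_nonpos _ (not_int_shift a N H))).
  assert (H2 := CGamma_neq0 _ (not_int_not_nonpos _ H)).
  unfold gamma_ratio. rewrite plus_IZR, RtoC_plus, Cplus_assoc. field. auto.
Qed.

Lemma gamma_ratio_nat a n : not_int a -> gamma_ratio a (Z.of_nat n) = poch a n.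
Proof.
  intros H. assert (H2 := CGamma_neq0 _ (not_int_not_nonpos _ H)).
  unfold gamma_ratio. rewrite <- INR_IZR_INZ, CGamma_add by (apply not_int_not_nonpos; auto).
  field. auto.
Qed.

Lemma gamma_ratio_0 a : not_int a -> gamma_ratio a 0 = 1.
Proof. intros H. apply (gamma_ratio_nat a 0 H). Qed.

Lemma gamma_ratio_neg a n : not_int a ->
  gamma_ratio a (- Z.of_nat n) = (/ poch (a - INR n) n)%C.
Proof.
  intros H. assert (Hs := not_int_shift a (- Z.of_nat n) H).
  assert (E := gamma_ratio_add a (- Z.of_nat n) (Z.of_nat n) H).
  replace (- Z.of_nat n + Z.of_nat n)%Z with 0%Z in E by lia.
  rewrite gamma_ratio_0, gamma_ratio_nat in E by auto.
  replace (a + IZR (- Z.of_nat n))%C with (a - INR n)%C in E, Hs.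
  2: rewrite opp_IZR, RtoC_opp, <- INR_IZR_INZ; ring.
  assert (Hp := poch_neq0 _ n (not_int_not_nonpos _ Hs)).
  apply (Cmult_cancel_l (poch (a - INR n) n)); auto.
  rewrite Cinv_r, E by auto. ring.
Qed.

Lemma gamma_ratio_succ a N : not_int a ->
  gamma_ratio a (N + 1) = (gamma_ratio a N * (a + IZR N))%C.
Proof.
  intros H. rewrite gamma_ratio_add by auto. f_equal.
  change 1%Z with (Z.of_nat 1). rewrite gamma_ratio_nat by (apply not_int_shift; auto).
  simpl. ring.
Qed.

(** Every step in [N] multiplies the product by a positive real. *)
Lemma gamma_ratio_pos z z' N : admissible z z' ->
  exists r : R, 0 < r /\ (gamma_ratio z N * gamma_ratio z' N)%C = RtoC (r * r).
Proof.
  intros H. assert (Hz := admissible_not_int _ _ H).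
  assert (Hz' := admissible_not_int _ _ (admissible_swap _ _ H)).
  set (P := fun N => exists q : R, 0 < q /\ (gamma_ratio z N * gamma_ratio z' N)%C = RtoC q).
  assert (P0 : P 0%Z).
  { exists 1. split; [lra|]. rewrite !gamma_ratio_0 by auto. ring. }
  assert (PS : forall n, P n -> P (n + 1)%Z).
  { intros n [q [Hq E]]. destruct (H n) as [r [Hr E']]. exists (q * r).
    split; [apply Rmult_lt_0_compat; auto|].
    rewrite !gamma_ratio_succ, RtoC_mult, <- E, <- E' by auto. ring. }
  assert (PP : forall n, P (n + 1)%Z -> P n).
  { intros n [q [Hq E]]. destruct (H n) as [r [Hr E']]. exists (q / r).
    split; [apply Rdiv_lt_0_compat; auto|].
    rewrite !gamma_ratio_succ in E by auto. rewrite RtoC_div by lra. rewrite <- E, <- E'.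
    field. split; auto. }
  assert (PN : P N).
  { destruct (Z_le_dec 0 N).
    - replace N with (Z.of_nat (Z.to_nat N)) by lia. induction (Z.to_nat N) as [|n IH]; auto.
      rewrite Nat2Z.inj_succ. apply PS; auto.
    - replace N with (- Z.of_nat (Z.to_nat (- N)))%Z by lia.
      induction (Z.to_nat (- N)) as [|n' IH]; auto.
      apply PP. replace (- Z.of_nat (S n') + 1)%Z with (- Z.of_nat n')%Z by lia. auto. }
  destruct PN as [q [Hq E]]. exists (sqrt q). split; [apply sqrt_lt_R0; auto|].
  rewrite sqrt_sqrt by lra. auto.
Qed.

(** The reflection changes each ratio by the sign [(-1)^N], which cancels in the
    product. *)
Lemma gamma_ratio_reflect_prod a b N : not_int a -> not_int b ->
  not_int (1 - a - IZR N) -> not_int (1 - b - IZR N) ->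
  (gamma_ratio (1 - a - IZR N) N * gamma_ratio (1 - b - IZR N) N =
   gamma_ratio a N * gamma_ratio b N)%C.
Proof.
  intros Ha Hb Ha' Hb'. destruct (Z_le_dec 0 N) as [H|H].
  - replace N with (Z.of_nat (Z.to_nat N)) in * by lia. set (n := Z.to_nat N) in *.
    rewrite !gamma_ratio_nat, <- INR_IZR_INZ, !poch_reflect by auto.
    transitivity (poch a n * poch b n * ((-1) ^ n * (-1) ^ n))%C; [ring|].
    rewrite Cpow_m1_sq. ring.
  - replace N with (- Z.of_nat (Z.to_nat (- N)))%Z in * by lia. set (n := Z.to_nat (- N)) in *.
    rewrite !gamma_ratio_neg by auto.
    assert (E : forall c, (1 - c - IZR (- Z.of_nat n) - INR n)%C = (1 - (c - INR n) - INR n)%C).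
    { intros c. rewrite opp_IZR, RtoC_opp, <- INR_IZR_INZ. ring. }
    rewrite !E, !poch_reflect.
    assert (Hp : forall c, not_int c -> poch (c - INR n) n <> 0).
    { intros c Hc. rewrite INR_IZR_INZ.
      apply poch_neq0, not_int_not_nonpos, not_int_minus, Hc. }
    assert (Hm : ((-1) ^ n)%C <> 0).
    { apply Cpow_nz. intros E1. injection E1. lra. }
    transitivity (/ (poch (a - INR n) n * poch (b - INR n) n * ((-1) ^ n * (-1) ^ n)))%C.
    + field. auto.
    + rewrite Cpow_m1_sq. field. auto.
Qed.

(** * The functions psi *)

(** For [N + k < 0] the right-hand side vanishes through the pole of Gamma. *)
Lemma binz_gamma_ratio s a N k : 0 < s -> not_int a ->
  binz s a (N + Z.of_nat k) =
  (gamma_ratio a N * Rpower s (IZR N) * (poch (a + IZR N) k * inv_Gamma_Z (N + 1 + Z.of_nat k) * s ^ k))%C.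
Proof.
  intros Hs Ha. unfold inv_Gamma_Z. destruct (Z_le_dec _ _) as [H|H].
  - rewrite binz_neg by lia. ring.
  - replace (N + Z.of_nat k)%Z with (Z.of_nat (Z.to_nat (N + Z.of_nat k))) by lia.
    replace (Z.to_nat (N + 1 + Z.of_nat k - 1)) with (Z.to_nat (N + Z.of_nat k)) by (f_equal; lia).
    set (n := Z.to_nat (N + Z.of_nat k)). rewrite binz_nat. unfold binc.
    assert (E : poch a n = (gamma_ratio a N * poch (a + IZR N) k)%C).
    { rewrite <- !gamma_ratio_nat, <- gamma_ratio_add by (auto; apply not_int_shift; auto).
      f_equal. lia. }
    assert (Es : (RtoC s ^ n = Rpower s (IZR N) * s ^ k)%C).
    { rewrite !Cpow_RtoC, <- RtoC_mult. f_equal. rewrite <- !Rpower_pow, <- Rpower_plus by auto.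
      f_equal. rewrite !INR_IZR_INZ, <- plus_IZR. f_equal. lia. }
    rewrite E, Es. unfold Cdiv. ring.
Qed.

Lemma laurent_exists s a b : 0 < s < 1 -> exists g, laurent s a b g.
Proof.
  intros Hs. exists (fun n => epsilon (inhabits (RtoC 0))
     (fun v => has_sum (fun k => binz s a (n + k) * binz s b k)%C v)).
  intros n. apply epsilon_spec, abs_summable_has_sum, laurent_summable_row; auto.
Qed.

Lemma laurent_hyp s xi a b g N v : 0 < s -> s * s = xi -> not_int a ->
  laurent s a b g ->
  has_sum (fun n => reg_coeff b (a + IZR N) (N + 1) n * xi ^ n)%C v ->
  g N = (gamma_ratio a N * Rpower s (IZR N) * v)%C.
Proof.
  intros Hs Hx Ha Hg Hv. eapply has_sum_unique; [apply (Hg N)|].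
  apply (has_sum_inj Z.of_nat (fun k => binz s a (N + k) * binz s b k)%C).
  - intros; lia.
  - intros u Hu. rewrite (binz_outside s b) by auto. ring.
  - eapply has_sum_ext; [|apply has_sum_scal; exact Hv].
    intros n. cbv beta. rewrite binz_gamma_ratio, binz_nat by auto.
    unfold reg_coeff, binc. rewrite <- Hx, RtoC_mult, Cpow_mult_l.
    unfold Cdiv. ring.
Qed.

Lemma hyp2F1_coeff_sym A B c : hyp2F1_coeff A B c = hyp2F1_coeff B A c.
Proof.
  apply functional_extensionality. intros n. unfold hyp2F1_coeff. f_equal. ring.
Qed.

Lemma hyp2F1_div_Gamma_sym A B c w : hyp2F1_div_Gamma A B c w = hyp2F1_div_Gamma B A c w.
Proof.
  assert (E : forall c, hyp2F1 A B c w = hyp2F1 B A c w).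
  { intros c'. unfold hyp2F1, is_hyp2F1. rewrite (hyp2F1_coeff_sym A B). reflexivity. }
  unfold hyp2F1_div_Gamma. rewrite E.
  replace (fun c' => (hyp2F1 A B c' w / CGamma c')%C) with (fun c' => (hyp2F1 B A c' w / CGamma c')%C); auto.
  apply functional_extensionality. intros c'. rewrite E. reflexivity.
Qed.

Lemma psi_swap z z' xi a x : psi z z' xi a x = psi z' z xi a x.
Proof.
  unfold psi. rewrite (hyp2F1_div_Gamma_sym (- z + hval a + / 2)).
  rewrite (Cmult_comm (CGamma (hval x + z + / 2))), (Cmult_comm (CGamma (z - hval a + / 2))).
  rewrite (Cplus_comm z z'). reflexivity.
Qed.

Lemma pos_sqrt_eq (g : C) r : 0 < r -> g = RtoC (r * r) -> pos_sqrt g = r.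
Proof.
  intros Hr E. apply (iota_unique (V := R_CompleteNormedModule)); auto.
  intros y [Hy Ey]. rewrite E in Ey. injection Ey. intros H. nra.
Qed.

Lemma RtoC_half : (/ 2)%C = RtoC (/ 2).
Proof. rewrite RtoC_inv; auto. Qed.

Lemma hval_C i : RtoC (hval (HalfInt i)) = (IZR i + / 2)%C.
Proof. unfold hval; simpl. rewrite RtoC_plus, RtoC_half. reflexivity. Qed.

Lemma half_plus_half : (/ 2 + / 2)%C = 1.
Proof. rewrite RtoC_half, <- RtoC_plus. f_equal. field. Qed.

(** With [a = j + 1/2], [x = i + 1/2], so that [N = x + a = i + j + 1]. *)
Lemma psi_value z z' xi i j r h v : 0 < xi < 1 -> not_int z -> not_int z' -> 0 < r ->
  (gamma_ratio (z - IZR j) (i + j + 1) * gamma_ratio (z' - IZR j) (i + j + 1))%C = RtoC (r * r) ->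
  has_sum (fun n => binc (z - IZR j - 1) n * xi ^ n)%C h ->
  has_sum (fun n => reg_coeff (IZR j + 1 - z) (z' + IZR i + 1) (i + j + 2) n * xi ^ n)%C v ->
  psi z z' xi (HalfInt j) (HalfInt i) =
  (r * Rpower (sqrt xi) (IZR (i + j + 1)) *
   RCpower (1 - xi) (/ 2 * (z + z') - (IZR j + / 2)) * (h * v))%C.
Proof.
  intros Hx Hz Hz' Hr Hg Hh Hv. unfold psi. rewrite !hval_C.
  assert (Hh2 := half_plus_half).
  repeat match goal with |- (?a * ?b)%C = (?c * ?d)%C => apply f_equal2 end.
  - f_equal. apply pos_sqrt_eq; auto. rewrite <- Hg. unfold gamma_ratio.
    assert (Ex : forall u : C, (IZR i + / 2 + u + / 2)%C = (u - IZR j + IZR (i + j + 1))%C).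
    { intros u. rewrite !plus_IZR, !RtoC_plus, <- Hh2. ring. }
    assert (Ea : forall u : C, (u - (IZR j + / 2) + / 2)%C = (u - IZR j)%C) by (intros; ring).
    rewrite !Ex, !Ea.
    assert (Hn : forall u, not_int u -> CGamma (u - IZR j) <> 0).
    { intros u Hu. apply CGamma_neq0, not_int_not_nonpos, not_int_minus, Hu. }
    field. auto.
  - f_equal. rewrite <- Rpower_sqrt by lra. rewrite Rpower_mult. f_equal.
    unfold hval; simpl. rewrite !plus_IZR. field.
  - reflexivity.
  - replace (IZR i + / 2 + (IZR j + / 2) + 1)%C with (RtoC (IZR (i + j + 2))).
    2:{ rewrite RtoC_half, <- !RtoC_plus, !plus_IZR. f_equal. field. }
    apply hyp2F1_div_Gamma_value; auto.
    + eapply has_sum_ext; [|exact Hh]. intros n. cbv beta.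
      replace (- (- z + (IZR j + / 2) + / 2))%C with (z - IZR j - 1)%C; auto.
      rewrite <- Hh2. ring.
    + eapply has_sum_ext; [|exact Hv]. intros n. cbv beta.
      replace (- z + (IZR j + / 2) + / 2)%C with (IZR j + 1 - z)%C by (rewrite <- Hh2; ring).
      replace (IZR (i + j + 2) - (- z' + (IZR j + / 2) + / 2))%C with (z' + IZR i + 1)%C; auto.
      rewrite !plus_IZR, !RtoC_plus. field.
Qed.

Lemma admissible_sum_real z z' : admissible z z' -> exists t : R, (z + z')%C = RtoC t.
Proof.
  intros H. destruct (H 0%Z) as [p [_ Hp]]. destruct (H 1%Z) as [q [_ Hq]].
  exists (q - p - 1). rewrite !RtoC_minus, <- Hp, <- Hq. ring.
Qed.

Lemma RCpower_RtoC t u : RCpower t (RtoC u) = RtoC (exp (u * ln t)).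
Proof. rewrite RCpower_cexp, <- RtoC_mult, cexp_R. do 2 f_equal. ring. Qed.

Lemma Cmod_xi_lt1 (xi : R) : 0 < xi < 1 -> Cmod xi < 1.
Proof. intros Hx. rewrite Cmod_R, Rabs_pos_eq; lra. Qed.

Lemma binc_sum_exists a xi : 0 < xi < 1 -> exists h, has_sum (fun n => binc a n * RtoC xi ^ n)%C h.
Proof.
  intros Hx. apply abs_summable_has_sum, binc_summable, Cmod_xi_lt1, Hx.
Qed.

Lemma reg_sum_exists A D c xi : 0 < xi < 1 ->
  exists v, has_sum (fun n => reg_coeff A D c n * RtoC xi ^ n)%C v.
Proof. intros Hx. apply abs_summable_has_sum, reg_coeff_summable; auto. Qed.

Lemma admissible_minus z z' j : admissible z z' -> admissible (z - IZR j) (z' - IZR j).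
Proof.
  intros H k. destruct (H (k - j)%Z) as [r [Hr E]]. exists r. split; auto.
  rewrite <- E, minus_IZR, RtoC_minus. ring.
Qed.

(** Applying Pfaff's transformation on either side turns
    [psi_a(x; z, z')] and [psi_x(a; -z, -z')] into the same series. *)
Lemma psi_duality z z' xi i j : 0 < xi < 1 -> admissible z z' ->
  psi z z' xi (HalfInt j) (HalfInt i) = psi (- z) (- z') xi (HalfInt i) (HalfInt j).
Proof.
  intros Hx H.
  assert (Hz := admissible_not_int _ _ H).
  assert (Hz' := admissible_not_int _ _ (admissible_swap _ _ H)).
  assert (Ho := admissible_opp _ _ H).
  assert (Hoz := admissible_not_int _ _ Ho).
  assert (Hoz' := admissible_not_int _ _ (admissible_swap _ _ Ho)).
  destruct (gamma_ratio_pos _ _ (i + j + 1) (admissible_minus _ _ j H)) as [r [Hr Er]].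
  destruct (binc_sum_exists (z - IZR j - 1) xi Hx) as [h Hh].
  destruct (reg_sum_exists (IZR j + 1 - z) (z' + IZR i + 1) (i + j + 2) xi Hx) as [v Hv].
  destruct (admissible_sum_real _ _ H) as [t Et].
  rewrite (psi_value z z' xi i j r h v); auto.
  set (rho := - (IZR i - IZR j + t)).
  assert (Hrho := binomial_series rho xi Hx).
  assert (Hh2 := binc_sum_mult _ _ _ _ _ (Cmod_xi_lt1 xi Hx) Hh Hrho).
  rewrite (psi_swap (- z)).
  rewrite (psi_value (- z') (- z) xi j i r (h * exp (- rho * ln (1 - xi))) v); auto.
  - replace (j + i + 1)%Z with (i + j + 1)%Z by lia.
    replace (/ 2 * (z + z') - (IZR j + / 2))%C with (RtoC (t / 2 - (IZR j + / 2))).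
    2:{ rewrite Et, RtoC_half, <- RtoC_mult, <- RtoC_plus, <- RtoC_minus. f_equal. field. }
    replace (/ 2 * (- z' + - z) - (IZR i + / 2))%C with (RtoC (- t / 2 - (IZR i + / 2))).
    2:{ replace (- z' + - z)%C with (- (z + z'))%C by ring.
        rewrite Et, RtoC_half, <- RtoC_opp, <- RtoC_mult, <- RtoC_plus, <- RtoC_minus.
        f_equal. field. }
    rewrite !RCpower_RtoC.
    assert (E : exp ((t / 2 - (IZR j + / 2)) * ln (1 - xi)) =
       exp ((- t / 2 - (IZR i + / 2)) * ln (1 - xi)) * exp (- rho * ln (1 - xi))).
    { rewrite <- exp_plus. f_equal. unfold rho. field. }
    rewrite E, RtoC_mult. ring.
  - replace (j + i + 1)%Z with (i + j + 1)%Z by lia.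
    rewrite <- Er. rewrite (Cmult_comm (gamma_ratio (z - IZR j) _)).
    assert (E : forall u, (- u - IZR i)%C = (1 - (u - IZR j) - IZR (i + j + 1))%C).
    { intros u. rewrite !plus_IZR, !RtoC_plus. ring. }
    rewrite !E. apply gamma_ratio_reflect_prod; auto using not_int_minus.
    + rewrite <- E. apply not_int_minus; auto.
    + rewrite <- E. apply not_int_minus; auto.
  - eapply has_sum_ext; [|exact Hh2]. intros n. cbv beta. f_equal. f_equal.
    unfold rho. rewrite RtoC_opp, RtoC_plus, RtoC_minus, <- Et. ring.
  - replace (j + i + 2)%Z with (i + j + 2)%Z by lia.
    eapply has_sum_ext; [|exact Hv]. intros n. unfold reg_coeff.
    replace (IZR i + 1 - - z')%C with (z' + IZR i + 1)%C by ring.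
    replace (- z + IZR j + 1)%C with (IZR j + 1 - z)%C by ring. unfold Cdiv. ring.
Qed.

(** [psi] as a multiple of Laurent coefficients of
    [(1 - s omega)^(j - z') (1 - s/omega)^(z - j - 1)], [s = sqrt xi]. *)
Lemma psi_laurent z z' xi i j r h g : 0 < xi < 1 -> admissible z z' -> 0 < r ->
  (gamma_ratio (z - IZR j) (i + j + 1) * gamma_ratio (z' - IZR j) (i + j + 1))%C = RtoC (r * r) ->
  has_sum (fun n => binc (z - IZR j - 1) n * xi ^ n)%C h ->
  laurent (sqrt xi) (z' - IZR j) (IZR j + 1 - z) g ->
  psi z z' xi (HalfInt j) (HalfInt i) =
  (RCpower (1 - xi) (/ 2 * (z + z') - (IZR j + / 2)) * h *
   (r / gamma_ratio (z' - IZR j) (i + j + 1)) * g (i + j + 1)%Z)%C.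
Proof.
  intros Hx H Hr Er Hh Hg.
  assert (Hz := admissible_not_int _ _ H).
  assert (Hz' := admissible_not_int _ _ (admissible_swap _ _ H)).
  destruct (reg_sum_exists (IZR j + 1 - z) (z' + IZR i + 1) (i + j + 2) xi Hx) as [v Hv].
  rewrite (psi_value z z' xi i j r h v); auto.
  assert (Hn := not_int_minus _ j Hz').
  rewrite (laurent_hyp (sqrt xi) xi (z' - IZR j) (IZR j + 1 - z) g (i + j + 1) v); auto.
  - field. apply gamma_ratio_neq0; auto.
  - apply sqrt_lt_R0; lra.
  - apply sqrt_sqrt; lra.
  - eapply has_sum_ext; [|exact Hv]. intros n. cbv beta.
    replace (i + j + 1 + 1)%Z with (i + j + 2)%Z by lia.
    replace (z' - IZR j + IZR (i + j + 1))%C with (z' + IZR i + 1)%C; auto.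
    rewrite !plus_IZR, !RtoC_plus. ring.
Qed.

(** One of the two functions is expanded as it stands and the other one with
    [z] and [z'] exchanged: then the Gamma factors that depend on [x] cancel
    in the product, and the biorthogonality of the Laurent coefficients
    applies. *)
Lemma psi_orthonormal z z' xi j k : 0 < xi < 1 -> admissible z z' ->
  abs_summable (fun i => psi z z' xi (HalfInt j) (HalfInt i) * psi z z' xi (HalfInt k) (HalfInt i))%C /\
  has_sum (fun i => psi z z' xi (HalfInt j) (HalfInt i) * psi z z' xi (HalfInt k) (HalfInt i))%C
    (if Z.eq_dec j k then RtoC 1 else RtoC 0).
Proof.
  intros Hx H.
  assert (H' := admissible_swap _ _ H).
  assert (Hz := admissible_not_int _ _ H). assert (Hz' := admissible_not_int _ _ H').
  set (s := sqrt xi).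
  assert (Hs0 : 0 < s) by (apply sqrt_lt_R0; lra).
  assert (Hss : s * s = xi) by (apply sqrt_sqrt; lra).
  assert (Hs : 0 < s < 1) by nra.
  destruct (binc_sum_exists (z - IZR j - 1) xi Hx) as [h Hh].
  destruct (binc_sum_exists (z' - IZR k - 1) xi Hx) as [h' Hh'].
  destruct (laurent_exists s (z' - IZR j) (IZR j + 1 - z) Hs) as [g Hg].
  destruct (laurent_exists s (z - IZR k) (IZR k + 1 - z') Hs) as [g' Hg'].
  set (d := (j - k)%Z).
  destruct (gamma_ratio_pos _ _ d (admissible_minus _ _ j H)) as [t [Ht Et]].
  set (Kj := RCpower (1 - xi) (/ 2 * (z + z') - (IZR j + / 2))).
  set (Kk := RCpower (1 - xi) (/ 2 * (z + z') - (IZR k + / 2))).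
  set (K := (Kj * h * (Kk * h') * (t / gamma_ratio (z' - IZR j) d))%C).
  assert (E : forall i, (psi z z' xi (HalfInt j) (HalfInt i) * psi z z' xi (HalfInt k) (HalfInt i))%C =
     (K * (g (i + j + 1)%Z * g' (i + j + 1 - d)%Z))%C).
  { intros i.
    destruct (gamma_ratio_pos _ _ (i + k + 1) (admissible_minus _ _ k H)) as [r [Hr Er]].
    assert (Hsp : forall u, not_int u -> gamma_ratio (u - IZR j) (i + j + 1) =
       (gamma_ratio (u - IZR j) d * gamma_ratio (u - IZR k) (i + k + 1))%C).
    { intros u Hu. replace (i + j + 1)%Z with (d + (i + k + 1))%Z by (unfold d; lia).
      rewrite gamma_ratio_add by (apply not_int_minus; auto). do 2 f_equal.
      unfold d. rewrite minus_IZR, RtoC_minus. ring. }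
    assert (Etr : (gamma_ratio (z - IZR j) (i + j + 1) * gamma_ratio (z' - IZR j) (i + j + 1))%C =
       RtoC ((t * r) * (t * r))).
    { rewrite !Hsp by auto.
      replace (t * r * (t * r)) with (t * t * (r * r)) by ring.
      rewrite RtoC_mult, <- Et, <- Er. ring. }
    assert (Er' : (gamma_ratio (z' - IZR k) (i + k + 1) * gamma_ratio (z - IZR k) (i + k + 1))%C = RtoC (r * r))
      by (rewrite <- Er; ring).
    rewrite (psi_laurent z z' xi i j (t * r) h g); auto; [|apply Rmult_lt_0_compat; auto].
    rewrite (psi_swap z z' xi (HalfInt k)).
    rewrite (psi_laurent z' z xi i k r h' g'); auto.
    rewrite (Cplus_comm z' z). fold Kj Kk.
    replace (i + j + 1 - d)%Z with (i + k + 1)%Z by (unfold d; lia).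
    rewrite Hsp by auto. unfold K.
    assert (N1 := gamma_ratio_neq0 _ d (not_int_minus _ j Hz')).
    assert (N2 := gamma_ratio_neq0 _ (i + k + 1) (not_int_minus _ k Hz')).
    assert (N3 := gamma_ratio_neq0 _ (i + k + 1) (not_int_minus _ k Hz)).
    set (u1 := gamma_ratio (z' - IZR j) d) in *.
    set (u2 := gamma_ratio (z' - IZR k) (i + k + 1)) in *.
    set (u3 := gamma_ratio (z - IZR k) (i + k + 1)) in *.
    rewrite RtoC_mult.
    transitivity (Kj * h * (Kk * h') * (t / u1) * (r * r / (u2 * u3)) * (g (i + j + 1)%Z * g' (i + k + 1)%Z))%C.
    { field. auto. }
    rewrite <- (RtoC_mult r r), <- Er'. fold u2 u3. field. auto. }
  destruct (laurent_biorthogonal s (z' - IZR j) (IZR j + 1 - z) (z - IZR k) (IZR k + 1 - z') d g g' Hs Hg Hg')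
    as [Sg Eg].
  { unfold d. rewrite minus_IZR, RtoC_minus. ring. }
  { unfold d. rewrite minus_IZR, RtoC_minus. ring. }
  assert (B1 : forall i, (i + j + 1 - j - 1)%Z = i) by (intros; lia).
  assert (B2 : forall i, (i - j - 1 + j + 1)%Z = i) by (intros; lia).
  split.
  - eapply abs_summable_le; [|apply (abs_summable_scal (fun i => g (i + j + 1)%Z * g' (i + j + 1 - d)%Z)%C K)].
    + intros i. rewrite E. apply Rle_refl.
    + apply (abs_summable_inj (fun i => (i + j + 1)%Z) (fun n => g n * g' (n - d)%Z)%C); auto.
      intros; lia.
  - apply (has_sum_bij (fun i => (i + j + 1)%Z) (fun n => (n - j - 1)%Z)) in Eg; auto.
    apply (has_sum_scal K) in Eg. cbv beta in Eg.
    eapply has_sum_ext; [intros i; symmetry; apply E|].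
    replace (if Z.eq_dec j k then RtoC 1 else RtoC 0) with
      (K * (if Z.eq_dec d 0 then RtoC (/ (1 - s ^ 2)) else RtoC 0))%C; auto.
    destruct (Z.eq_dec j k) as [Ejk|Hjk]; destruct (Z.eq_dec d 0) as [Hd|Hd];
      try (exfalso; unfold d in *; lia); [|ring].
    (* the normalization: Kj^2 h h' = 1 - xi *)
    subst k. unfold K. rewrite Hd in Et |- *.
    rewrite gamma_ratio_0 in Et |- * by (apply not_int_minus; auto).
    rewrite gamma_ratio_0 in Et by (apply not_int_minus; auto).
    assert (Et1 : t = 1).
    { rewrite Cmult_1_l in Et. injection Et. intros Et1. nra. }
    destruct (admissible_sum_real _ _ H) as [q Eq].
    assert (HK : Kj = RtoC (exp ((q / 2 - (IZR j + / 2)) * ln (1 - xi)))).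
    { unfold Kj. rewrite <- RCpower_RtoC. f_equal.
      rewrite Eq, RtoC_half, <- RtoC_mult, <- RtoC_plus, <- RtoC_minus. f_equal. field. }
    assert (Hhh : (h * h')%C = RtoC (exp (- (q - 2 * IZR j - 2) * ln (1 - xi)))).
    { eapply has_sum_unique; [|apply binomial_series; exact Hx].
      eapply has_sum_ext; [|apply (binc_sum_mult _ _ _ _ _ (Cmod_xi_lt1 xi Hx) Hh Hh')].
      intros n. cbv beta. f_equal. f_equal.
      rewrite !RtoC_minus, RtoC_mult, <- Eq.
      replace (RtoC 2) with (RtoC 1 + RtoC 1)%C; [ring|]. rewrite <- RtoC_plus. f_equal; lra. }
    change Kk with Kj.
    transitivity (Kj * Kj * (h * h') * (t / 1) * / (1 - s ^ 2))%C.
    { rewrite RtoC_inv by nra. rewrite !RtoC_minus, RtoC_pow. ring. }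
    rewrite Hhh, HK, Et1, <- !RtoC_mult, <- !exp_plus.
    replace ((q / 2 - (IZR j + / 2)) * ln (1 - xi) + (q / 2 - (IZR j + / 2)) * ln (1 - xi) +
      - (q - 2 * IZR j - 2) * ln (1 - xi)) with (ln (1 - xi)) by field.
    rewrite exp_ln by lra.
    replace (1 - xi) with (1 - s ^ 2) by (rewrite <- Hss; ring).
    rewrite RtoC_minus, RtoC_pow. field.
    rewrite <- RtoC_pow, <- RtoC_minus. apply RtoC_neq0. nra.
Qed.

(** ** Reality *)

Lemma Cconj_RtoC x : Cconj (RtoC x) = RtoC x.
Proof. unfold Cconj, RtoC; simpl. f_equal. ring. Qed.

Lemma has_sum_Cconj {T} (f : T -> C) s : has_sum f s -> has_sum (fun t => Cconj (f t)) (Cconj s).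
Proof.
  intros H eps He. destruct (H eps He) as [l0 H0]. exists l0. intros l Hl Hi.
  rewrite <- Cconj_csum, <- Cminus_conj, Cmod_conj. auto.
Qed.

Lemma Cconj_poch a n : Cconj (poch a n) = poch (Cconj a) n.
Proof.
  induction n as [|n IH]; simpl; [apply Cconj_RtoC|].
  rewrite Cmult_conj, IH, Cplus_conj, Cconj_RtoC. reflexivity.
Qed.

Lemma Cconj_reg_coeff A D c n : Cconj (reg_coeff A D c n) = reg_coeff (Cconj A) (Cconj D) c n.
Proof.
  unfold reg_coeff, Cdiv. rewrite !Cmult_conj, !Cconj_poch.
  rewrite <- RtoC_inv, Cconj_RtoC by apply INR_fact_neq_0. f_equal.
  unfold inv_Gamma_Z. destruct (Z_le_dec _ _); [apply Cconj_RtoC|].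
  rewrite <- RtoC_inv by apply INR_fact_neq_0. apply Cconj_RtoC.
Qed.

Lemma Cconj_binc a n : Cconj (binc a n) = binc (Cconj a) n.
Proof.
  unfold binc, Cdiv. rewrite Cmult_conj, Cconj_poch, <- RtoC_inv, Cconj_RtoC by apply INR_fact_neq_0.
  reflexivity.
Qed.

(** Complex conjugation fixes or exchanges the two parameters, and [psi] is
    symmetric in them. *)
Lemma psi_real z z' xi a x : 0 < xi < 1 -> admissible z z' ->
  (Cconj z = z /\ Cconj z' = z') \/ (Cconj z = z' /\ Cconj z' = z) ->
  Cconj (psi z z' xi a x) = psi z z' xi a x.
Proof.
  intros Hx H Hc. destruct a as [j], x as [i].
  assert (Hz := admissible_not_int _ _ H).
  assert (Hz' := admissible_not_int _ _ (admissible_swap _ _ H)).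
  destruct (gamma_ratio_pos _ _ (i + j + 1) (admissible_minus _ _ j H)) as [r [Hr Er]].
  destruct (binc_sum_exists (z - IZR j - 1) xi Hx) as [h Hh].
  destruct (reg_sum_exists (IZR j + 1 - z) (z' + IZR i + 1) (i + j + 2) xi Hx) as [v Hv].
  destruct (admissible_sum_real _ _ H) as [t Et].
  assert (Hpsi : psi (Cconj z) (Cconj z') xi (HalfInt j) (HalfInt i) = psi z z' xi (HalfInt j) (HalfInt i)).
  { destruct Hc as [[-> ->]|[-> ->]]; auto. apply psi_swap. }
  assert (Hni : not_int (Cconj z) /\ not_int (Cconj z')).
  { destruct Hc as [[-> ->]|[-> ->]]; auto. }
  assert (Hgr : (gamma_ratio (Cconj z - IZR j) (i + j + 1) * gamma_ratio (Cconj z' - IZR j) (i + j + 1))%C = RtoC (r * r)).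
  { destruct Hc as [[-> ->]|[-> ->]]; auto. rewrite <- Er. ring. }
  assert (Hsum : (Cconj z + Cconj z')%C = RtoC t).
  { rewrite <- Et. destruct Hc as [[-> ->]|[-> ->]]; ring. }
  rewrite <- Hpsi at 2. destruct Hni as [Hni Hni'].
  rewrite (psi_value z z' xi i j r h v); auto.
  rewrite (psi_value (Cconj z) (Cconj z') xi i j r (Cconj h) (Cconj v)); auto.
  - rewrite Et, Hsum.
    replace (/ 2 * t - (IZR j + / 2))%C with (RtoC (/ 2 * t - (IZR j + / 2))).
    2:{ rewrite RtoC_minus, RtoC_plus, RtoC_mult, RtoC_half. reflexivity. }
    rewrite RCpower_RtoC, !Cmult_conj, !Cconj_RtoC. reflexivity.
  - eapply has_sum_ext; [|apply has_sum_Cconj, Hh]. intros n. cbv beta.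
    rewrite Cmult_conj, Cconj_binc, Cpow_RtoC, !Cminus_conj, !Cconj_RtoC. reflexivity.
  - eapply has_sum_ext; [|apply has_sum_Cconj, Hv]. intros n. cbv beta.
    rewrite Cmult_conj, Cconj_reg_coeff, Cpow_RtoC, Cminus_conj, !Cplus_conj, !Cconj_RtoC. reflexivity.
Qed.

(** ** The basis property *)

Theorem proposition2p4 :
  forall (xi : R) (z z' : C),
    (0 < xi < 1)%R ->
    principal_series z z' \/ complementary_series z z' ->
    l2_orthonormal_basis (fun a : half_integer => psi z z' xi a).
Proof.
  intros xi z z' Hx Hzz.
  assert (H : admissible z z').
  { destruct Hzz; [apply admissible_principal|apply admissible_complementary]; auto. }
  assert (Hc : (Cconj z = z /\ Cconj z' = z') \/ (Cconj z = z' /\ Cconj z' = z)).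
  { destruct Hzz as [[_ ->]|[Hi [Hi' _]]].
    - right. split; auto. apply Cconj_conj.
    - left. destruct z as [u w], z' as [u' w']. simpl in Hi, Hi'. subst.
      unfold Cconj; simpl. split; f_equal; ring. }
  replace (fun a => psi z z' xi a)
    with (fun a x => psi z z' xi (HalfInt (hfloor a)) (HalfInt (hfloor x))).
  2:{ apply functional_extensionality; intros [j].
      apply functional_extensionality; intros [i]. reflexivity. }
  apply (orthonormal_basis_of_matrix (fun j i => psi z z' xi (HalfInt j) (HalfInt i))).
  - intros j i. apply psi_real; auto.
  - intros j k. apply psi_orthonormal; auto.
  - intros i.
    destruct (psi_orthonormal (- z) (- z') xi i i Hx (admissible_opp _ _ H)) as [_ E].
    destruct (Z.eq_dec i i) as [_|]; [|congruence].
    eapply has_sum_ext; [|exact E]. intros j. cbv beta.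
    rewrite (psi_duality z z' xi i j) by auto. reflexivity.
Qed.
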